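(* Let $\varepsilon_0>0$, $N\in\mathbb{Z}_+=\{0,1,2,\dots\}$, and $f\in\mathfrak{W}^N_{\varepsilon_0}$. Then for every $\varepsilon$ with $0<\varepsilon<\varepsilon_0$ the function $\mathbf{B}_\varepsilon(\,\cdot\,;f)$ belongs to $\Lambda_{\varepsilon,f}$, and moreover $$\mathbf{B}_\varepsilon(x;f)=\inf_{G\in\Lambda_{\varepsilon,f}}G(x),\qquad x\in\Omega_\varepsilon .$$
   Context: For a bounded interval $J\subset\mathbb{R}$, $\langle\varphi\rangle_J=\frac1{|J|}\int_J\varphi$. For an interval $I$, $\mathrm{BMO}_\varepsilon(I)$ is the set of $\varphi\in L^1(I)$ with $\sup_{J\subset I}\langle|\varphi-\langle\varphi\rangle_J|^2\rangle_J\le\varepsilon^2$, the supremum being over subintervals $J$ of $I$. Parabolic strip: $\Omega_\varepsilon=\{(x_1,x_2)\in\mathbb{R}^2: x_1^2\le x_2\le x_1^2+\varepsilon^2\}$. Bellman function: for $x=(x_1,x_2)\in\Omega_\varepsilon$, $$\mathbf{B}_\varepsilon(x;f)=\sup_{\varphi\in\mathrm{BMO}_\varepsilon(I)}\{\langle f\circ\varphi\rangle_I:\ \langle\varphi\rangle_I=x_1,\ \langle\varphi^2\rangle_I=x_2\}$$ (it does not depend on the choice of $I$). $\mathfrak{W}_{\varepsilon_0}=C^2(\mathbb{R})\cap W^1_3(\mathbb{R},w_{\varepsilon_0})$ with $w_{\varepsilon_0}(t)=e^{-|t|/\varepsilon_0}$: the functions $f\in C^2(\mathbb{R})$ having a (weak)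 third derivative such that $f,f',f'',f'''$ are all integrable with weight $w_{\varepsilon_0}$. $\mathfrak{W}^N_{\varepsilon_0}$ is the set of $f\in\mathfrak{W}_{\varepsilon_0}$ for which there are $2N+1$ points $-\infty\le c_0<v_1<c_1<v_2<\dots<v_N<c_N\le+\infty$ such that: (1) $f'''>0$ a.e. on $(v_k,c_k)$ for $1\le k\le N$ and on $(-\infty,c_0)$, and $f'''<0$ a.e. on $(c_k,v_{k+1})$ for $0\le k\le N-1$ and on $(c_N,\infty)$; (2) $|c_k-v_j|\ge2\varepsilon_0$ for all $k,j$. A function $G$ on $\Omega_\varepsilon$ is locally concave if $G(\alpha_-x^-+\alpha_+x^+)\ge\alpha_-G(x^-)+\alpha_+G(x^+)$ for every segment $[x^-,x^+]\subset\Omega_\varepsilon$ and all $\alpha_\pm\ge0$ with $\alpha_-+\alpha_+=1$. $\Lambda_{\varepsilon,f}$ is the set of locally concave $G\in C(\Omega_\varepsilon)$ with $G(u,u^2)=f(u)$ for all $u\in\mathbb{R}$. *)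

(* Defs.v *)
From HB Require Import structures.
From mathcomp Require Import all_boot all_order all_algebra.
From mathcomp Require Import all_classical all_reals all_analysis.

Set Implicit Arguments.
Unset Strict Implicit.
Unset Printing Implicit Defensive.

Import Order.TTheory GRing.Theory Num.Theory.
Import numFieldNormedType.Exports.

Local Open Scope classical_set_scope.
Local Open Scope ring_scope.

Section Averages.
Context {R : realType}.
Local Notation mu := (@lebesgue_measure R).

(* The intervals over which averages are taken: finite positive length, with
   any choice of open or closed endpoints. *)
Definition bounded_interval (J : interval R) : Prop :=
  (0 < mu [set` J] < +oo)%E.

(* Extended-real valued, as [g] need not be integrable over [J]
   (e.g. the square of a function of [L^1]). *)
Definition avg (J : interval R) (g : R -> R) : \bar R :=
  (((fine (mu [set` J]))^-1)%R%:E * \int[mu]_(t in [set` J]) (g t)%:E)%E.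

Definition mean_oscillation2 (J : interval R) (phi : R -> R) : \bar R :=
  avg J (fun t => `|phi t - fine (avg J phi)| ^+ 2).

Definition BMO (eps : R) (I : interval R) : set (R -> R) :=
  [set phi : R -> R | mu.-integrable [set` I] (EFin \o phi) /\
    (ereal_sup [set mean_oscillation2 J phi
               | J in [set J : interval R |
                        bounded_interval J /\ [set` J] `<=` [set` I]]]
     <= (eps ^+ 2)%:E)%E].

Definition Omega (eps : R) : set (R * R) :=
  [set x | x.1 ^+ 2 <= x.2 <= x.1 ^+ 2 + eps ^+ 2].

Definition Bellman (I : interval R) (eps : R) (f : R -> R) (x : R * R) :
    \bar R :=
  ereal_sup [set avg I (f \o phi)
            | phi in [set phi : R -> R | [/\ BMO eps I phi,
                avg I phi = x.1%:E &
                avg I (fun t => phi t ^+ 2) = x.2%:E]]].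

End Averages.

Section FunctionClasses.
Context {R : realType}.
Local Notation mu := (@lebesgue_measure R).

Definition C2 (f : R -> R) : Prop :=
  [/\ forall t, derivable f t 1, forall t, derivable (derive1 f) t 1 &
      continuous (derive1n 2 f)].

Definition test_function (psi : R -> R) : Prop :=
  (forall n t, derivable (derive1n n psi) t 1) /\
  (exists M : R, forall t, M < `|t| -> psi t = 0).

Definition weak_derivative (n : nat) (f g : R -> R) : Prop :=
  [/\ locally_integrable [set: R] f, locally_integrable [set: R] g &
      forall psi, test_function psi ->
        \int[mu]_t (f t * derive1n n psi t) = (-1) ^+ n * \int[mu]_t (g t * psi t)].

Definition weight (eps0 t : R) : R := expR (- `|t| / eps0).

Definition weighted_integrable (eps0 : R) (g : R -> R) : Prop :=
  mu.-integrable [set: R] (fun t => (g t * weight eps0 t)%:E).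

Definition frakW (eps0 : R) : set (R -> R) :=
  [set f | [/\ C2 f,
    weighted_integrable eps0 f,
    weighted_integrable eps0 (derive1 f),
    weighted_integrable eps0 (derive1n 2 f) &
    exists g : R -> R, weak_derivative 3 f g /\ weighted_integrable eps0 g]].

(* The points are [c 0, ..., c N] and [v 1, ..., v N]; the other values of [c]
   and [v] are irrelevant.  Only [c 0] and [c N] can be infinite, and for
   [N = 0] the single point [c 0] may be either infinity. *)
Definition frakWN (eps0 : R) (N : nat) : set (R -> R) :=
  [set f | frakW eps0 f /\
    exists (g : R -> R) (c : nat -> \bar R) (v : nat -> R),
      [/\ weak_derivative 3 f g,
          forall k, (k < N)%N -> (c k < (v k.+1)%:E < c k.+1)%E,
          [/\ forall k, (1 <= k <= N)%N ->
                {ae mu, forall t, ((v k)%:E < t%:E < c k)%E -> 0 < g t},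
              {ae mu, forall t, (t%:E < c 0%N)%E -> 0 < g t},
              forall k, (k < N)%N ->
                {ae mu, forall t, (c k < t%:E < (v k.+1)%:E)%E -> g t < 0} &
              {ae mu, forall t, (c N < t%:E)%E -> g t < 0}] &
          forall k j, (k <= N)%N -> (1 <= j <= N)%N ->
            ((2 * eps0)%:E <= `|c k - (v j)%:E|)%E]].

End FunctionClasses.

Section LocallyConcave.
Context {R : realType}.

Definition locally_concave (eps : R) (G : R * R -> R) : Prop :=
  forall x y : R * R,
    (forall a b : R, 0 <= a -> 0 <= b -> a + b = 1 ->
       Omega eps (a *: x + b *: y)) ->
    forall a b : R, 0 <= a -> 0 <= b -> a + b = 1 ->
      a * G x + b * G y <= G (a *: x + b *: y).

Definition Lambda (eps : R) (f : R -> R) : set (R * R -> R) :=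
  [set G | [/\ locally_concave eps G,
               {within Omega eps, continuous G} &
               forall u, G (u, u ^+ 2) = f u]].

End LocallyConcave.

(* Main.v *)
Require Import Defs.
From mathcomp Require Import all_boot all_order all_algebra.
From mathcomp Require Import all_classical all_reals all_analysis.
From mathcomp Require Import measurable_realfun ring lra.

Import Order.TTheory GRing.Theory Num.Theory.
Import numFieldNormedType.Exports.

Local Open Scope classical_set_scope.
Local Open Scope ring_scope.

(** Write B for the Bellman function, and let G belong to [Lambda eps f].

    B is at most G.  This is Bellman induction.  If [phi] is bounded and has
    mean oscillation at most [del] < [eps], every interval splits into two
    parts, neither of them too short, such that the segment joining the points
    (mean of [phi], mean of [phi]^2) of the two parts lies in [Omega eps]
    ([bellman_split]).  Concavity of G along these segments says that the
    defect (integral of f o [phi]) - (length) * G(point) can only grow when the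
    interval is split.  On short intervals it is small, up to an additive error
    given by the L^1 distance of [phi] to a continuous function, since the point
    of an interval on which [phi] is nearly constant is close to the lower
    parabola, where G = f ([bounded_bellman]).
    A general [phi] is truncated and multiplied by a factor below 1; the limit
    is legitimate because f grows at most like exp(|t| / eps0)
    ([growth_bound]) and the exponentials exp(k |phi|), k eps < 1, are
    integrable: Bellman induction applies to the explicit locally concave
    function [exp_major], and Fatou's lemma concludes ([bmo_exp_integrable],
    [bmo_bellman]).

    B is itself in [Lambda eps f], so it is the least element and the infimum
    is attained.  The work is in local concavity: if [phi1] and [phi2] are
    admissible for the two ends of a segment in [Omega eps], their concatenation
    need not have small oscillation, but its nondecreasing rearrangement has.
    In terms of laws: call a finitely supported law good when every slice of
    it, that is, its restriction to a subinterval of the quantile line, has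
    variance at most eps^2.  The mixture of two good laws is good as soon as the
    segment joining their (mean, second moment) points lies in [Omega eps]
    ([good_cat]).  Hence the supremum [law_envelope] of the integrals of f
    against good laws is locally concave.  It equals f on the lower parabola,
    it is finite by the bounds above, and it is continuous: along the tangents
    of the upper parabola it is concave and bounded, hence Lipschitz away from
    the lower parabola, and near the lower parabola it is squeezed between a
    chord bound and an exponential bound ([law_envelope_Lambda]).  Finally, the
    quantile function of a good law is admissible ([good_law_step]), so
    [law_envelope] is at most B, while B is at most [law_envelope] because the
    latter is in [Lambda eps f]; the two coincide ([BellmanE]). *)

Set Implicit Arguments.
Unset Strict Implicit.
Unset Printing Implicit Defensive.

(** * Mixtures of laws all of whose slices have small variance *)

Section FiniteLaws.
Context {R : realType}.
Implicit Types (L : seq (R * R)) (S : seq R) (h g k : R -> R) (eps : R).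

(** A finitely supported measure is a list of pairs (weight, value); it is not
    normalised and a value may occur several times. *)
Definition wsum L h : R := \sum_(p <- L) p.1 * h p.2.

Definition nonneg_weights L := forall p, p \in L -> 0 <= p.1.

Definition values_in S L := forall p, p \in L -> p.2 \in S.

Lemma wsum_ext L h g : (forall p, p \in L -> h p.2 = g p.2) -> wsum L h = wsum L g.
Proof. by move=> e; apply: eq_big_seq => p pL; rewrite e. Qed.

Lemma wsumD L h g : wsum L (fun v => h v + g v) = wsum L h + wsum L g.
Proof. by rewrite /wsum -big_split; apply: eq_bigr => p _; rewrite mulrDr. Qed.

Lemma wsumZ L c h : wsum L (fun v => c * h v) = c * wsum L h.
Proof. by rewrite /wsum big_distrr; apply: eq_bigr => p _; rewrite /= mulrCA. Qed.

Lemma wsum_cat L1 L2 h : wsum (L1 ++ L2) h = wsum L1 h + wsum L2 h.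
Proof. by rewrite /wsum big_cat. Qed.

Lemma ler_wsum L h g : nonneg_weights L ->
  (forall p, p \in L -> h p.2 <= g p.2) -> wsum L h <= wsum L g.
Proof.
move=> L0 hg; rewrite /wsum big_seq [leRHS]big_seq; apply: ler_sum => p pL.
by rewrite ler_wpM2l ?L0 ?hg.
Qed.

Lemma wsum_ge0 L h : nonneg_weights L ->
  (forall p, p \in L -> 0 <= h p.2) -> 0 <= wsum L h.
Proof.
by move=> L0 h0; rewrite /wsum big_seq sumr_ge0 // => p pL; rewrite mulr_ge0 ?L0 ?h0.
Qed.

Lemma wsum_le0 L h : nonneg_weights L ->
  (forall p, p \in L -> h p.2 <= 0) -> wsum L h <= 0.
Proof.
move=> L0 h0; rewrite -oppr_ge0 -mulN1r -wsumZ; apply: wsum_ge0 => // p pL.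
by rewrite mulN1r oppr_ge0 h0.
Qed.

Definition cut_bounds k := forall v, 0 <= k v <= 1.

(** Densities of the restrictions of a law with values in [S] to a subinterval
    of its quantile line: strictly between two values that are met, every atom
    is taken entirely; only the lowest and the highest atom met may be taken
    in part. *)
Definition interval_cut S k := cut_bounds k /\
  forall u v w, u \in S -> v \in S -> w \in S ->
    u < v -> v < w -> 0 < k u -> 0 < k w -> k v = 1.

(** The case of an initial interval of the quantile line, which drops the
    values above some level. *)
Definition upper_cut S k := cut_bounds k /\
  forall u v, u \in S -> v \in S -> u < v -> 0 < k v -> k u = 1.

Definition rank S (v : R) : R := (count (fun u => u < v) S)%:R.

(** As [b] grows from [0] to [size S], the atoms of [S] are released one after
    the other in increasing order. *)
Definition ramp S (b v : R) : R := Num.min 1 (Num.max 0 (b - rank S v)).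

Lemma rank_lt S u v : u \in S -> u < v -> rank S u + 1 <= rank S v.
Proof.
move=> uS uv; rewrite /rank natr1 ler_nat.
elim: S uS => //= a S IH; rewrite inE => /orP[/eqP <-|uS].
  rewrite ltxx uv add0n ltnS; apply: sub_count => w wu; exact: lt_trans wu uv.
have := IH uS; case: (ltP a u) => au /=; last by move/leq_trans; apply; rewrite leq_addl.
by rewrite (lt_trans au uv) addSn addnC -addSn addnC addSn.
Qed.

Lemma ramp_upper S b : upper_cut S (ramp S b).
Proof.
split=> [v|u v uS vS uv].
  by rewrite /ramp ge_min lexx /= le_min ler01 /= le_max lexx.
have := rank_lt uS uv; rewrite /ramp => rk.
rewrite lt_min ltr01 /= lt_max ltxx /= subr_gt0 => bv.
by apply/min_idPl; rewrite le_max; apply/orP; right; lra.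
Qed.

Lemma upper_cut_min S k k' : upper_cut S k -> upper_cut S k' ->
  upper_cut S (fun v => Num.min (k v) (k' v)).
Proof.
move=> [b c] [b' c']; split=> [v|u v uS vS uv].
  have /andP[? ?] := b v; have /andP[? ?] := b' v.
  by rewrite le_min ge_min; apply/andP; split; [apply/andP|apply/orP; left].
by rewrite lt_min => /andP[/(c _ _ uS vS uv) -> /(c' _ _ uS vS uv) ->]; rewrite minxx.
Qed.

Lemma upper_cut_max S k k' : upper_cut S k -> upper_cut S k' ->
  upper_cut S (fun v => Num.max (k v) (k' v)).
Proof.
move=> [b c] [b' c']; split=> [v|u v uS vS uv].
  have /andP[? ?] := b v; have /andP[? ?] := b' v.
  by rewrite le_max ge_max; apply/andP; split; [apply/orP; left|apply/andP].
have /andP[? ?] := b u; have /andP[? ?] := b' u.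
by rewrite lt_max => /orP[/(c _ _ uS vS uv) e|/(c' _ _ uS vS uv) e];
  rewrite e; [apply/max_idPl|apply/max_idPr].
Qed.

(** The upper cuts between [k0] and [k1] contain a path that is continuous in
    the parameter of [ramp], so the intermediate value theorem applies. *)
Lemma upper_cut_ivt S L k0 k1 h : values_in S L ->
  upper_cut S k0 -> upper_cut S k1 -> (forall v, k0 v <= k1 v) ->
  wsum L (fun v => k0 v * h v) <= 0 -> 0 <= wsum L (fun v => k1 v * h v) ->
  exists k, [/\ upper_cut S k, forall v, k0 v <= k v <= k1 v &
    wsum L (fun v => k v * h v) = 0].
Proof.
move=> SL c0 c1 k01 h0 h1.
pose k b v := Num.min (Num.max (k0 v) (ramp S b v)) (k1 v).
pose F b := wsum L (fun v => k b v * h v).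
have kcont v : continuous (fun b => k b v).
  move=> b.
  apply: (@continuous_min R R (fun b => Num.max (k0 v) (ramp S b v)) (fun=> k1 v));
    last exact: cvg_cst.
  apply: (@continuous_max R R (fun=> k0 v) (fun b => ramp S b v)); first exact: cvg_cst.
  apply: (@continuous_min R R (fun=> 1) (fun b => Num.max 0 (b - rank S v)));
    first exact: cvg_cst.
  apply: (@continuous_max R R (fun=> 0) (fun b => b - rank S v)); first exact: cvg_cst.
  by apply: cvgB; [exact: cvg_id|exact: cvg_cst].
have Fcont : continuous F.
  rewrite /F /wsum; elim: (L) => [|p l IH] b.
    under eq_fun do rewrite big_nil; exact: cvg_cst.
  under eq_fun do rewrite big_cons.
  apply: cvgD; last exact: IH.
  by apply: cvgM; [exact: cvg_cst|apply: cvgM; [exact: kcont|exact: cvg_cst]].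
have F0 : F 0 = wsum L (fun v => k0 v * h v).
  apply: wsum_ext => p pL; congr (_ * _); rewrite /k /ramp.
  have /andP[k0p _] := c0.1 p.2.
  rewrite (_ : Num.max 0 (0 - rank S p.2) = 0); last first.
    by apply/max_idPl; rewrite sub0r oppr_le0 ler0n.
  rewrite (min_r ler01) (max_l k0p); exact/min_idPl.
have F1 : F (size S)%:R = wsum L (fun v => k1 v * h v).
  apply: wsum_ext => p pL; congr (_ * _); rewrite /k.
  have /andP[_ k0p] := c0.1 p.2; have /andP[_ k1p] := c1.1 p.2.
  have -> : ramp S (size S)%:R p.2 = 1.
    apply/min_idPl; rewrite le_max; apply/orP; right.
    have pS := SL p pL; rewrite lerBrDr addrC natr1 ler_nat -addn1.
    have := count_predC (fun u => u < p.2) S => <-.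
    rewrite leq_add2l -has_count; apply/hasP; exists p.2 => //=.
    by rewrite ltxx.
  by rewrite (max_r k0p); exact/min_idPr.
have [||b _ Fb] := @IVT R F 0 (size S)%:R 0 (ler0n _ _).
- by apply: continuous_subspaceT.
- by rewrite F0 F1 ge_min le_max h0 h1 orbT.
exists (k b); split=> //.
  apply: upper_cut_min => //; apply: upper_cut_max => //; exact: ramp_upper.
move=> v; rewrite /k ge_min lexx orbT andbT le_min k01 andbT le_max lexx //.
Qed.


(** The condition m2/m0 - (m1/m0)^2 <= eps^2 cleared of denominators, so that
    null slices satisfy it. *)
Definition small_variance eps (m0 m1 m2 : R) := m0 * m2 - m1 ^+ 2 <= eps ^+ 2 * m0 ^+ 2.

Definition cut_small eps L k :=
  small_variance eps (wsum L k) (wsum L (fun v => k v * v))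
    (wsum L (fun v => k v * v ^+ 2)).

Definition upper_good eps S L := forall k, upper_cut S k -> cut_small eps L k.

(** The points (mean, second moment) of the slices of [L1] and [L2] span a
    segment on or below the upper parabola; [a] and [b] run over the mixtures. *)
Definition compatible eps L1 L2 k := forall a b, 0 <= a -> 0 <= b ->
  small_variance eps (a * wsum L1 k + b * wsum L2 k)
    (a * wsum L1 (fun v => k v * v) + b * wsum L2 (fun v => k v * v))
    (a * wsum L1 (fun v => k v * v ^+ 2) + b * wsum L2 (fun v => k v * v ^+ 2)).

Lemma seq_max S : S != [::] -> exists2 t, t \in S & forall v, v \in S -> v <= t.
Proof.
elim: S => // a S IH _; have [->|/IH[t tS tm]] := eqVneq S [::].
  by exists a; rewrite ?inE // => v; rewrite inE => /eqP ->.
have [ta|at_] := leP t a.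
  exists a; first by rewrite inE eqxx.
  by move=> v; rewrite inE => /orP[/eqP -> //|/tm vt]; exact: le_trans ta.
exists t; first by rewrite inE tS orbT.
by move=> v; rewrite inE => /orP[/eqP -> |/tm //]; exact: ltW.
Qed.

(** This is v^2 - (m^2 + eps^2) - al (v - m): it is nonnegative exactly when
    (v, v^2) is on or above the line of slope [al] through the point of the
    upper parabola with abscissa [m]. *)
Definition lin eps m al (v : R) := (v - m) ^+ 2 + (m *+ 2 - al) * (v - m) - eps ^+ 2.

(** At [m] the quadratic polynomial [lin] is not positive, so to the right of [m]
    it changes sign at most once, from negative to positive. *)
Lemma lin_ge0_right eps m al t v : m < t -> t <= v ->
  0 <= lin eps m al t -> 0 <= lin eps m al v.
Proof.
rewrite /lin => mt tv; set c := m *+ 2 - al => h.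
have x0 : 0 < t - m by rewrite subr_gt0.
have xy : t - m <= v - m by rewrite lerD2r.
move: (t - m) (v - m) x0 xy h => x y x0 xy h.
have e0 := sqr_ge0 eps.
have xc : 0 <= x + c by rewrite -(pmulr_rge0 _ x0); lra.
have : x * (x + c) <= y * (y + c) by rewrite ler_pM // ?(ltW x0) // lerD2r.
lra.
Qed.

Lemma wsum_lin eps m al L k : wsum L (fun v => k v * lin eps m al v) =
  wsum L (fun v => k v * v ^+ 2) - (m ^+ 2 + eps ^+ 2) * wsum L k
  - al * wsum L (fun v => k v * (v - m)).
Proof.
rewrite (@wsum_ext L _ (fun v => k v * v ^+ 2 + (- (m ^+ 2 + eps ^+ 2)) * k v
  + (- al) * (k v * (v - m)))); last by move=> p _; rewrite /lin; ring.
rewrite (@wsumD L (fun v => _ + _)) (@wsumD L (fun v => k v * _)) !wsumZ; ring.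
Qed.

Lemma wsum_centered m L k : wsum L (fun v => k v * (v - m)) =
  wsum L (fun v => k v * v) - m * wsum L k.
Proof.
rewrite (@wsum_ext L _ (fun v => k v * v + (- m) * k v)); last by move=> p _; ring.
by rewrite wsumD wsumZ mulNr.
Qed.

Lemma wsum_null L k h : nonneg_weights L -> (forall v, 0 <= k v) ->
  wsum L k = 0 -> wsum L (fun v => k v * h v) = 0.
Proof.
move=> L0 k0 M0; rewrite /wsum big_seq big1 // => p pL.
have pk0 : p.1 * k p.2 = 0.
  apply/eqP; move: M0; rewrite /wsum => /eqP; rewrite big_seq psumr_eq0.
    by move=> /allP/(_ p pL); rewrite pL.
  by move=> q qL; rewrite mulr_ge0 ?L0.
by rewrite mulrA pk0 mul0r.
Qed.

(** A slice of mean [m] and small variance has its point on the vertical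
    through the point (m, m^2 + eps^2) of the line, below it. *)
Lemma cut_small_lin eps m al L k : nonneg_weights L -> cut_bounds k ->
  cut_small eps L k -> wsum L (fun v => k v * (v - m)) = 0 ->
  wsum L (fun v => k v * lin eps m al v) <= 0.
Proof.
move=> L0 kb; rewrite /cut_small /small_variance => sv h0.
rewrite wsum_lin h0 mulr0 subr0.
move: h0; rewrite wsum_centered => /eqP; rewrite subr_eq0 => /eqP m1E.
rewrite m1E in sv.
have M0 : 0 <= wsum L k by apply: wsum_ge0 => // p _; have /andP[] := kb p.2.
move: M0; rewrite le_eqVlt => /predU1P[M0|M0]; last by nra.
rewrite -M0 mulr0 subr0.
by rewrite (wsum_null _ L0 _ (esym M0)) // => v; have /andP[] := kb v.
Qed.

(** The points of the two slices are strictly above a line through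
    (m, m^2 + eps^2), one on each side of the abscissa [m].  Let [t] be the
    highest value met by the cut.  If (t, t^2) is above the line, so are all the
    values that were cut off, and they are to the right of [m]: restoring them
    keeps both points above the line and the second one on the right.  The first
    point cannot pass to the right, because at the moment when its abscissa is
    [m] it would be above the upper parabola.  If (t, t^2) is below the line,
    remove from the second slice its values above [m], starting from the
    highest: its point stays above the line and must pass from the right of [m]
    to the left, which is impossible for the same reason. *)
Lemma upper_cut_core eps S L1 L2 k m al : 0 < eps ->
  values_in S L1 -> values_in S L2 -> nonneg_weights L1 -> nonneg_weights L2 ->
  upper_good eps S L1 -> upper_good eps S L2 -> upper_cut S k ->
  wsum L1 (fun v => k v * (v - m)) < 0 -> 0 < wsum L2 (fun v => k v * (v - m)) ->
  0 < wsum L1 (fun v => k v * lin eps m al v) ->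
  0 < wsum L2 (fun v => k v * lin eps m al v) ->
  [/\ wsum L1 (fun v => v - m) < 0, 0 < wsum L2 (fun v => v - m),
      0 < wsum L1 (lin eps m al) & 0 < wsum L2 (lin eps m al)].
Proof.
move=> e0 SL1 SL2 L10 L20 g1 g2 ck h1 h2 l1 l2.
have kb := ck.1.
have [t [tS kt tm mt]] : exists t, [/\ t \in S, 0 < k t,
    forall v, v \in S -> 0 < k v -> v <= t & m < t].
  have [p pL pk] : exists2 p, p \in L2 & 0 < k p.2 * (p.2 - m).
    apply: contrapT => no; move: h2; apply/negP; rewrite -leNgt.
    apply: wsum_le0 => // p pL; rewrite leNgt; apply/negP => hp; apply: no; by exists p.
  have kp : 0 < k p.2.
    have /andP[] := kb p.2; rewrite le_eqVlt => /predU1P[z|//] _.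
    by move: pk; rewrite -z mul0r ltxx.
  have pm : m < p.2 by move: pk; rewrite pmulr_rgt0 // subr_gt0.
  have pS := SL2 p pL.
  have [|t] := @seq_max [seq v <- S | 0 < k v].
    by rewrite -has_filter; apply/hasP; exists p.2.
  rewrite mem_filter => /andP[kt tS] tm; exists t; split=> //.
    by move=> v vS kv; apply: tm; rewrite mem_filter kv.
  by apply: (lt_le_trans pm); apply: tm; rewrite mem_filter kp.
have one_cut : upper_cut S (fun=> 1) by split=> // v; rewrite ler01 lexx.
have [lt|lt] := leP 0 (lin eps m al t).
  have linp v : t <= v -> 0 <= lin eps m al v by move=> tv; exact: lin_ge0_right mt tv lt.
  have k1 v : v \in S -> k v < 1 -> t <= v.
    move=> vS kv; rewrite leNgt; apply/negP => vt.
    by move: kv; rewrite (ck.2 _ _ vS tS vt kt) ltxx.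
  have lmono L k' : values_in S L -> nonneg_weights L -> (forall v, k v <= k' v <= 1) ->
      wsum L (fun v => k v * lin eps m al v) <= wsum L (fun v => k' v * lin eps m al v).
    move=> SL L0 kk'; apply: ler_wsum => // p pL.
    have /andP[kk1 kk2] := kk' p.2; have pS := SL p pL.
    have [kp|kp] := ltP (k p.2) 1; first by rewrite ler_wpM2r // linp ?k1.
    suff -> : k' p.2 = k p.2 by [].
    by apply/eqP; rewrite eq_le kk1 (le_trans kk2).
  have le1 v : k v <= 1 <= (1 : R) by have /andP[] := kb v; rewrite lexx => _ ->.
  have lfull L : wsum L (fun v => 1 * lin eps m al v) = wsum L (lin eps m al).
    by apply: wsum_ext => p _; rewrite mul1r.
  split.
  - rewrite ltNge; apply/negP => H1.
    have [|||k' [ck' kk' hk']] := @upper_cut_ivt S L1 k (fun=> 1) (fun v => v - m) SL1 ck one_cut.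
    + by move=> v; have /andP[] := le1 v.
    + exact: ltW.
    + by apply: le_trans H1 _; apply: ler_wsum => // p _; rewrite mul1r.
    have := cut_small_lin al L10 ck'.1 (g1 _ ck') hk'.
    apply/negP; rewrite -ltNge; apply: lt_le_trans l1 _.
    exact: lmono.
  - apply: lt_le_trans h2 _; apply: ler_wsum => // p pL.
    have [kp|kp] := ltP (k p.2) 1.
      by have := k1 _ (SL2 p pL) kp; have /andP[_ ?] := kb p.2; nra.
    have -> : k p.2 = 1 by apply/eqP; rewrite eq_le kp; have /andP[_ ->] := kb p.2.
    by rewrite mul1r.
  - by rewrite -lfull; apply: lt_le_trans l1 _; exact: lmono.
  - by rewrite -lfull; apply: lt_le_trans l2 _; exact: lmono.
exfalso.
(* The lower end of the path: all the values above m have been removed. *)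
pose k0 v := if v <= m then k v else 0.
have ck0 : upper_cut S k0.
  split=> [v|u v uS vS uv]; first by rewrite /k0; case: ifP => // _; rewrite lexx ler01.
  rewrite /k0; case: (leP v m) => [vm kv|]; last by rewrite ltxx.
  by rewrite (le_trans (ltW uv) vm); exact: ck.2 kv.
have k0k v : k0 v <= k v by rewrite /k0; case: ifP => //; have /andP[] := kb v.
have [||k' [ck' kk' hk']] := @upper_cut_ivt S L2 k0 k (fun v => v - m) SL2 ck0 ck k0k.
- apply: wsum_le0 => // p _.
  rewrite /k0; case: ifP => pm; last by rewrite mul0r.
  by have /andP[] := kb p.2; nra.
- exact: ltW.
have := cut_small_lin al L20 ck'.1 (g2 _ ck') hk'.
apply/negP; rewrite -ltNge; apply: lt_le_trans l2 _; apply: ler_wsum => // p pL.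
have [pm|pm] := leP p.2 m.
  suff -> : k' p.2 = k p.2 by [].
  by apply/eqP; have /andP[] := kk' p.2; rewrite /k0 pm eq_le => -> ->.
have /andP[_ k'k] := kk' p.2.
have [kp|kp] := ltP 0 (k p.2); last first.
  suff -> : k' p.2 = k p.2 by [].
  apply/eqP; rewrite eq_le k'k (le_trans kp) //.
  by have /andP[] := ck'.1 p.2.
have pt := tm _ (SL2 p pL) kp.
suff : lin eps m al p.2 <= 0 by nra.
by rewrite leNgt; apply/negP => /ltW/(lin_ge0_right pm pt); rewrite leNgt lt.
Qed.


(** Consider a segment that joins the points of two slices and passes above
    the point (m, m^2 + eps^2).  A line through that point and below both ends
    exists, and [upper_cut_core] carries the picture over to the full laws,
    contradicting their compatibility. *)
Lemma compatible_barrier eps S L1 L2 k m a b : 0 < eps ->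
  values_in S L1 -> values_in S L2 -> nonneg_weights L1 -> nonneg_weights L2 ->
  upper_good eps S L1 -> upper_good eps S L2 -> upper_cut S k -> 0 < a ->
  compatible eps L1 L2 (fun=> 1) ->
  let H L := wsum L (fun v => k v * (v - m)) in
  let G L := wsum L (fun v => k v * v ^+ 2) - (m ^+ 2 + eps ^+ 2) * wsum L k in
  H L1 < 0 -> 0 < H L2 -> a * H L1 + b * H L2 = 0 -> 0 < a * G L1 + b * G L2 ->
  False.
Proof.
move=> e0 SL1 SL2 L10 L20 g1 g2 ck a0 cmp H G h1 h2 h12 g12.
pose r1 := G L1 / H L1; pose r2 := G L2 / H L2.
have G1E : G L1 = r1 * H L1 by rewrite /r1 divfK // lt_eqF.
have G2E : G L2 = r2 * H L2 by rewrite /r2 divfK // gt_eqF.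
have r12 : r1 < r2.
  have : 0 < (a * H L1) * (r1 - r2).
    have -> : (a * H L1) * (r1 - r2) = a * G L1 + b * G L2 -
        r2 * (a * H L1 + b * H L2) by rewrite G1E G2E; ring.
    by rewrite h12 mulr0 subr0.
  by rewrite nmulr_rgt0 ?subr_lt0 // pmulr_rlt0.
(* The slopes of the line that leave both points above it are those
   strictly between r1 and r2. *)
pose al := (r1 + r2) / 2.
have l1 : 0 < wsum L1 (fun v => k v * lin eps m al v).
  rewrite wsum_lin -/(H L1) -/(G L1) G1E -mulrBl nmulr_lgt0 // /al; lra.
have l2 : 0 < wsum L2 (fun v => k v * lin eps m al v).
  rewrite wsum_lin -/(H L2) -/(G L2) G2E -mulrBl pmulr_lgt0 // /al; lra.
have [X1 X2 Y1 Y2] := upper_cut_core e0 SL1 SL2 L10 L20 g1 g2 ck h1 h2 l1 l2.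
have one L h : wsum L h = wsum L (fun v => 1 * h v).
  by apply: wsum_ext => p _; rewrite mul1r.
have N1 : 0 <= wsum L1 (fun=> 1) by apply: wsum_ge0.
have N2 : 0 < wsum L2 (fun=> 1).
  rewrite lt_def wsum_ge0 // andbT; apply/eqP => z.
  by move: X2; rewrite one (wsum_null _ L20 _ z) ?ltxx.
have sv := cmp _ _ (ltW X2) (ltW (etrans (oppr_gt0 _) X1)).
have Ws L : wsum L (lin eps m al) = wsum L (fun v => v ^+ 2)
    - (m ^+ 2 + eps ^+ 2) * wsum L (fun=> 1) - al * wsum L (fun v => v - m).
  rewrite (one L (lin _ _ _)) wsum_lin.
  by rewrite -(one L (fun v => v ^+ 2)) -(one L (fun v => v - m)).
have Es L : wsum L (fun v => v - m) = wsum L id - m * wsum L (fun=> 1).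
  by rewrite (one L (fun v => v - m)) wsum_centered -(one L id).
rewrite Ws in Y1; rewrite Ws in Y2.
have E1 := Es L1; have E2 := Es L2.
move: sv Y1 Y2; rewrite /small_variance -!(one L1 id) -!(one L2 id).
rewrite -!(one L1 (fun v => v ^+ 2)) -!(one L2 (fun v => v ^+ 2)).
move: X1 X2 E1 E2 N1 N2.
move: (wsum L1 (fun v => v - m)) (wsum L2 (fun v => v - m)) => X1 X2.
move: (wsum L1 id) (wsum L2 id) => A1 A2.
move: (wsum L1 (fun v => v ^+ 2)) (wsum L2 (fun v => v ^+ 2)) => B1 B2.
move: (wsum L1 (fun=> 1)) (wsum L2 (fun=> 1)) => N1 N2.
move=> X10 X20 E1 E2 N10 N20 sv Y1 Y2; move: sv.
have n0 : 0 < X2 * N1 + - X1 * N2.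
  by rewrite ltr_wpDl ?mulr_ge0 ?mulr_gt0 ?oppr_gt0 // ltW.
have A1E : A1 = X1 + m * N1 by lra.
have A2E : A2 = X2 + m * N2 by lra.
have -> : X2 * A1 + - X1 * A2 = m * (X2 * N1 + - X1 * N2)
  by rewrite A1E A2E; ring.
have n2 : 0 < X2 * B1 + - X1 * B2 - (m ^+ 2 + eps ^+ 2) * (X2 * N1 + - X1 * N2).
  have -> : X2 * B1 + - X1 * B2 - (m ^+ 2 + eps ^+ 2) * (X2 * N1 + - X1 * N2) =
    X2 * (B1 - (m ^+ 2 + eps ^+ 2) * N1 - al * X1)
    + (- X1) * (B2 - (m ^+ 2 + eps ^+ 2) * N2 - al * X2) by ring.
  by rewrite addr_gt0 // mulr_gt0 // oppr_gt0.
move: (X2 * N1 + _) (X2 * B1 + _) n0 n2 => n0 n2 n00 n20; nra.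
Qed.

Lemma compatible_sym eps L1 L2 k : compatible eps L1 L2 k -> compatible eps L2 L1 k.
Proof.
move=> c a b a0 b0; have := c b a b0 a0.
by rewrite /small_variance ![b * _ + _]addrC.
Qed.

(** Dropping the values above a common level from two good laws keeps the
    segment between their points in the strip. *)
Lemma compatible_upper_cut eps S L1 L2 k : 0 < eps ->
  values_in S L1 -> values_in S L2 -> nonneg_weights L1 -> nonneg_weights L2 ->
  upper_good eps S L1 -> upper_good eps S L2 ->
  compatible eps L1 L2 (fun=> 1) -> upper_cut S k -> compatible eps L1 L2 k.
Proof.
move=> e0 SL1 SL2 L10 L20 g1 g2 cmp ck a b a0 b0.
rewrite /small_variance leNgt; apply/negP => bad.
set M1 := wsum L1 k in bad; set M2 := wsum L2 k in bad.
set A1 := wsum L1 (fun v => k v * v) in bad; set A2 := wsum L2 (fun v => k v * v) in bad.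
set B1 := wsum L1 (fun v => k v * v ^+ 2) in bad.
set B2 := wsum L2 (fun v => k v * v ^+ 2) in bad.
have M10 : 0 <= M1 by apply: wsum_ge0 => // p _; have /andP[] := ck.1 p.2.
have M20 : 0 <= M2 by apply: wsum_ge0 => // p _; have /andP[] := ck.1 p.2.
have m00 : 0 < a * M1 + b * M2.
  rewrite lt_def addr_ge0 ?mulr_ge0 // andbT; apply/eqP => z.
  by move: bad; rewrite z expr0n mulr0 mul0r sub0r ltNge oppr_le0 sqr_ge0.
(* The abscissa of the mixture that is above the upper parabola. *)
pose m := (a * A1 + b * A2) / (a * M1 + b * M2).
have mE : m * (a * M1 + b * M2) = a * A1 + b * A2 by rewrite /m divfK // gt_eqF.
pose H1 := A1 - m * M1; pose H2 := A2 - m * M2.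
pose G1 := B1 - (m ^+ 2 + eps ^+ 2) * M1; pose G2 := B2 - (m ^+ 2 + eps ^+ 2) * M2.
have H12 : a * H1 + b * H2 = 0 by rewrite /H1 /H2; lra.
have G12 : 0 < a * G1 + b * G2.
  rewrite -(pmulr_rgt0 _ m00) /G1 /G2; move: bad; rewrite -mE -subr_gt0.
  by congr (0 < _); ring.
have linE1 al : wsum L1 (fun v => k v * lin eps m al v) = G1 - al * H1.
  by rewrite wsum_lin wsum_centered.
have linE2 al : wsum L2 (fun v => k v * lin eps m al v) = G2 - al * H2.
  by rewrite wsum_lin wsum_centered.
have z1 : H1 = 0 -> G1 <= 0.
  move=> z; have := @cut_small_lin eps m 0 L1 k L10 ck.1 (g1 _ ck).
  by rewrite linE1 wsum_centered mul0r subr0; apply.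
have z2 : H2 = 0 -> G2 <= 0.
  move=> z; have := @cut_small_lin eps m 0 L2 k L20 ck.1 (g2 _ ck).
  by rewrite linE2 wsum_centered mul0r subr0; apply.
have aG : a * H1 = 0 -> a * G1 <= 0.
  by move/eqP; rewrite mulf_eq0 => /orP[/eqP ->|/eqP/z1]; [rewrite mul0r|nra].
have bG : b * H2 = 0 -> b * G2 <= 0.
  by move/eqP; rewrite mulf_eq0 => /orP[/eqP ->|/eqP/z2]; [rewrite mul0r|nra].
have aH0 : a * H1 != 0.
  apply/eqP => z; have := aG z; have := bG; rewrite z add0r in H12.
  by move=> /(_ H12); lra.
have a1 : 0 < a by rewrite lt_def a0 andbT; apply: contraNneq aH0 => ->; rewrite mul0r.
have b1 : 0 < b.
  rewrite lt_def b0 andbT; apply: contraNneq aH0 => z.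
  by move: H12; rewrite z mul0r addr0 => ->.
have [h1|h1|h1] := ltgtP H1 0; last by rewrite h1 mulr0 eqxx in aH0.
- have h2 : 0 < H2.
    by rewrite -(pmulr_rgt0 _ b1) -(addKr (a * H1) (b * H2)) H12 addr0 oppr_gt0 pmulr_rlt0.
  apply: (@compatible_barrier eps S L1 L2 k m a b) => //;
    by rewrite ?wsum_centered.
- have h2 : H2 < 0.
    by rewrite -(pmulr_rlt0 _ b1) -(addKr (a * H1) (b * H2)) H12 addr0 oppr_lt0 pmulr_rgt0.
  apply: (@compatible_barrier eps S L2 L1 k m b a) => //;
    rewrite ?wsum_centered // 1?addrC //; exact: compatible_sym.
Qed.


(** Slices are taken on the quantile line, so this says that the nondecreasing
    function on [0, 1] with law [L] has mean oscillation at most [eps]. *)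
Definition good eps L :=
  forall k, interval_cut [seq p.2 | p <- L] k -> cut_small eps L k.

(** The slice of [L] of density [k], reflected by v |-> - v; it turns lower
    cuts into upper cuts. *)
Definition reflect_cut k L := [seq (p.1 * k p.2, - p.2) | p <- L].

Lemma wsum_reflect_cut k L h :
  wsum (reflect_cut k L) h = wsum L (fun v => k v * h (- v)).
Proof. by rewrite /wsum big_map; apply: eq_bigr => p _ /=; rewrite mulrA. Qed.

Lemma upper_interval_cut S k : upper_cut S k -> interval_cut S k.
Proof. by move=> [b c]; split=> // u v w _ vS wS _ vw _; exact: c. Qed.

Lemma interval_cut_sub S S' k : {subset S <= S'} -> interval_cut S' k -> interval_cut S k.
Proof. by move=> s [b c]; split=> // u v w /s uS /s vS /s wS; exact: c. Qed.

(** At the highest atom [t] that it meets, an interval cut factors into an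
    upper cut and a lower cut.  [compatible_upper_cut] applies to the upper cut,
    and, after the reflection v |-> - v, to the lower one. *)
Lemma interval_good_cat eps S L1 L2 : 0 < eps ->
  values_in S L1 -> values_in S L2 -> nonneg_weights L1 -> nonneg_weights L2 ->
  (forall k, interval_cut S k -> cut_small eps L1 k) ->
  (forall k, interval_cut S k -> cut_small eps L2 k) ->
  compatible eps L1 L2 (fun=> 1) ->
  forall k, interval_cut S k -> cut_small eps (L1 ++ L2) k.
Proof.
move=> e0 SL1 SL2 L10 L20 g1 g2 cmp k [kb kc].
have k0 v : 0 <= k v by have /andP[] := kb v.
have [/eqP knil|knil] := eqVneq [seq v <- S | 0 < k v] [::].
  have z L (SL : values_in S L) h : wsum L (fun v => k v * h v) = 0.
    rewrite /wsum big_seq big1 // => p pL.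
    suff -> : k p.2 = 0 by rewrite mul0r mulr0.
    apply/eqP; rewrite eq_le k0 andbT leNgt; apply/negP => kp.
    by move: knil; rewrite -[_ == _]negbK -has_filter => /hasP; apply; exists p.2; [exact: SL|].
  have SL : values_in S (L1 ++ L2) by move=> p; rewrite mem_cat => /orP[/SL1|/SL2].
  rewrite /cut_small /small_variance !(z _ SL) mulr0 expr0n subrr.
  by rewrite mulr_ge0 ?sqr_ge0.
have [t] := seq_max knil; rewrite mem_filter => /andP[kt tS] tm.
have {}tm v : v \in S -> 0 < k v -> v <= t by move=> vS kv; apply: tm; rewrite mem_filter kv.
pose ku v := if v < t then 1 else k v; pose kl v := if v < t then k v else 1.
have kE v : k v = ku v * kl v.
  by rewrite /ku /kl; case: ifP; rewrite ?mul1r ?mulr1.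
have cu : upper_cut S ku.
  split=> [v|u v uS vS uv]; first by rewrite /ku; case: ifP => // _; rewrite ler01 lexx.
  rewrite /ku; case: (ltP v t) => vt kv; first by rewrite (lt_trans uv vt).
  by rewrite (lt_le_trans uv (tm _ vS kv)).
have cmpu : compatible eps L1 L2 ku.
  by apply: (@compatible_upper_cut eps S) => // k' /upper_interval_cut; [exact: g1|exact: g2].
have ku0 v : 0 <= ku v by have /andP[] := cu.1 v.
have rS L : values_in S L -> values_in [seq - v | v <- S] (reflect_cut ku L).
  by move=> SL p /mapP[q qL ->]; apply: map_f; exact: SL.
have r0 L : nonneg_weights L -> nonneg_weights (reflect_cut ku L).
  by move=> L0 p /mapP[q qL -> /=]; rewrite mulr_ge0 ?L0.
have rmom L k' : [/\ wsum (reflect_cut ku L) k' = wsum L (fun v => ku v * k' (- v)),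
    wsum (reflect_cut ku L) (fun v => k' v * v) =
      - wsum L (fun v => (ku v * k' (- v)) * v) &
    wsum (reflect_cut ku L) (fun v => k' v * v ^+ 2) =
      wsum L (fun v => (ku v * k' (- v)) * v ^+ 2)].
  rewrite !wsum_reflect_cut -mulN1r -wsumZ; split=> //.
  - by apply: wsum_ext => p _; ring.
  - by apply: wsum_ext => p _; ring.
have rg L : (forall k, interval_cut S k -> cut_small eps L k) ->
    upper_good eps [seq - v | v <- S] (reflect_cut ku L).
  move=> g k' [b' c'].
  have /g : interval_cut S (fun v => ku v * k' (- v)).
    split=> [v|u v w uS vS wS uv vw].
      have /andP[? ?] := cu.1 v; have /andP[? ?] := b' (- v).
      by rewrite mulr_ge0 //= mulr_ile1.
    move=> pu pw.
    have -> : ku v = 1.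
      apply: (cu.2 _ _ vS wS vw); rewrite lt_def ku0 andbT.
      by apply: contraTneq pw => ->; rewrite mul0r ltxx.
    rewrite mul1r; apply: (c' _ _ (map_f _ vS) (map_f _ uS)); first by rewrite ltrN2.
    have /andP[? _] := b' (- u); rewrite lt_def; apply/andP; split=> //.
    by apply: contraTneq pu => ->; rewrite mulr0 ltxx.
  rewrite /cut_small; have [-> -> ->] := rmom L k'.
  by rewrite /small_variance sqrrN.
have rc : compatible eps (reflect_cut ku L1) (reflect_cut ku L2) (fun=> 1).
  move=> a b a0 b0; have := cmpu a b a0 b0; rewrite /small_variance.
  have [-> -> ->] := rmom L1 (fun=> 1); have [-> -> ->] := rmom L2 (fun=> 1).
  rewrite !mulrN -opprD sqrrN.
  have e L h : wsum L (fun v => ku v * 1 * h v) = wsum L (fun v => ku v * h v).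
    by apply: wsum_ext => p _; rewrite mulr1.
  have e' L : wsum L (fun v => ku v * 1) = wsum L ku.
    by apply: wsum_ext => p _; rewrite mulr1.
  by rewrite !(e _ id) !(e _ (fun v => v ^+ 2)) !e'.
have ckl : upper_cut [seq - v | v <- S] (fun v => kl (- v)).
  split=> [v|u' v' /mapP[u uS ->] /mapP[v vS ->]].
    by rewrite /kl; case: ifP => // _; rewrite ler01 lexx.
  rewrite ltrN2 !opprK /kl => vu; case: (ltP u t) => // ut.
  by rewrite (lt_trans vu ut) => kv; exact: kc kv kt.
have := @compatible_upper_cut eps [seq - v | v <- S] _ _ _ e0 (rS _ SL1) (rS _ SL2)
  (r0 _ L10) (r0 _ L20) (rg _ g1) (rg _ g2) rc ckl.
move=> /(_ 1 1 ler01 ler01); rewrite /cut_small !mul1r.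
have [-> -> ->] := rmom L1 (fun v => kl (- v)).
have [-> -> ->] := rmom L2 (fun v => kl (- v)).
rewrite -opprD /small_variance sqrrN !wsum_cat.
have e L h : wsum L (fun v => ku v * kl (- - v) * h v) = wsum L (fun v => k v * h v).
  by apply: wsum_ext => p _; rewrite opprK -kE.
have e' L : wsum L (fun v => ku v * kl (- - v)) = wsum L k.
  by apply: wsum_ext => p _; rewrite opprK -kE.
by rewrite !(e _ id) !(e _ (fun v => v ^+ 2)) !e'.
Qed.

(** Mixtures along segments of the strip preserve good laws.  This is the
    property that makes the envelope of good laws locally concave. *)
Lemma good_cat eps L1 L2 : 0 < eps -> nonneg_weights L1 -> nonneg_weights L2 ->
  good eps L1 -> good eps L2 -> compatible eps L1 L2 (fun=> 1) -> good eps (L1 ++ L2).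
Proof.
move=> e0 L10 L20 g1 g2 cmp k.
have sub1 : {subset [seq p.2 | p <- L1] <= [seq p.2 | p <- L1 ++ L2]}.
  by move=> v; rewrite map_cat mem_cat => ->.
have sub2 : {subset [seq p.2 | p <- L2] <= [seq p.2 | p <- L1 ++ L2]}.
  by move=> v; rewrite map_cat mem_cat => ->; rewrite orbT.
apply: interval_good_cat => //.
- by move=> p pL; apply: sub1; apply: map_f.
- by move=> p pL; apply: sub2; apply: map_f.
- by move=> k' /(interval_cut_sub sub1); exact: g1.
- by move=> k' /(interval_cut_sub sub2); exact: g2.
Qed.

Definition scale_law (c : R) L := [seq (c * p.1, p.2) | p <- L].

Lemma wsum_scale c L h : wsum (scale_law c L) h = c * wsum L h.
Proof.
by rewrite /wsum big_map big_distrr; apply: eq_bigr => p _; rewrite /= mulrA.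
Qed.

Lemma good_scale eps c L : good eps L -> good eps (scale_law c L).
Proof.
move=> g k; rewrite /scale_law -map_comp => /g; rewrite /cut_small !wsum_scale.
rewrite /small_variance => sv; have := sqr_ge0 c.
move: sv (c ^+ 2) (expr2 c).
move: (wsum L k) (wsum L (fun v => k v * v)) (wsum L (fun v => k v * v ^+ 2)).
move=> m0 m1 m2 sv c2 ec c20.
have -> : c * m0 * (c * m2) - (c * m1) ^+ 2 = c2 * (m0 * m2 - m1 ^+ 2) by rewrite ec; ring.
have -> : eps ^+ 2 * (c * m0) ^+ 2 = c2 * (eps ^+ 2 * m0 ^+ 2) by rewrite ec; ring.
exact: ler_wpM2l.
Qed.

Lemma good_point eps w v : good eps [:: (w, v)].
Proof.
move=> k _; rewrite /cut_small /small_variance /wsum !big_seq1 /=.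
have -> : w * k v * (w * (k v * v ^+ 2)) - (w * (k v * v)) ^+ 2 = 0 by ring.
by rewrite mulr_ge0 ?sqr_ge0.
Qed.

End FiniteLaws.

(** * The parabolic strip and an exponential locally concave function *)

Section Geometry.
Context {R : realType}.
Implicit Types (eps k : R) (x y : R * R) (G : R * R -> R).

(** The two tangents to the upper parabola through [x] touch it at the
    abscissae [x.1 - depth eps x] and [x.1 + depth eps x]. *)
Definition depth eps x : R := Num.sqrt (eps ^+ 2 - (x.2 - x.1 ^+ 2)).

Lemma depth_ge0 eps x : 0 <= depth eps x. Proof. exact: sqrtr_ge0. Qed.

Lemma sqr_depth eps x : Omega eps x -> depth eps x ^+ 2 = eps ^+ 2 - (x.2 - x.1 ^+ 2).
Proof. by move=> /andP[? ?]; rewrite /depth sqr_sqrtr //; lra. Qed.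

Lemma depth_le eps x : 0 <= eps -> Omega eps x -> depth eps x <= eps.
Proof.
move=> e0 xO; have := sqr_depth xO; move: xO => /andP[? ?] dE.
by rewrite -(ler_pXn2r (n := 2)) ?nnegrE ?depth_ge0 // dE; lra.
Qed.

Definition segment_in eps x y := forall a b : R, 0 <= a -> 0 <= b -> a + b = 1 ->
  Omega eps (a *: x + b *: y).

Lemma segment_in_ends eps x y : segment_in eps x y -> Omega eps x /\ Omega eps y.
Proof.
move=> s; split.
  by have := s 1 0 ler01 (lexx _) (addr0 _); rewrite scale1r scale0r addr0.
by have := s 0 1 (lexx _) ler01 (add0r _); rewrite scale1r scale0r add0r.
Qed.

(** Along the segment, eps^2 - (z2 - z1^2) is a quadratic polynomial with
    leading term (x1 - y1)^2 and end values [depth x ^ 2] and [depth y ^ 2]; it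
    cannot be nonnegative throughout if the two depths are too small. *)
Lemma segment_depth eps x y : segment_in eps x y ->
  `|x.1 - y.1| <= depth eps x + depth eps y.
Proof.
move=> s; have [xO yO] := segment_in_ends s.
rewrite leNgt; apply/negP => lt.
set D := `|x.1 - y.1| in lt.
have s0 := depth_ge0 eps x; have s1 := depth_ge0 eps y.
have D0 : 0 < D by apply: le_lt_trans lt; rewrite addr_ge0.
have D2 : D ^+ 2 = (x.1 - y.1) ^+ 2 by rewrite /D real_normK ?num_real.
have x2 := sqr_depth xO; have y2 := sqr_depth yO.
(* Enlarge both depths by e so that they add up to D exactly; the weights a
   and b are then those of the double root of the enlarged polynomial. *)
pose e := (D - (depth eps x + depth eps y)) / 2.
have e0 : 0 < e by rewrite /e; lra.
pose b := (depth eps x + e) / D; pose a := (depth eps y + e) / D.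
have ab : a + b = 1 by rewrite -mulrDl /e; apply: (mulIf (lt0r_neq0 D0)); rewrite divfK ?gt_eqF //; lra.
have a0 : 0 < a by rewrite divr_gt0 //; lra.
have b0 : 0 < b by rewrite divr_gt0 //; lra.
have := s a b (ltW a0) (ltW b0) ab => /andP[_] /=.
rewrite -[_ *: x.1]/(a * x.1) -[_ *: x.2]/(a * x.2) -[_ *: y.1]/(b * y.1) -[_ *: y.2]/(b * y.2).
apply/negP; rewrite -ltNge.
have aD : a * D = depth eps y + e by rewrite divfK ?gt_eqF.
have bD : b * D = depth eps x + e by rewrite divfK ?gt_eqF.
have -> : a * x.2 + b * y.2 = (a * x.1 + b * y.1) ^+ 2 + eps ^+ 2
  - (a * depth eps x ^+ 2 + b * depth eps y ^+ 2 - a * b * D ^+ 2).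
  rewrite x2 y2 D2 (_ : b = 1 - a); [ring | lra].
suff : a * depth eps x ^+ 2 + b * depth eps y ^+ 2 - a * b * D ^+ 2 < 0 by lra.
have abD : a * b * D ^+ 2 = a * (depth eps x + e) ^+ 2 + b * (depth eps y + e) ^+ 2.
  by rewrite -aD -bD (_ : b = 1 - a); [ring | lra].
have : a * depth eps x ^+ 2 < a * (depth eps x + e) ^+ 2.
  by rewrite ltr_pM2l // ltr_pXn2r ?nnegrE ?addr_ge0 ?(ltW e0) // ltrDl.
have : b * depth eps y ^+ 2 < b * (depth eps y + e) ^+ 2.
  by rewrite ltr_pM2l // ltr_pXn2r ?nnegrE ?addr_ge0 ?(ltW e0) // ltrDl.
by rewrite abD; lra.
Qed.

(** For a point of abscissa [t1] and depth [s], expR (k * t1) times this is the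
    value of the affine function of the point that touches [exp_major] along
    the left half of the tangent at t1 + w, up to the constant factor of
    [exp_major]. *)
Definition exp_plane (k s w : R) : R := expR (k * w) * (1 - k * w + k ^+ 2 / 2 * (w ^+ 2 - s ^+ 2)).

Lemma exp_plane_derive (k s w : R) :
  is_derive w 1 (exp_plane k s) (k ^+ 3 / 2 * (w ^+ 2 - s ^+ 2) * expR (k * w)).
Proof.
rewrite /exp_plane; apply: is_derive_eq; rewrite /GRing.scale /=.
change (expR (k * w) * ((0 + 1) * - (k * 1) + k ^+ 2 / 2 * (w * 1 + w * 1 - 0)) +
  (1 - k * w + k ^+ 2 / 2 * (w ^+ 2 - s ^+ 2)) * (expR (k * w) * (k * 1)) =
  k ^+ 3 / 2 * (w ^+ 2 - s ^+ 2) * expR (k * w) :> R).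
by move: (expR _) => E; field.
Qed.

(** The derivative in [w] has the sign of w^2 - s^2, so on [-s, +oo) the minimum
    is at [s]. *)
Lemma exp_plane_min (k s w : R) : 0 < k -> 0 <= s -> - s <= w -> exp_plane k s s <= exp_plane k s w.
Proof.
move=> k0 s0 sw.
have cont : continuous (exp_plane k s).
  by move=> z; apply/differentiable_continuous/derivable1_diffP; case: (exp_plane_derive k s z).
have k3 : 0 < k ^+ 3 / 2 by rewrite divr_gt0 // exprn_gt0.
have [ws|sw'] := leP w s.
- have [||c cin] := @MVT_segment R (exp_plane k s)
      (fun w => k ^+ 3 / 2 * (w ^+ 2 - s ^+ 2) * expR (k * w)) w s ws.
  + by move=> z _; exact: exp_plane_derive.
  + exact: continuous_subspaceT.
  move=> /eqP; rewrite subr_eq => /eqP ->; rewrite gerDr.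
  move: cin; rewrite in_itv /= => /andP[wc cs].
  rewrite mulr_le0_ge0 ?subr_ge0 // mulr_le0_ge0 ?expR_ge0 // pmulr_rle0 //; nra.
- have [||c cin] := @MVT_segment R (exp_plane k s)
      (fun w => k ^+ 3 / 2 * (w ^+ 2 - s ^+ 2) * expR (k * w)) s w (ltW sw').
  + by move=> z _; exact: exp_plane_derive.
  + exact: continuous_subspaceT.
  move=> /eqP; rewrite subr_eq => /eqP ->; rewrite lerDr.
  move: cin; rewrite in_itv /= => /andP[sc cw].
  rewrite mulr_ge0 ?subr_ge0 ?(ltW sw') // mulr_ge0 ?expR_ge0 // pmulr_rge0 //; nra.
Qed.

(** The extremal function of the integral John-Nirenberg inequality, of value
    expR (k * u) at (u, u^2).  It is affine on the half of each tangent of the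
    upper parabola to the left of the point of contact. *)
Definition exp_major eps k x : R :=
  expR (- (k * eps)) / (1 - k * eps) * (expR (k * x.1) * exp_plane k (depth eps x) (depth eps x)).

(** The affine function touching [exp_major] at a point [z] of the segment is
    above it on the whole segment: by [segment_depth] the abscissa of contact of
    the tangent through [z] stays in the range where [exp_plane_min] applies. *)
Lemma exp_major_concave eps k : 0 < k -> k * eps < 1 -> locally_concave eps (exp_major eps k).
Proof.
move=> k0 ke x y s a b a0 b0 ab.
have C0 : 0 <= expR (- (k * eps)) / (1 - k * eps).
  by rewrite divr_ge0 ?expR_ge0 // subr_ge0 ltW.
have [xO yO] := segment_in_ends s.
set z := a *: x + b *: y.
have zO : Omega eps z by apply: s.
have z1E : z.1 = a * x.1 + b * y.1 by [].
have z2E : z.2 = a * x.2 + b * y.2 by [].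
pose u := z.1 + depth eps z.
(* the affine function touching the graph at z, of contact abscissa u *)
pose P t := expR (k * u) * (1 - k * (u - t.1) + k ^+ 2 / 2 * (t.2 - u *+ 2 * t.1 + u ^+ 2 - eps ^+ 2)).
have PE t : Omega eps t -> P t = expR (k * t.1) * exp_plane k (depth eps t) (u - t.1).
  move=> tO; rewrite /P /exp_plane mulrA -expRD (sqr_depth tO).
  have -> : k * t.1 + k * (u - t.1) = k * u by ring.
  by congr (_ * _); ring.
have Paff : P z = a * P x + b * P y.
  by rewrite /P z1E z2E (_ : b = 1 - a); [ring | lra].
have seg t : segment_in eps t z -> t.1 - z.1 <= depth eps t + depth eps z.
  by move=> /segment_depth; apply: le_trans; exact: ler_norm.
have le t : Omega eps t -> segment_in eps t z ->
    expR (k * t.1) * exp_plane k (depth eps t) (depth eps t) <= P t.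
  move=> tO /seg tz; rewrite PE // ler_wpM2l ?expR_ge0 // exp_plane_min ?depth_ge0 //.
  by rewrite /u; lra.
have zE : expR (k * z.1) * exp_plane k (depth eps z) (depth eps z) = P z.
  by rewrite PE // /u addrC addKr.
rewrite /exp_major; move: (_ / _) C0 => C C0.
rewrite (mulrCA a C) (mulrCA b C) -mulrDr ler_wpM2l // zE Paff.
have sx : segment_in eps x z.
  move=> c d c0 d0 cd; rewrite /z scalerDr addrA !scalerA -scalerDl.
  apply: s; rewrite ?mulr_ge0 ?addr_ge0 ?mulr_ge0 //.
  by rewrite -addrA -mulrDr ab mulr1.
have sy : segment_in eps y z.
  move=> c d c0 d0 cd; rewrite /z scalerDr addrC -addrA !scalerA -scalerDl.
  apply: s; rewrite ?mulr_ge0 ?addr_ge0 ?mulr_ge0 //.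
  by rewrite addrA -mulrDr ab mulr1 addrC.
by apply: lerD; rewrite ler_wpM2l // le.
Qed.

Lemma exp_major_boundary eps k u : 0 <= eps -> k * eps < 1 ->
  exp_major eps k (u, u ^+ 2) = expR (k * u).
Proof.
move=> e0 ke; rewrite /exp_major.
have -> : depth eps (u, u ^+ 2) = eps by rewrite /depth /= subrr subr0 sqrtr_sqr ger0_norm.
rewrite /exp_plane subrr mulr0 addr0 /= expRN.
by field; rewrite gt_eqF ?subr_gt0 // gt_eqF ?expR_gt0.
Qed.

Lemma depth_continuous eps : continuous (depth eps).
Proof.
move=> x; rewrite /depth.
apply: (@continuous_comp _ _ _ (fun x : R * R => eps ^+ 2 - (x.2 - x.1 ^+ 2)) Num.sqrt);
  last exact: sqrt_continuous.
apply: cvgB; first exact: cvg_cst.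
apply: cvgB; first exact: cvg_snd.
by apply: cvgM; exact: cvg_fst.
Qed.

Lemma exp_major_continuous eps k : continuous (exp_major eps k).
Proof.
move=> x; rewrite /exp_major /exp_plane.
have expc (g : R * R -> R) : {for x, continuous g} ->
    {for x, continuous (fun y => expR (k * g y))}.
  move=> gc; apply: (@continuous_comp _ _ _ (fun y => k * g y) expR); last exact: continuous_expR.
  by apply: cvgM; [exact: cvg_cst|exact: gc].
have dc := @depth_continuous eps x.
apply: cvgM; first exact: cvg_cst.
apply: cvgM; first by apply: expc; exact: cvg_fst.
apply: cvgM; first exact: expc.
apply: cvgD; last first.
  apply: cvgM; first exact: cvg_cst.
  by apply: cvgB; apply: cvgM; exact: dc.
apply: cvgB; first exact: cvg_cst.
by apply: cvgM; [exact: cvg_cst|exact: dc].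
Qed.

End Geometry.

(** * Concave functions on the tangents of the upper parabola *)

Section Chords.
Context {R : realType}.
Implicit Types (eps a th : R) (x y : R * R) (f : R -> R) (G : R * R -> R).

(** The point at signed horizontal distance [th] from the point of contact, on
    the tangent at abscissa [a]; it is in the strip for |th| <= eps and on the
    lower parabola for th = eps and th = - eps. *)
Definition tangent eps a th : R * R := (a + th, a ^+ 2 + 2 * a * th + eps ^+ 2).

Lemma tangent_in eps a th : `|th| <= eps -> Omega eps (tangent eps a th).
Proof.
rewrite ler_norml => /andP[? ?]; rewrite /Omega /tangent /=; apply/andP; split; nra.
Qed.

Lemma tangent_comb eps a t1 t2 c d : c + d = 1 ->
  c *: tangent eps a t1 + d *: tangent eps a t2 = tangent eps a (c * t1 + d * t2).
Proof.
move=> cd; have dE : d = 1 - c by lra.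
apply: injective_projections => /=.
  rewrite -[_ *: (a + t1)]/(c * (a + t1)) -[_ *: (a + t2)]/(d * (a + t2)) dE; ring.
rewrite -[c *: _]/(c * (a ^+ 2 + 2 * a * t1 + eps ^+ 2)).
rewrite -[d *: _]/(d * (a ^+ 2 + 2 * a * t2 + eps ^+ 2)) dE; ring.
Qed.

Lemma tangent_segment eps a t1 t2 : `|t1| <= eps -> `|t2| <= eps ->
  segment_in eps (tangent eps a t1) (tangent eps a t2).
Proof.
move=> h1 h2 c d c0 d0 cd; rewrite tangent_comb //; apply: tangent_in.
rewrite (le_trans (ler_normD _ _)) // !normrM !(ger0_norm c0) !(ger0_norm d0).
by rewrite -[leRHS]mul1r -cd mulrDl lerD // ler_wpM2l.
Qed.

Lemma tangentE eps x : Omega eps x ->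
  x = tangent eps (x.1 - depth eps x) (depth eps x) /\
  x = tangent eps (x.1 + depth eps x) (- depth eps x).
Proof.
move=> xO; have := sqr_depth xO; rewrite /tangent; case: x xO => x1 x2 /= xO dE.
split; congr (_, _); [ring| |ring|]; nra.
Qed.

Lemma tangent_end eps a : tangent eps a eps = (a + eps, (a + eps) ^+ 2) /\
  tangent eps a (- eps) = (a - eps, (a - eps) ^+ 2).
Proof. by rewrite /tangent; split; congr (_, _); ring. Qed.

(** Through [x] passes a tangent of the upper parabola, with both ends on the
    lower parabola. *)
Lemma concave_chord eps G x : 0 < eps -> locally_concave eps G -> Omega eps x ->
  let s := depth eps x in
  (eps - s) / (2 * eps) * G (x.1 - s - eps, (x.1 - s - eps) ^+ 2)
  + (eps + s) / (2 * eps) * G (x.1 - s + eps, (x.1 - s + eps) ^+ 2) <= G x.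
Proof.
move=> e0 cG xO /=; set s := depth eps x.
have s0 : 0 <= s := depth_ge0 _ _; have se : s <= eps := depth_le (ltW e0) xO.
have [xE _] := tangentE xO; rewrite -/s in xE.
have [<- <-] := tangent_end eps (x.1 - s).
have ne : `|- eps| <= eps by rewrite normrN ger0_norm // ltW.
have pe : `|eps| <= eps by rewrite ger0_norm // ltW.
have c0 : 0 <= (eps - s) / (2 * eps) by rewrite divr_ge0 ?subr_ge0 // mulr_ge0 // ltW.
have d0 : 0 <= (eps + s) / (2 * eps) by rewrite divr_ge0 ?addr_ge0 ?(ltW e0) // mulr_ge0 // ltW.
have cd : (eps - s) / (2 * eps) + (eps + s) / (2 * eps) = 1.
  by field; rewrite gt_eqF.
have := cG _ _ (tangent_segment (x.1 - s) ne pe) _ _ c0 d0 cd.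
rewrite tangent_comb //; move/le_trans; apply; rewrite [in leRHS]xE.
suff -> : (eps - s) / (2 * eps) * - eps + (eps + s) / (2 * eps) * eps = s by [].
by field; rewrite gt_eqF.
Qed.

Lemma concave_floor eps (K B : R) G x : 0 < eps -> locally_concave eps G -> Omega eps x ->
  `|x.1| <= K -> (forall u, `|u| <= K + 2 * eps -> - B <= G (u, u ^+ 2)) -> - B <= G x.
Proof.
move=> e0 cG xO xK hB.
have := concave_chord e0 cG xO; set s := depth eps x => /= /(le_trans _); apply.
have s0 : 0 <= s := depth_ge0 _ _; have se : s <= eps := depth_le (ltW e0) xO.
move: xK; rewrite ler_norml => /andP[x1 x2].
have f1 : - B <= G (x.1 - s - eps, (x.1 - s - eps) ^+ 2).
  by apply: hB; rewrite ler_norml; apply/andP; split; lra.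
have f2 : - B <= G (x.1 - s + eps, (x.1 - s + eps) ^+ 2).
  by apply: hB; rewrite ler_norml; apply/andP; split; lra.
have c0 : 0 <= (eps - s) / (2 * eps) by rewrite divr_ge0 ?subr_ge0 // mulr_ge0 // ltW.
have d0 : 0 <= (eps + s) / (2 * eps) by rewrite divr_ge0 ?addr_ge0 ?(ltW e0) // mulr_ge0 // ltW.
have cd : (eps - s) / (2 * eps) + (eps + s) / (2 * eps) = 1.
  by field; rewrite gt_eqF.
rewrite -[leLHS](mul1r (- B)) -[X in X * - B]cd mulrDl.
by apply: lerD; rewrite ler_wpM2l.
Qed.

(** A concave function bounded by [M] on an interval has slopes at most 2M/eta
    at distance at least [eta] from the ends. *)
Lemma tangent_lipschitz eps (a M eta s t : R) G : locally_concave eps G ->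
  (forall th, `|th| <= eps -> `|G (tangent eps a th)| <= M) -> 0 < eta ->
  `|s| <= eps - eta -> `|t| <= eps - eta ->
  `|G (tangent eps a s) - G (tangent eps a t)| <= 2 * M / eta * `|s - t|.
Proof.
move=> cG hM eta0; wlog st : s t / s <= t.
  move=> W se te; have [st|/ltW ts] := leP s t; first exact: W.
  by rewrite distrC (distrC s) W.
move=> se te; rewrite (distrC s) (ger0_norm (_ : 0 <= t - s)) ?subr_ge0 //.
move: (se) (te); rewrite !ler_norml => /andP[s1 s2] /andP[t1 t2].
have eps0 : 0 <= eps by lra.
have se' : `|s| <= eps by apply: le_trans se _; lra.
have te' : `|t| <= eps by apply: le_trans te _; lra.
have ne : `|- eps| <= eps by rewrite normrN ger0_norm.
have pe : `|eps| <= eps by rewrite ger0_norm.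
have bound v : `|v| <= eps -> - M <= G (tangent eps a v) <= M by move=> /hM; rewrite ler_norml.
have /andP[a1 a2] := bound _ ne; have /andP[a3 a4] := bound _ pe.
have /andP[a5 a6] := bound _ se'; have /andP[a7 a8] := bound _ te'.
have M0 : 0 <= M by lra.
have key (lam u v w : R) : `|u| <= eps -> `|v| <= eps -> 0 <= lam -> lam <= 1 ->
    w = lam * u + (1 - lam) * v -> lam <= (t - s) / eta ->
    G (tangent eps a v) - G (tangent eps a w) <= 2 * M / eta * (t - s).
  move=> ue ve l0 l1 -> lb.
  have l1' : 0 <= 1 - lam by lra.
  have := cG _ _ (tangent_segment a ue ve) lam (1 - lam) l0 l1' (subrKC _ _).
  rewrite tangent_comb ?subrKC //.
  have /andP[b1 b2] := bound _ ue; have /andP[b3 b4] := bound _ ve.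
  move: (G (tangent eps a (lam * u + _))) => X.
  move: (G (tangent eps a u)) (G (tangent eps a v)) b1 b2 b3 b4 => U V b1 b2 b3 b4 h.
  have : lam * (V - U) <= lam * (2 * M) by rewrite ler_wpM2l //; lra.
  have -> : 2 * M / eta * (t - s) = (2 * M) * ((t - s) / eta) by field; rewrite gt_eqF.
  have : (2 * M) * lam <= (2 * M) * ((t - s) / eta) by rewrite ler_wpM2l // mulr_ge0.
  by lra.
have ts0 : 0 <= t - s by lra.
apply/andP; split.
  rewrite lerNl opprB.
  have p : 0 < t + eps by lra.
  apply: (key ((t - s) / (t + eps)) (- eps) t s) => //.
  - by rewrite divr_ge0 // ltW.
  - by rewrite ler_pdivrMr // mul1r; lra.
  - by field; rewrite gt_eqF.
  - by rewrite ler_wpM2l // lef_pV2 ?posrE //; lra.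
have p : 0 < eps - s by lra.
apply: (key ((t - s) / (eps - s)) eps s t) => //.
- by rewrite divr_ge0 // ltW.
- by rewrite ler_pdivrMr // mul1r; lra.
- by field; rewrite gt_eqF.
- by rewrite ler_wpM2l // lef_pV2 ?posrE //; lra.
Qed.

End Chords.

(** * Uniform estimates on compact sets *)

Section Uniformity.
Context {R : realType}.

(** Compactness turns a threshold that is locally uniform into a uniform one. *)
Lemma uniform_near (P : R -> R -> Prop) (a b : R) :
  (forall t, t \in `[a, b] -> \forall t' \near t & r \near 0^'+, P r t') ->
  exists2 r : R, 0 < r & forall t, t \in `[a, b] -> P r t.
Proof.
move=> h; have /compact_near_coveringP cov := @segment_compact R a b.
have near_r := cov _ _ _ (at_right_proper_filter (0:R)) h.
have : \forall r \near 0^'+, 0 < r /\ `[a, b] `<=` P r.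
  near=> r; split; first by near: r; exact: nbhs_right_gt.
  by near: r.
move=> /filter_ex[r [r0 hr]]; exists r => // t tab; exact: hr.
Unshelve. all: by end_near. Qed.

Lemma heine (g : R -> R) (a b eta : R) : continuous g -> 0 < eta ->
  exists2 r : R, 0 < r & forall t s, t \in `[a, b] -> `|s - t| <= r -> `|g s - g t| <= eta.
Proof.
move=> gc eta0.
have [|r r0 hr] := @uniform_near (fun r t => forall s, `|s - t| <= r -> `|g s - g t| <= eta) a b.
  move=> t _.
  have e2 : 0 < eta / 2 by rewrite divr_gt0.
  have /cvgrPdist_le/(_ _ e2)/nbhs_ballP[d /= d0 hd] := gc t.
  have d2 : 0 < d / 2 by rewrite divr_gt0.
  near=> t' r => s /= st.
  have tt' : `|t - t'| < d / 2 by near: t'; exact: (nbhsx_ballx t _ d2).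
  have rd : r < d / 2 by near: r; exact: nbhs_right_lt.
  have h1 : `|g t - g t'| <= eta / 2 by apply: hd; rewrite /ball /=; lra.
  have h2 : `|g t - g s| <= eta / 2.
    apply: hd; rewrite /ball /= -(subrKA t') (le_lt_trans (ler_normD _ _)) //.
    by rewrite (distrC t' s); lra.
  rewrite -(subrKA (g t)) (le_trans (ler_normD _ _)) //.
  by rewrite distrC; lra.
by exists r => // t s tab st; exact: hr.
Unshelve. all: by end_near. Qed.


Lemma within_continuous_dist (A : set (R * R)) (G : R * R -> R) :
  {within A, continuous G} <->
  (forall x (e : R), A x -> 0 < e -> exists2 d : R, 0 < d & forall y, A y ->
    `|x.1 - y.1| < d -> `|x.2 - y.2| < d -> `|G x - G y| <= e).
Proof.
rewrite -[X in X <-> _]/(continuous (G : subspace A -> R)) subspace_continuousP.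
split=> [c x e Ax e0|h x Ax].
  have /cvgrPdist_le/(_ _ e0) := c x Ax.
  rewrite /within /= => /nbhs_ballP[d /= d0 hd]; exists d => // y Ay h1 h2.
  by apply: hd.
apply/cvgrPdist_le => e e0; have [d d0 hd] := h x e Ax e0.
rewrite near_withinE; apply/nbhs_ballP; exists d => // y [h1 h2] Ay.
exact: hd.
Qed.

Lemma continuous_bounded (f : R -> R) (K : R) : continuous f -> 0 <= K ->
  exists2 B : R, 0 <= B & forall u, `|u| <= K -> `|f u| <= B.
Proof.
move=> fc K0; have KK : - K <= K by lra.
have nc : {within `[- K, K], continuous (fun u => `|f u|)}.
  by apply: continuous_subspaceT => u; apply: cvg_norm; exact: fc.
have [c _ hc] := @EVT_max R (fun u => `|f u|) _ _ KK nc.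
exists `|f c| => // u; rewrite ler_norml => /andP[u1 u2].
by apply: hc; rewrite in_itv /= u1.
Qed.

(** Near the lower parabola and for [v] near [x.1] the difference is at most
    [eta] by uniform continuity; elsewhere the quadratic term is bounded below,
    and [C] times it exceeds the oscillation of [f] and [G].  Averaged over an
    interval with [v] replaced by a function, the quadratic term becomes twice
    the variance. *)
Lemma boundary_defect (eps M eta : R) (f : R -> R) (G : R * R -> R) :
  0 < eps -> 0 <= M -> 0 < eta -> continuous f -> Lambda eps f G ->
  exists2 C : R, 0 <= C & forall x v, Omega eps x -> `|x.1| <= M -> `|v| <= M ->
    f v - G x <= eta + C * ((v - x.1) ^+ 2 + (x.2 - x.1 ^+ 2)).
Proof.
move=> e0 M0 eta0 fc [cG contG bG].
have e20 : 0 < eta / 2 by rewrite divr_gt0.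
have [|r r0 hr] := @uniform_near (fun r t => forall v h, `|v - t| <= r ->
    0 <= h -> h <= r -> h <= eps ^+ 2 -> f v - G (t, t ^+ 2 + h) <= eta) (- M) M.
  move=> t _.
  have tO : Omega eps (t, t ^+ 2) by rewrite /Omega /= lexx lerDl sqr_ge0.
  have [d d0 hd] := (within_continuous_dist _ _).1 contG _ _ tO e20.
  have [d' d'0 hd'] := (@heine f t t _ fc e20).
  have d20 : 0 < d / 2 by rewrite divr_gt0.
  have d'20 : 0 < d' / 2 by rewrite divr_gt0.
  have sqc : forall z : R, {for z, continuous (fun u : R => u ^+ 2)}.
    by move=> z; apply: cvgM; exact: cvg_id.
  have /cvgrPdist_lt/(_ _ d20) sqn := sqc t.
  near=> t' r => v h /= vt h0 hr he.
  have tt1 : `|t - t'| < d by near: t'; exact: (nbhsx_ballx t _ d0).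
  have tt2 : `|t - t'| < d' / 2 by near: t'; exact: (nbhsx_ballx t _ d'20).
  have tt3 : `|t ^+ 2 - t' ^+ 2| < d / 2 by near: t'; exact: sqn.
  have rd : r < d / 2 by near: r; exact: nbhs_right_lt.
  have rd' : r < d' / 2 by near: r; exact: nbhs_right_lt.
  have h1 : `|f v - f t| <= eta / 2.
    apply: hd'; first by rewrite in_itv /= lexx.
    rewrite -(subrKA t') (le_trans (ler_normD _ _)) // (distrC t' t); lra.
  have h2 : `|G (t, t ^+ 2) - G (t', t' ^+ 2 + h)| <= eta / 2.
    apply: hd => //=.
      by rewrite /Omega /= lerDl h0 lerD2l.
    rewrite opprD addrA (le_lt_trans (ler_normB _ _)) // (ger0_norm h0); lra.
  rewrite bG in h2; move: h1 h2; rewrite !ler_norml => /andP[_ ?] /andP[_ ?]; lra.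
have K0 : 0 <= M + 2 * eps by rewrite addr_ge0 // mulr_ge0 // ltW.
have [B B0 hB] := continuous_bounded fc K0.
pose m := Num.min (r ^+ 2) r.
have m0 : 0 < m by rewrite /m lt_min r0 exprn_gt0.
exists (2 * B / m); first by rewrite divr_ge0 ?mulr_ge0 // ltW.
move=> x v xO xM vM.
have h0 : 0 <= x.2 - x.1 ^+ 2 by move: xO => /andP[]; lra.
have he : x.2 - x.1 ^+ 2 <= eps ^+ 2 by move: xO => /andP[]; lra.
have C0 : 0 <= 2 * B / m by rewrite divr_ge0 ?mulr_ge0 // ltW.
have q0 := sqr_ge0 (v - x.1).
have [near|far] := boolP ((`|v - x.1| <= r) && (x.2 - x.1 ^+ 2 <= r)).
  have /andP[n1 n2] := near.
  have := hr x.1 _ v _ n1 h0 n2 he; rewrite in_itv /= -ler_norml => /(_ xM).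
  rewrite [x.1 ^+ 2 + _]addrC subrK -surjective_pairing => /le_trans; apply.
  by rewrite lerDl mulr_ge0 // addr_ge0.
have dm : m <= (v - x.1) ^+ 2 + (x.2 - x.1 ^+ 2).
  move: far; rewrite negb_and -!ltNge => /orP[far|far].
    have : m <= r ^+ 2 by rewrite /m ge_min lexx.
    have : r ^+ 2 <= (v - x.1) ^+ 2.
      by rewrite -[leRHS]real_normK ?num_real // ler_pXn2r ?nnegrE ?(ltW r0) // ltW.
    lra.
  have : m <= r by rewrite /m ge_min lexx orbT.
  lra.
have fB : f v <= B.
  apply: le_trans (ler_norm _) (hB v _).
  by apply: le_trans vM _; rewrite lerDl mulr_ge0 // ltW.
have hBl u : - (M + 2 * eps) <= u <= M + 2 * eps -> - B <= f u.
  by rewrite -ler_norml => /hB; rewrite ler_norml => /andP[].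
have GB : - B <= G x.
  apply: (concave_floor (K := M) e0 cG xO xM) => u; rewrite bG ler_norml; exact: hBl.
have : 2 * B <= 2 * B / m * ((v - x.1) ^+ 2 + (x.2 - x.1 ^+ 2)).
  by rewrite -{1}(divfK (lt0r_neq0 m0) (2 * B)) ler_wpM2l.
lra.
Unshelve. all: by end_near. Qed.

End Uniformity.

(** * Splitting an interval along a segment of the strip *)

Section Bisection.
Context {R : realType}.
Implicit Types (x y : R * R).

(** All the pieces are at most 1 - ga times as long as the interval that they
    come from, so that after finitely many splittings they are short enough. *)
Lemma bisection_bound (D : R -> R -> R) (a b ga rho K : R) :
  a < b -> 0 < ga -> ga < 1 -> 0 < rho ->
  (forall c d, a <= c -> c < d -> d <= b -> d - c <= rho -> D c d <= K * (d - c)) ->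
  (forall c d, a <= c -> c < d -> d <= b -> exists e, [/\ c < e, e < d,
     e - c <= (1 - ga) * (d - c), d - e <= (1 - ga) * (d - c) &
     D c d <= D c e + D e d]) ->
  D a b <= K * (b - a).
Proof.
move=> ab ga0 ga1 rho0 small split_.
have h n : forall c d, a <= c -> c < d -> d <= b -> (1 - ga) ^+ n * (d - c) <= rho ->
    D c d <= K * (d - c).
  elim: n => [|n IH] c d ac cd db; first by rewrite expr0 mul1r; exact: small.
  move=> hn; have [e [ce ed h1 h2 hD]] := split_ c d ac cd db.
  have p0 : 0 <= (1 - ga) ^+ n by rewrite exprn_ge0 // subr_ge0 ltW.
  have i1 : D c e <= K * (e - c).
    apply: IH => //; first exact: le_trans (ltW ed) db.
    by apply: le_trans hn; rewrite exprSr -mulrA ler_wpM2l.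
  have i2 : D e d <= K * (d - e).
    apply: IH => //; first exact: le_trans ac (ltW ce).
    by apply: le_trans hn; rewrite exprSr -mulrA ler_wpM2l.
  lra.
have : exists n, (1 - ga) ^+ n * (b - a) <= rho.
  have g1 : `|1 - ga| < 1 by rewrite ger0_norm ?subr_ge0 ?ltW // ltrBlDr ltrDl.
  have /cvgrPdist_lt/(_ (rho / (b - a))) := cvg_expr g1.
  rewrite divr_gt0 ?subr_gt0 // => /(_ isT)/filter_ex[n].
  rewrite sub0r normrN ger0_norm ?exprn_ge0 ?subr_ge0 ?(ltW ga1) // => hn.
  by exists n; rewrite -ler_pdivlMr ?subr_gt0 // ltW.
by case=> n; apply: h.
Qed.

Lemma combE (c d : R) x y : c *: x + d *: y = (c * x.1 + d * y.1, c * x.2 + d * y.2).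
Proof. by apply: injective_projections. Qed.

Lemma depth_comb (eps c d : R) x y : c + d = 1 ->
  eps ^+ 2 - ((c *: x + d *: y).2 - (c *: x + d *: y).1 ^+ 2) =
  c * (eps ^+ 2 - (x.2 - x.1 ^+ 2)) + d * (eps ^+ 2 - (y.2 - y.1 ^+ 2))
  - c * d * (x.1 - y.1) ^+ 2.
Proof. by move=> cd; rewrite combE /= (_ : d = 1 - c); [ring|lra]. Qed.

(** The converse of [segment_depth]. *)
Lemma depth_segment (eps : R) x y : Omega eps x -> Omega eps y ->
  `|x.1 - y.1| <= depth eps x + depth eps y -> segment_in eps x y.
Proof.
move=> xO yO h c d c0 d0 cd.
have s0 := depth_ge0 eps x; have s1 := depth_ge0 eps y.
have D2 : (x.1 - y.1) ^+ 2 <= (depth eps x + depth eps y) ^+ 2.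
  by rewrite -[leLHS]real_normK ?num_real // ler_pXn2r ?nnegrE ?addr_ge0.
have x2 := sqr_depth xO; have y2 := sqr_depth yO.
have q := depth_comb eps x y cd; rewrite -x2 -y2 in q.
have cd0 : 0 <= c * d by rewrite mulr_ge0.
have : 0 <= c * depth eps x ^+ 2 + d * depth eps y ^+ 2 - c * d * (x.1 - y.1) ^+ 2.
  have : c * d * (x.1 - y.1) ^+ 2 <= c * d * (depth eps x + depth eps y) ^+ 2.
    exact: ler_wpM2l.
  have : 0 <= (c * depth eps x - d * depth eps y) ^+ 2 by exact: sqr_ge0.
  have -> : d = 1 - c by lra.
  nra.
have l0 : 0 <= (c *: x + d *: y).2 - (c *: x + d *: y).1 ^+ 2.
  have := depth_comb 0 x y cd; rewrite expr0n /= !sub0r.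
  move: xO yO => /andP[x0 _] /andP[y0 _] e.
  have : 0 <= c * (x.2 - x.1 ^+ 2) by rewrite mulr_ge0 // subr_ge0.
  have : 0 <= d * (y.2 - y.1 ^+ 2) by rewrite mulr_ge0 // subr_ge0.
  have : 0 <= c * d * (x.1 - y.1) ^+ 2 by rewrite mulr_ge0 ?sqr_ge0 // mulr_ge0.
  lra.
by move=> l1; apply/andP; split; lra.
Qed.

(** When the depths of [x] and [z] add up to their horizontal distance, the
    quadratic polynomial of [segment_depth] is a perfect square, so it is
    nonnegative on the whole line and not just between [x] and [z]. *)
Lemma tangent_extension (eps r : R) x y : Omega eps x -> Omega eps y -> 0 < r -> r < 1 ->
  let z := r *: x + (1 - r) *: y in Omega eps z ->
  `|x.1 - z.1| = depth eps x + depth eps z -> segment_in eps x y.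
Proof.
move=> xO yO r0 r1 z zO tan c d c0 d0 cd.
have x2 := sqr_depth xO; have z2 := sqr_depth zO.
have r10 : 0 < 1 - r by lra.
have D2 : (x.1 - z.1) ^+ 2 = (depth eps x + depth eps z) ^+ 2.
  by rewrite -[LHS]real_normK ?num_real // tan.
have yE : d *: y = (d / (1 - r)) *: (z - r *: x).
  by rewrite /z addrAC subrr add0r scalerA divfK ?gt_eqF.
have pE : c *: x + d *: y = (1 - d / (1 - r)) *: x + (d / (1 - r)) *: z.
  rewrite yE scalerBr scalerA addrCA addrC; congr (_ + _).
  rewrite -scaleNr -scalerDl; congr (_ *: _).
  have -> : c = 1 - d by lra.
  by field; rewrite gt_eqF.
have l0 : 0 <= (c *: x + d *: y).2 - (c *: x + d *: y).1 ^+ 2.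
  have := depth_comb 0 x y cd; rewrite expr0n /= !sub0r.
  move: xO yO => /andP[x0 _] /andP[y0 _] e.
  have : 0 <= c * (x.2 - x.1 ^+ 2) by rewrite mulr_ge0 // subr_ge0.
  have : 0 <= d * (y.2 - y.1 ^+ 2) by rewrite mulr_ge0 // subr_ge0.
  have : 0 <= c * d * (x.1 - y.1) ^+ 2 by rewrite mulr_ge0 ?sqr_ge0 // mulr_ge0.
  lra.
set t := d / (1 - r) in pE.
have q := @depth_comb eps (1 - t) t x z (subrK _ _).
rewrite -pE -x2 -z2 D2 in q.
have : 0 <= ((1 - t) * depth eps x - t * depth eps z) ^+ 2 by exact: sqr_ge0.
have -> : ((1 - t) * depth eps x - t * depth eps z) ^+ 2 =
   (1 - t) * depth eps x ^+ 2 + t * depth eps z ^+ 2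
   - (1 - t) * t * (depth eps x + depth eps z) ^+ 2 by ring.
by rewrite -q => l1; apply/andP; split; lra.
Qed.

(** For primitives [P1] of [phi] and [P2] of [phi]^2 these are the averages over
    [c, d]. *)
Definition avgpt (P1 P2 : R -> R) (c d : R) : R * R :=
  ((P1 d - P1 c) / (d - c), (P2 d - P2 c) / (d - c)).

Lemma avgpt_comb P1 P2 c e d : c < e -> e < d ->
  avgpt P1 P2 c d = ((e - c) / (d - c)) *: avgpt P1 P2 c e
                  + ((d - e) / (d - c)) *: avgpt P1 P2 e d.
Proof.
move=> ce ed; rewrite combE /avgpt /=.
have h1 : e - c != 0 by rewrite gt_eqF ?subr_gt0.
have h2 : d - e != 0 by rewrite gt_eqF ?subr_gt0.
have h3 : d - c != 0 by rewrite gt_eqF ?subr_gt0 // (lt_trans ce).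
by congr (_, _); field; rewrite h1 h2 h3.
Qed.

(** Move the splitting point [e] from the midpoint to [d].  The point of [c, e]
    then moves to that of [c, d]; by continuity the segment between them is
    tangent to the upper parabola at some moment, and [tangent_extension]
    applies.  The part [e, d] is not too short, because the two ends of the
    tangent segment are at a definite distance below the upper parabola. *)
Lemma half_split (P1 P2 : R -> R) (eps del c d : R) : continuous P1 -> continuous P2 ->
  0 < del -> del < eps -> c < d ->
  (forall s t, c <= s -> s < t -> t <= d -> Omega del (avgpt P1 P2 s t)) ->
  let m := (c + d) / 2 in
  depth eps (avgpt P1 P2 c m) + depth eps (avgpt P1 P2 c d) <
    `|(avgpt P1 P2 c m).1 - (avgpt P1 P2 c d).1| ->
  exists e, [/\ m <= e, e < d, (d - e) * eps >= Num.sqrt (eps ^+ 2 - del ^+ 2) * (d - c) &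
    segment_in eps (avgpt P1 P2 c e) (avgpt P1 P2 e d)].
Proof.
move=> c1 c2 del0 dele cd inO m bad.
have cm : c < m by rewrite /m; lra.
have md : m < d by rewrite /m; lra.
have eps0 : 0 < eps by lra.
have de2 : del ^+ 2 <= eps ^+ 2 by rewrite ler_pXn2r ?nnegrE ?ltW.
have subO x : Omega del x -> Omega eps x.
  by move=> /andP[? ?]; apply/andP; split => //; lra.
have deep x : Omega del x -> Num.sqrt (eps ^+ 2 - del ^+ 2) <= depth eps x.
  move=> /andP[? ?]; rewrite /depth ler_wsqrtr //; lra.
have sig0 : 0 < Num.sqrt (eps ^+ 2 - del ^+ 2).
  by rewrite sqrtr_gt0 subr_gt0 ltr_pXn2r ?nnegrE ?ltW.
set sig := Num.sqrt _ in deep sig0 *.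
pose z := avgpt P1 P2 c d.
have zO : Omega del z by apply: inO.
pose g e := depth eps (avgpt P1 P2 c e) + depth eps z - `|(avgpt P1 P2 c e).1 - z.1|.
have ptc e : e != c -> {for e, continuous (fun e => avgpt P1 P2 c e)}.
  move=> ec; have ec0 : e - c != 0 by rewrite subr_eq0.
  have qc (P : R -> R) : continuous P -> {for e, continuous (fun e => (P e - P c) / (e - c))}.
    move=> Pc; apply: cvgM; first by apply: cvgB; [exact: Pc|exact: cvg_cst].
    by apply: cvgV => //; apply: cvgB; [exact: cvg_id|exact: cvg_cst].
  rewrite /continuous_at /avgpt.
  apply: (@cvg_pair _ _ _ _ (nbhs _) (nbhs _)); [exact: qc|exact: qc].
have gc : {within `[m, d], continuous g}.
  apply: continuous_in_subspaceT => e; rewrite inE /= in_itv /= => /andP[me _].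
  have ec : e != c by rewrite gt_eqF // (lt_le_trans cm).
  have pc := ptc e ec.
  apply: cvgB.
    apply: cvgD; last exact: cvg_cst.
    by apply: continuous_comp; [exact: pc|exact: depth_continuous].
  apply: cvg_norm; apply: cvgB; last exact: cvg_cst.
  by apply: (continuous_comp pc); exact: cvg_fst.
have gm : g m < 0 by rewrite /g subr_lt0.
have gd : 0 < g d.
  rewrite /g -/z subrr normr0 subr0 addr_gt0 // (lt_le_trans sig0) // deep //.
have [|e] := @IVT R g m d 0 (ltW md) gc.
  by rewrite ge_min le_max (ltW gm) (ltW gd) orbT.
rewrite in_itv /= => /andP[me ed] ge0.
have {}ed : e < d by rewrite lt_neqAle ed andbT; apply: contraTneq gd => <-; rewrite ge0 ltxx.
have ce : c < e by apply: lt_le_trans me.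
have xO : Omega del (avgpt P1 P2 c e) by apply: inO => //; exact: ltW.
have yO : Omega del (avgpt P1 P2 e d) by apply: inO => //; exact: ltW.
have tan : `|(avgpt P1 P2 c e).1 - z.1| = depth eps (avgpt P1 P2 c e) + depth eps z.
  by apply/eqP; rewrite eq_sym -subr_eq0; apply/eqP.
have dc0 : 0 < d - c by rewrite subr_gt0.
have zE : z = ((e - c) / (d - c)) *: avgpt P1 P2 c e
    + (1 - (e - c) / (d - c)) *: avgpt P1 P2 e d.
  rewrite /z (avgpt_comb _ _ ce ed); congr (_ + _ *: _).
  by field; rewrite gt_eqF.
have seg : segment_in eps (avgpt P1 P2 c e) (avgpt P1 P2 e d).
  apply: (@tangent_extension eps ((e - c) / (d - c))); try exact: subO.
  - by rewrite divr_gt0 // subr_gt0.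
  - by rewrite ltr_pdivrMr // mul1r ltrD2r.
  - by rewrite -zE; exact: subO.
  - by rewrite -zE.
exists e; split => //.
have := segment_depth seg.
have : depth eps (avgpt P1 P2 c e) <= eps by apply: depth_le; [exact: ltW|exact: subO].
have : depth eps (avgpt P1 P2 e d) <= eps by apply: depth_le; [exact: ltW|exact: subO].
have : 2 * sig <= `|(avgpt P1 P2 c e).1 - z.1|.
  by rewrite tan mulr_natl mulr2n lerD // deep.
have -> : `|(avgpt P1 P2 c e).1 - z.1| =
    (d - e) / (d - c) * `|(avgpt P1 P2 c e).1 - (avgpt P1 P2 e d).1|.
  rewrite -[X in X * _]ger0_norm; last by rewrite divr_ge0 ?subr_ge0 // ltW.
  rewrite -normrM; congr `|_|; rewrite zE combE /=.
  by field; rewrite !gt_eqF ?subr_gt0.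
move=> h1 h2 h3 h4.
have h5 : `|(avgpt P1 P2 c e).1 - (avgpt P1 P2 e d).1| <= 2 * eps by lra.
have : 2 * sig <= (d - e) / (d - c) * (2 * eps).
  by apply: (le_trans h1); rewrite ler_wpM2l // divr_ge0 ?subr_ge0 // ltW.
rewrite mulrAC ler_pdivlMr //; lra.
Qed.


Lemma avgpt_reflect (P1 P2 : R -> R) c d s t :
  avgpt (fun t => - P1 (c + d - t)) (fun t => - P2 (c + d - t)) s t =
  avgpt P1 P2 (c + d - t) (c + d - s).
Proof.
rewrite /avgpt; have -> : c + d - s - (c + d - t) = t - s by ring.
by congr (_ / _, _ / _); ring.
Qed.

Lemma segment_in_sym (eps : R) x y : segment_in eps x y -> segment_in eps y x.
Proof. by move=> s c d c0 d0 cd; rewrite addrC; apply: s => //; rewrite addrC. Qed.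

Lemma segment_in_midpoint (eps : R) x y : let z := (1 / 2) *: x + (1 / 2) *: y in
  segment_in eps x z -> segment_in eps z y -> segment_in eps x y.
Proof.
move=> z xz zy c d c0 d0 cd; have cE : c = 1 - d by lra.
have [d2|d2] := leP d (1 / 2).
  have := xz (1 - 2 * d) (2 * d); rewrite /z scalerDr addrA !scalerA -scalerDl.
  have -> : 1 - 2 * d + 2 * d * (1 / 2) = c by rewrite cE; field.
  have -> : 2 * d * (1 / 2) = d by field.
  apply; lra.
have := zy (2 * c) (1 - 2 * c); rewrite /z scalerDr -addrA !scalerA -scalerDl.
have -> : 2 * c * (1 / 2) = c by field.
have -> : c + (1 - 2 * c) = d by lra.
apply; lra.
Qed.

(** Split at the midpoint if this is possible.  Otherwise the segment leaves
    the strip on one side of the point of [c, d], and [half_split] applies on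
    that side, after reflection if it is the right one. *)
Lemma bellman_split (P1 P2 : R -> R) (eps del c d : R) :
  continuous P1 -> continuous P2 -> 0 < del -> del < eps -> c < d ->
  (forall s t, c <= s -> s < t -> t <= d -> Omega del (avgpt P1 P2 s t)) ->
  let ga := Num.sqrt (eps ^+ 2 - del ^+ 2) / (2 * eps) in
  exists e, [/\ c < e, e < d, e - c <= (1 - ga) * (d - c), d - e <= (1 - ga) * (d - c) &
    segment_in eps (avgpt P1 P2 c e) (avgpt P1 P2 e d)].
Proof.
move=> c1 c2 del0 dele cd inO; set sig := Num.sqrt _ => ga.
have eps0 : 0 < eps by lra.
have de2 : del ^+ 2 <= eps ^+ 2 by rewrite ler_pXn2r ?nnegrE ?ltW.
have subO x : Omega del x -> Omega eps x.
  by move=> /andP[? ?]; apply/andP; split => //; lra.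
have sige : sig <= eps.
  rewrite -(ger0_norm (ltW eps0)) -sqrtr_sqr ler_wsqrtr // gerBl sqr_ge0 //.
have gaE : 2 * eps * ga = sig by rewrite /ga mulrC divfK // gt_eqF // mulr_gt0.
have ga2 : ga <= 1 / 2.
  by rewrite -(ler_pM2l (_ : 0 < 2 * eps)) ?gaE ?mulr_gt0 //; lra.
have dc0 : 0 < d - c by rewrite subr_gt0.
pose m := (c + d) / 2.
have cm : c < m by rewrite /m; lra.
have md : m < d by rewrite /m; lra.
have gabound l : sig * (d - c) <= l * eps -> ga * (d - c) <= l.
  move=> h; have : eps * (2 * (ga * (d - c))) <= eps * l.
    have -> : eps * (2 * (ga * (d - c))) = sig * (d - c) by rewrite -gaE; ring.
    by rewrite (mulrC eps l).
  rewrite ler_pM2l // => {}h.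
  have : 0 <= ga * (d - c) by rewrite mulr_ge0 ?(ltW dc0) // divr_ge0 ?sqrtr_ge0 // mulr_ge0 // ltW.
  lra.
have [bad1|ok1] := ltP (depth eps (avgpt P1 P2 c m) + depth eps (avgpt P1 P2 c d))
    `|(avgpt P1 P2 c m).1 - (avgpt P1 P2 c d).1|.
  have [e [me ed h seg]] := half_split c1 c2 del0 dele cd inO bad1.
  exists e; split => //; first exact: lt_le_trans me.
    by have := gabound _ h; lra.
  have : (1 / 2) * (d - c) <= (1 - ga) * (d - c) by rewrite ler_pM2r //; lra.
  by rewrite -/m in me; rewrite /m in me; lra.
have [bad2|ok2] := ltP (depth eps (avgpt P1 P2 m d) + depth eps (avgpt P1 P2 c d))
    `|(avgpt P1 P2 m d).1 - (avgpt P1 P2 c d).1|.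
  pose Q (P : R -> R) t := - P (c + d - t).
  have Qc P : continuous P -> continuous (Q P).
    move=> Pc t; apply: cvgN.
    apply: (@continuous_comp _ _ _ (fun t => c + d - t) P); last exact: Pc.
    by apply: cvgB; [exact: cvg_cst|exact: cvg_id].
  have QE s t : avgpt (Q P1) (Q P2) s t = avgpt P1 P2 (c + d - t) (c + d - s).
    exact: avgpt_reflect.
  have [||e [me ed h seg]] := half_split (Qc _ c1) (Qc _ c2) del0 dele cd.
  - by move=> s t cs st td; rewrite QE; apply: inO; lra.
  - rewrite !QE.
    have -> : c + d - (c + d) / 2 = m by rewrite /m; field.
    have -> : c + d - c = d by ring.
    by have -> : c + d - d = c by ring.
  exists (c + d - e); split; try lra.
  - have : (1 / 2) * (d - c) <= (1 - ga) * (d - c) by rewrite ler_pM2r //; lra.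
    lra.
  - by have := gabound _ h; lra.
  - move: seg; rewrite !QE => /segment_in_sym.
    have -> : c + d - c = d by ring.
    by have -> : c + d - d = c by ring.
exists m; split => //.
- have : (1 / 2) * (d - c) <= (1 - ga) * (d - c) by rewrite ler_pM2r //; lra.
  by rewrite /m; lra.
- have : (1 / 2) * (d - c) <= (1 - ga) * (d - c) by rewrite ler_pM2r //; lra.
  by rewrite /m; lra.
have zE : avgpt P1 P2 c d = (1 / 2) *: avgpt P1 P2 c m + (1 / 2) *: avgpt P1 P2 m d.
  rewrite (avgpt_comb _ _ cm md); have dn : d - c != 0 by rewrite gt_eqF.
  by congr (_ *: _ + _ *: _); rewrite /m; field.
apply: segment_in_midpoint; rewrite -zE.
- by apply: depth_segment => //; apply: subO; apply: inO => //; exact: ltW.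
- apply: segment_in_sym.
  by apply: depth_segment => //; apply: subO; apply: inO => //; exact: ltW.
Qed.

End Bisection.

(** * Integrals over open intervals and their primitives *)

Section IntervalIntegrals.
Context {R : realType}.
Local Notation mu := (@lebesgue_measure R).
Implicit Types (a b c d e s t : R) (h g : R -> R).

Definition itv_integrable a b h := mu.-integrable `]a, b[ (EFin \o h).

Definition itv_integral a b h : R := \int[mu]_(t in `]a, b[) h t.

Lemma itv_measure c d : c <= d -> mu `]c, d[%classic = (d - c)%:E.
Proof.
rewrite lebesgue_measure_itv /= lte_fin le_eqVlt => /predU1P[->|->]; last by rewrite EFinB.
by rewrite ltxx subrr.
Qed.

Lemma itv_measure_fin c d : (mu `]c, d[%classic < +oo)%E.
Proof. by rewrite lebesgue_measure_itv /=; case: ifP => // _; rewrite -EFinB ltry. Qed.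

Lemma itv_integrable_sub a b c d h : itv_integrable a b h -> a <= c -> d <= b ->
  itv_integrable c d h.
Proof.
move=> hi ac db; apply: integrableS hi => //.
by apply: subset_itv; rewrite bnd_simp.
Qed.

Lemma itv_integrable_bounded a b h M : measurable_fun `]a, b[ h ->
  (forall t, t \in `]a, b[ -> `|h t| <= M) -> itv_integrable a b h.
Proof.
move=> mh hM; apply: measurable_bounded_integrable => //.
  exact: itv_measure_fin.
by exists M; split; [rewrite num_real|move=> x /ltW Mx t /= tab; rewrite (le_trans _ Mx) ?hM].
Qed.

Lemma itv_integral_cst c d r : c <= d -> itv_integral c d (fun=> r) = r * (d - c).
Proof.
move=> cd; rewrite /itv_integral Rintegral_cst //; congr (_ * _).
exact: (congr1 fine (itv_measure cd)).
Qed.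

Lemma itv_integrable_cst c d r : itv_integrable c d (fun=> r).
Proof. by apply: (@itv_integrable_bounded _ _ _ `|r|) => // t _. Qed.

Lemma itv_integral_nil c d h : d <= c -> itv_integral c d h = 0.
Proof.
move=> dc; rewrite /itv_integral set_itv_ge ?Rintegral_set0 //.
by rewrite bnd_simp -leNgt.
Qed.

Lemma itv_integral_chasles c e d h : itv_integrable c d h -> c <= e -> e <= d ->
  itv_integral c d h = itv_integral c e h + itv_integral e d h.
Proof.
move=> hi; rewrite le_eqVlt => /predU1P[->|ce].
  by rewrite (@itv_integral_nil e e) // add0r.
rewrite le_eqVlt => /predU1P[->|ed].
  by rewrite (@itv_integral_nil d d) // addr0.
have := @Rintegral_itvB R h (BRight c) (BLeft d) e hi.
rewrite !bnd_simp => /(_ (ltW ce) ed) /eqP; rewrite subr_eq addrC => /eqP.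
rewrite /itv_integral => ->; congr (_ + _).
rewrite Rintegral_itv_bndo_bndc //.
exact: (itv_integrable_sub hi (lexx _) (ltW ed)).
Qed.

Lemma le_itv_integral c d h g : itv_integrable c d h -> itv_integrable c d g ->
  (forall t, t \in `]c, d[ -> h t <= g t) -> itv_integral c d h <= itv_integral c d g.
Proof. by move=> hi gi hg; apply: le_Rintegral. Qed.

Lemma itv_integralD c d h g : itv_integrable c d h -> itv_integrable c d g ->
  itv_integral c d (fun t => h t + g t) = itv_integral c d h + itv_integral c d g.
Proof. by move=> hi gi; apply: RintegralD. Qed.

Lemma itv_integralZ c d r h : itv_integrable c d h ->
  itv_integral c d (fun t => r * h t) = r * itv_integral c d h.
Proof. by move=> hi; apply: RintegralZl. Qed.

Lemma itv_integrableD c d h g : itv_integrable c d h -> itv_integrable c d g ->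
  itv_integrable c d (fun t => h t + g t).
Proof. by move=> hi gi; apply: (integrableD _ hi gi). Qed.

Lemma itv_integrableZ c d r h : itv_integrable c d h ->
  itv_integrable c d (fun t => r * h t).
Proof. by move=> hi; apply: (integrableZl _ r hi). Qed.

Lemma itv_integrable_norm c d h : itv_integrable c d h ->
  itv_integrable c d (fun t => `|h t|).
Proof. exact: integrable_norm. Qed.

Lemma itv_integral_bound c d h M : c <= d -> itv_integrable c d h ->
  (forall t, t \in `]c, d[ -> `|h t| <= M) -> `|itv_integral c d h| <= M * (d - c).
Proof.
move=> cd hi hM; rewrite /itv_integral (le_trans (le_normr_Rintegral _ hi)) //.
rewrite -itv_integral_cst //; apply: le_itv_integral => //.
  exact: itv_integrable_norm.
exact: itv_integrable_cst.
Qed.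

Definition clamp a b t := Num.min (Num.max a t) b.

Lemma clamp_id a b t : a <= t -> t <= b -> clamp a b t = t.
Proof. by move=> at_ tb; rewrite /clamp (max_r at_) (min_l tb). Qed.

Lemma clamp_in a b t : a <= b -> a <= clamp a b t <= b.
Proof.
by move=> ab; rewrite /clamp le_min ge_min lexx orbT andbT ab andbT le_max lexx.
Qed.

Lemma clamp_mono a b s t : s <= t -> clamp a b s <= clamp a b t.
Proof.
move=> st; rewrite /clamp; case: (leP a s) => ?; case: (leP a t) => ?;
by repeat match goal with |- context [Num.min ?x ?y] => case: (leP x y) => ? end; lra.
Qed.

Lemma clamp_lip a b s t : a <= b -> `|clamp a b s - clamp a b t| <= `|s - t|.
Proof.
move=> ab; wlog st : s t / s <= t.
  by move=> W; have [/W //|/ltW/W] := leP s t; rewrite distrC (distrC t).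
rewrite distrC (distrC s) !ger0_norm ?subr_ge0 ?clamp_mono //.
rewrite /clamp; case: (leP a s) => ?; case: (leP a t) => ?;
by repeat match goal with |- context [Num.min ?x ?y] => case: (leP x y) => ? end; lra.
Qed.

Lemma lipschitz_cont (F : R -> R) M : (forall s t, `|F s - F t| <= M * `|s - t|) ->
  continuous F.
Proof.
move=> FM t; apply/cvgrPdist_le => e e0; apply/nbhs_ballP.
have M0 : 0 <= M by have := FM 1 0; rewrite subr0 normr1 mulr1; apply: le_trans.
have M1 : 0 < M + 1 by lra.
exists (e / (M + 1)); first by rewrite /= divr_gt0.
move=> s; rewrite /ball /= => st; apply: (le_trans (FM _ _)).
have : (M + 1) * `|t - s| <= e by rewrite mulrC -ler_pdivlMr // ltW.
have := normr_ge0 (t - s); lra.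
Qed.

(** Clamping makes the primitive constant outside [a, b], hence continuous on
    the whole line. *)
Definition primitive a b h t := itv_integral a (clamp a b t) h.

Lemma primitiveB a b h s t : itv_integrable a b h -> a <= s -> s <= t -> t <= b ->
  primitive a b h t - primitive a b h s = itv_integral s t h.
Proof.
move=> hi as_ st tb; have at_ := le_trans as_ st; have sb := le_trans st tb.
rewrite /primitive !clamp_id //.
have := itv_integral_chasles (itv_integrable_sub hi (lexx _) tb) as_ st.
by move=> ->; rewrite addrAC subrr add0r.
Qed.

Lemma primitive_cont a b h M : a <= b -> itv_integrable a b h ->
  (forall t, t \in `]a, b[ -> `|h t| <= M) -> continuous (primitive a b h).
Proof.
move=> ab hi hM.
have [M' M'0 hM'] : exists2 M' : R, 0 <= M' & forall t, t \in `]a, b[ -> `|h t| <= M'.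
  exists `|M| => // t tab; exact: le_trans (hM t tab) (ler_norm _).
apply: (@lipschitz_cont _ M') => s t; wlog st : s t / s <= t.
  by move=> W; have [/W //|/ltW/W] := leP s t; rewrite distrC (distrC t).
have /andP[s1 s2] := clamp_in s ab; have /andP[t1 t2] := clamp_in t ab.
have c12 := clamp_mono a b st.
have -> : primitive a b h s - primitive a b h t =
    - itv_integral (clamp a b s) (clamp a b t) h.
  by rewrite -(primitiveB hi s1 c12 t2) opprB /primitive
    (clamp_id s1 s2) (clamp_id t1 t2).
rewrite normrN (le_trans (itv_integral_bound (M := M') c12 _ _)) //.
- exact: itv_integrable_sub hi s1 t2.
- move=> u; rewrite in_itv /= => /andP[u1 u2]; apply: hM'.
  by rewrite in_itv /= (le_lt_trans s1 u1) (lt_le_trans u2 t2).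
- by rewrite ler_wpM2l // (le_trans _ (clamp_lip s t ab)) // distrC ler_norm.
Qed.

End IntervalIntegrals.

(** * Bellman induction for bounded functions *)

Section BellmanInduction.
Context {R : realType}.
Local Notation mu := (@lebesgue_measure R).
Implicit Types (a b c d s t M : R) (phi f : R -> R).

Lemma itv_integral_sqr phi c d k : c <= d -> itv_integrable c d phi ->
  itv_integrable c d (fun t => phi t ^+ 2) ->
  itv_integrable c d (fun t => (phi t - k) ^+ 2) /\
  itv_integral c d (fun t => (phi t - k) ^+ 2) =
  itv_integral c d (fun t => phi t ^+ 2) - 2 * k * itv_integral c d phi + k ^+ 2 * (d - c).
Proof.
move=> cd i1 i2.
have -> : (fun t => (phi t - k) ^+ 2) =
    (fun t => (phi t ^+ 2 + (- (2 * k)) * phi t) + k ^+ 2).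
  by apply/funext => t; ring.
have i3 := itv_integrableZ (- (2 * k)) i1.
have i4 := itv_integrableD i2 i3.
have i5 := itv_integrable_cst c d (k ^+ 2).
split; first exact: itv_integrableD i4 i5.
by rewrite (itv_integralD i4 i5) (itv_integralD i2 i3) itv_integralZ // itv_integral_cst // mulNr.
Qed.

Definition bellman_point phi c d : R * R :=
  (itv_integral c d phi / (d - c), itv_integral c d (fun t => phi t ^+ 2) / (d - c)).

(** Continuous functions are dense in L^1. *)
Lemma continuous_approx phi a b e : itv_integrable a b phi -> 0 < e ->
  exists g : R -> R, [/\ continuous g, itv_integrable a b (fun t => `|phi t - g t|) &
    itv_integral a b (fun t => `|phi t - g t|) <= e].
Proof.
move=> iphi e0.
have [g [gc gi glim]] := approximation_continuous_integrable
  (measurable_itv `]a, b[) (itv_measure_fin a b) iphi.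
have idiff n : itv_integrable a b (fun t => `|phi t - g n t|).
  apply: (@itv_integrable_norm _ _ _ (fun t => phi t - g n t)).
  exact: (integrableB _ iphi (gi n)).
move/fine_cvgP: glim => [_ /cvgrPdist_le/(_ _ e0)/filter_ex[n hn]].
exists (g n); split => //; move: hn => /=.
rewrite sub0r normrN; apply: le_trans; exact: ler_norm.
Qed.

(** The integral of |phi - g|, for [g] continuous and close to [phi] in L^1, is
    additive, so a multiple of it may be subtracted from the defect without
    disturbing the splitting argument.  On short intervals [boundary_defect]
    bounds the defect by the variance of [phi], which that integral and the
    oscillation of [g] control. *)
Lemma bounded_bellman (a b M eps del : R) phi f G :
  a < b -> 0 <= M -> measurable_fun `]a, b[ phi ->
  (forall t, t \in `]a, b[ -> `|phi t| <= M) -> 0 < del -> del < eps ->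
  (forall s t, a <= s -> s < t -> t <= b -> Omega del (bellman_point phi s t)) ->
  continuous f -> Lambda eps f G ->
  itv_integral a b (f \o phi) <= (b - a) * G (bellman_point phi a b).
Proof.
move=> ab M0 mphi phiM del0 dele inO fc LG.
have eps0 : 0 < eps by lra.
have ba0 : 0 < b - a by rewrite subr_gt0.
have iphi : itv_integrable a b phi by exact: itv_integrable_bounded phiM.
have phi2M t : t \in `]a, b[ -> `|phi t ^+ 2| <= M ^+ 2.
  by move=> /phiM h; rewrite normrX ler_pXn2r ?nnegrE.
have iphi2 : itv_integrable a b (fun t => phi t ^+ 2).
  by apply: itv_integrable_bounded phi2M; exact: measurable_funX.
have [B B0 fB] := continuous_bounded fc M0.
have ifphi : itv_integrable a b (f \o phi).
  apply: (@itv_integrable_bounded _ _ _ _ B).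
    by apply: measurableT_comp => //; exact: continuous_measurable_fun.
  by move=> t tab; apply: fB; exact: phiM.
pose P1 := primitive a b phi; pose P2 := primitive a b (fun t => phi t ^+ 2).
have c1 : continuous P1 by apply: primitive_cont phiM => //; exact: ltW.
have c2 : continuous P2 by apply: primitive_cont phi2M => //; exact: ltW.
have ptE s t : a <= s -> s < t -> t <= b -> avgpt P1 P2 s t = bellman_point phi s t.
  by move=> as_ st tb; rewrite /avgpt /bellman_point !primitiveB // ltW.
have del2 : del ^+ 2 <= eps ^+ 2 by rewrite ler_pXn2r ?nnegrE ?ltW.
have subO x : Omega del x -> Omega eps x.
  by move=> /andP[? ?]; apply/andP; split => //; lra.
apply/ler_addgt0Pr => z z0.
pose L := b - a.
have [C C0 hC] := boundary_defect eps0 M0 (divr_gt0 z0 (mulr_gt0 (ltr0n _ 3) ba0)) fc LG.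
set eta := z / _ in hC.
(* The three errors eta (b - a), 4CM eta' (b - a) and 4CM |phi - g|_1 are
   at most z / 3 each; q bounds 4CM and is positive. *)
pose q := 4 * C * M + 1.
have CM0 : 0 <= 4 * C * M by rewrite !mulr_ge0.
have q0 : 0 < q by rewrite /q; lra.
have eta'0 : 0 < z / (3 * L * q) by rewrite divr_gt0 // !mulr_gt0.
have [g [gc ig gN]] := continuous_approx iphi (divr_gt0 z0 (mulr_gt0 (ltr0n _ 3) q0)).
have [rho rho0 hrho] := heine a b gc eta'0.
set eta' := z / _ in eta'0 hrho.
pose D c d := itv_integral c d (f \o phi) - (d - c) * G (avgpt P1 P2 c d)
  - 4 * C * M * itv_integral c d (fun t => `|phi t - g t|).
have sig0 : 0 < Num.sqrt (eps ^+ 2 - del ^+ 2).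
  by rewrite sqrtr_gt0 subr_gt0 ltr_pXn2r ?nnegrE ?ltW.
have sige : Num.sqrt (eps ^+ 2 - del ^+ 2) <= eps.
  by rewrite -[leRHS](ger0_norm (ltW eps0)) -sqrtr_sqr ler_wsqrtr // gerBl sqr_ge0.
have DK : D a b <= (eta + 4 * C * M * eta') * (b - a).
  apply: (@bisection_bound _ D a b (Num.sqrt (eps ^+ 2 - del ^+ 2) / (2 * eps)) rho) => //.
  - by rewrite divr_gt0 // mulr_gt0.
  - by rewrite ltr_pdivrMr ?mulr_gt0 //; lra.
  - move=> c d ac cd db small.
    have cd' := ltW cd; have dc0 : 0 < d - c by rewrite subr_gt0.
    have i1 := itv_integrable_sub iphi ac db; have i2 := itv_integrable_sub iphi2 ac db.
    have i3 := itv_integrable_sub ifphi ac db; have i4 := itv_integrable_sub ig ac db.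
    rewrite /D ptE //; set x := bellman_point phi c d.
    have sub t : t \in `]c, d[ -> t \in `]a, b[.
      by rewrite !in_itv /= => /andP[? ?]; rewrite (le_lt_trans ac) // (lt_le_trans _ db).
    have x1E : itv_integral c d phi = x.1 * (d - c) by rewrite /x /= divfK // gt_eqF.
    have x2E : itv_integral c d (fun t => phi t ^+ 2) = x.2 * (d - c).
      by rewrite /x /= divfK // gt_eqF.
    have x1M : `|x.1| <= M.
      have := itv_integral_bound cd' i1 (fun t h => phiM t (sub t h)).
      by rewrite x1E normrM (gtr0_norm dc0) ler_pM2r.
    have xO : Omega eps x by apply: subO; apply: inO.
    pose V := x.2 - x.1 ^+ 2.
    have [j1 e1] := itv_integral_sqr x.1 cd' i1 i2.
    (* A constant near phi on (c, d), kept within the bounds of phi so that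
       (phi - k)^2 <= 2M |phi - k|. *)
    pose k := clamp (- M) M (g c).
    have MM : - M <= M by lra.
    have /andP[k1 k2] := clamp_in (g c) MM; rewrite -/k in k1 k2.
    have [j2 e2] := itv_integral_sqr k cd' i1 i2.
    have cin : c \in `[a, b] by rewrite in_itv /= ac (le_trans cd').
    have V1 : (d - c) * V <= 2 * M * (itv_integral c d (fun t => `|phi t - g t|) + eta' * (d - c)).
      apply: (@le_trans _ _ (itv_integral c d (fun t => (phi t - k) ^+ 2))).
        rewrite e2 x1E x2E /V; have := sqr_ge0 (x.1 - k); move: dc0; clear; nra.
      rewrite -(itv_integral_cst _ cd') -itv_integralD // ?itv_integrable_cst //.
      have j3 := itv_integrableD i4 (itv_integrable_cst c d eta').
      rewrite -itv_integralZ //; apply: le_itv_integral => //.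
        exact: itv_integrableZ.
      move=> t tcd; have tab := sub t tcd.
      have := phiM t tab; rewrite ler_norml => /andP[p1 p2].
      have h1 : `|phi t - k| <= `|phi t - g t| + eta'.
        have h : `|g t - g c| <= eta'.
          apply: hrho => //; move: tcd; rewrite in_itv /= => /andP[ct td].
          by clear - ct td small; rewrite ger0_norm; lra.
        have := clamp_lip (phi t) (g c) MM; rewrite clamp_id // -/k.
        move/le_trans; apply; rewrite -(subrKA (g t)).
        by rewrite (le_trans (ler_normD _ _)) // lerD2l.
      have h2 : `|phi t - k| <= 2 * M by clear - k1 k2 p1 p2; rewrite ler_norml; apply/andP; split; lra.
      rewrite -[leLHS]real_normK ?num_real // expr2.
      by apply: ler_pM.
    have fle : itv_integral c d (f \o phi) <=
        (G x + eta + C * V) * (d - c) + C * ((d - c) * V).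
      have -> : (d - c) * V = itv_integral c d (fun t => (phi t - x.1) ^+ 2).
        by rewrite e1 x1E x2E /V; ring.
      rewrite -(itv_integral_cst _ cd') -(itv_integralZ C j1) -itv_integralD ?itv_integrable_cst //;
        last exact: itv_integrableZ.
      apply: le_itv_integral => //.
        by apply: itv_integrableD; [exact: itv_integrable_cst|exact: itv_integrableZ].
      move=> t tcd; have := hC x (phi t) xO x1M (phiM t (sub t tcd)).
      by rewrite /comp /V; clear; lra.
    have V2 : C * ((d - c) * V) <= C * (2 * M * (itv_integral c d (fun t => `|phi t - g t|) + eta' * (d - c))).
      exact: ler_wpM2l.
    by move: fle V2; move: (itv_integral c d (fun t => `|_|)) (itv_integral _ _ _) => N F; clear; lra.
  - move=> c d ac cd db.
    have inO' s t : c <= s -> s < t -> t <= d -> Omega del (avgpt P1 P2 s t).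
      move=> cs st td; have as_ := le_trans ac cs; have tb := le_trans td db.
      by rewrite ptE //; apply: inO.
    have [e [ce ed h1 h2 seg]] := bellman_split c1 c2 del0 dele cd inO'.
    exists e; split => //.
    have dc0 : 0 < d - c by rewrite subr_gt0.
    have [cG _ _] := LG.
    have ec0 : 0 <= (e - c) / (d - c) by rewrite divr_ge0 ?subr_ge0 // ltW.
    have de0 : 0 <= (d - e) / (d - c) by rewrite divr_ge0 ?subr_ge0 // ltW.
    have sum1 : (e - c) / (d - c) + (d - e) / (d - c) = 1.
      by rewrite -mulrDl addrC subrKA divff // gt_eqF.
    have Gs := cG _ _ seg _ _ ec0 de0 sum1; rewrite -avgpt_comb // in Gs.
    have {}Gs : (e - c) * G (avgpt P1 P2 c e) + (d - e) * G (avgpt P1 P2 e d)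
        <= (d - c) * G (avgpt P1 P2 c d).
      have := ler_wpM2l (ltW dc0) Gs; apply: le_trans; rewrite le_eqVlt; apply/orP; left.
      by apply/eqP; field; rewrite gt_eqF.
    have i3 := itv_integrable_sub ifphi ac db; have i4 := itv_integrable_sub ig ac db.
    rewrite /D (itv_integral_chasles i3 (ltW ce) (ltW ed)).
    rewrite (itv_integral_chasles i4 (ltW ce) (ltW ed)).
    by move: Gs; clear; lra.
have N1 : 4 * C * M * itv_integral a b (fun t => `|phi t - g t|) <= z / 3.
  apply: (le_trans (ler_wpM2l CM0 gN)).
  have -> : z / (3 * q) = (z / 3) / q by field; rewrite gt_eqF.
  rewrite mulrA ler_pdivrMr // mulrC ler_wpM2l ?divr_ge0 // ?ltW //.
  by rewrite /q ltrDl.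
have N2 : 4 * C * M * eta' * (b - a) <= z / 3.
  have -> : 4 * C * M * eta' * (b - a) = 4 * C * M * ((z / 3) / q).
    by rewrite /eta' /L; field; rewrite !gt_eqF.
  rewrite mulrA ler_pdivrMr // mulrC ler_wpM2l ?divr_ge0 // ?ltW //.
  by rewrite /q ltrDl.
have N3 : eta * (b - a) = z / 3 by rewrite /eta; field; rewrite gt_eqF.
move: DK; rewrite /D ptE //.
rewrite (mulrDl eta) N3; move: N1 N2.
move: (4 * C * M * itv_integral _ _ _) (4 * C * M * eta' * (b - a)) => n1 n2 ? ?.
lra.
Qed.

End BellmanInduction.

(** * Truncation and dominated convergence *)

Section GeneralFunctions.
Context {R : realType}.
Local Notation mu := (@lebesgue_measure R).
Implicit Types (a b c d s t M k : R) (phi f : R -> R).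

Lemma itv_integrable_measurable a b h : itv_integrable a b h ->
  measurable_fun `]a, b[ (h : R -> R).
Proof. by move=> /measurable_int/measurable_EFinP. Qed.

Lemma itv_integralE a b (h : R -> R) : itv_integrable a b h ->
  (\int[mu]_(t in `]a, b[) (h t)%:E)%E = (itv_integral a b h)%:E.
Proof.
by move=> hi; rewrite /itv_integral /Rintegral fineK //; exact: integrable_fin_num.
Qed.

Lemma itv_dominated_convergence a b (h_ : nat -> R -> R) (h g : R -> R) :
  (forall n, measurable_fun `]a, b[ (h_ n)) -> measurable_fun `]a, b[ h ->
  (forall t, t \in `]a, b[ -> h_ n t @[n --> \oo] --> h t) ->
  itv_integrable a b g ->
  (forall n t, t \in `]a, b[ -> `|h_ n t| <= g t) ->
  itv_integrable a b h /\ itv_integral a b (h_ n) @[n --> \oo] --> itv_integral a b h.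
Proof.
move=> mh_ mh hh ig hg.
have [||||||i1 _ i2] := @dominated_convergence _ _ _ mu `]a, b[%classic _
  (fun n t => (h_ n t)%:E) (EFin \o h) (EFin \o g).
- exact: measurable_itv.
- by move=> n; apply/measurable_EFinP; exact: mh_.
- exact/measurable_EFinP.
- by apply: aeW => t tab; apply: cvg_EFin; [exact: nearW|exact: hh].
- exact: ig.
- by apply: aeW => t n tab; rewrite /= lee_fin hg.
split; first exact: i1.
have i1' : itv_integrable a b h by [].
have ih_ n : itv_integrable a b (h_ n).
  apply: (le_integrable _ _ _ ig) => //; first by apply/measurable_EFinP; exact: mh_.
  by move=> t tab; rewrite /= lee_fin (le_trans (hg n t tab)) // ler_norm.
move: i2; rewrite (itv_integralE i1') => i2.
have : (itv_integral a b (h_ n))%:E @[n --> \oo] --> (itv_integral a b h)%:E.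
  by move: i2; under eq_fun do rewrite itv_integralE //.
by move/fine_cvg.
Qed.

(** Clamping is 1-Lipschitz, so it does not increase the mean square distance
    to a constant. *)
Lemma clamp_variance a b (lo hi al : R) phi c d eps : lo <= hi -> 0 <= al ->
  itv_integrable a b phi -> itv_integrable a b (fun t => phi t ^+ 2) ->
  a <= c -> c < d -> d <= b ->
  let m := itv_integral c d phi / (d - c) in
  itv_integral c d (fun t => (phi t - m) ^+ 2) <= eps ^+ 2 * (d - c) ->
  Omega (al * eps) (bellman_point (fun t => al * clamp lo hi (phi t)) c d).
Proof.
move=> lohi al0 i1 i2 ac cd db m osc.
have cd' := ltW cd; have dc0 : 0 < d - c by rewrite subr_gt0.
have {}i1 := itv_integrable_sub i1 ac db; have {}i2 := itv_integrable_sub i2 ac db.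
pose psi t := al * clamp lo hi (phi t).
have mpsi : measurable_fun `]c, d[ psi.
  apply: measurable_funM; first exact: measurable_cst.
  apply: measurable_minr; last exact: measurable_cst.
  by apply: measurable_maxr; [exact: measurable_cst|exact: itv_integrable_measurable].
have bpsi t : `|psi t| <= al * (`|lo| + `|hi|).
  rewrite /psi normrM (ger0_norm al0) ler_wpM2l //.
  have /andP[] := clamp_in (phi t) lohi; rewrite ler_norml.
  have := ler_norm hi; have := ler_norm (- lo); rewrite normrN.
  have := normr_ge0 lo; have := normr_ge0 hi => *; apply/andP; split; lra.
have j1 : itv_integrable c d psi by apply: itv_integrable_bounded => // t _; exact: bpsi.
have j2 : itv_integrable c d (fun t => psi t ^+ 2).
  apply: (@itv_integrable_bounded _ _ _ _ ((al * (`|lo| + `|hi|)) ^+ 2)).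
    exact: measurable_funX.
  by move=> t _; rewrite normrX ler_pXn2r ?nnegrE ?mulr_ge0 ?addr_ge0.
pose M := itv_integral c d psi / (d - c).
have [l1 e1] := itv_integral_sqr M cd' j1 j2.
have [l2 e2] := itv_integral_sqr (al * clamp lo hi m) cd' j1 j2.
have [l3 _] := itv_integral_sqr m cd' i1 i2.
have le1 : itv_integral c d (fun t => (psi t - al * clamp lo hi m) ^+ 2) <=
    al ^+ 2 * itv_integral c d (fun t => (phi t - m) ^+ 2).
  rewrite -itv_integralZ //; apply: le_itv_integral => //; first exact: itv_integrableZ.
  move=> t _; rewrite /psi -mulrBr exprMn ler_wpM2l ?sqr_ge0 //.
  rewrite -[leLHS]real_normK ?num_real // -[leRHS]real_normK ?num_real //.
  by rewrite ler_pXn2r ?nnegrE // clamp_lip.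
have ge0 : 0 <= itv_integral c d (fun t => (psi t - M) ^+ 2).
  by apply: Rintegral_ge0 => t _; exact: sqr_ge0.
have ME : itv_integral c d psi = M * (d - c) by rewrite /M divfK // gt_eqF.
set X2 := itv_integral c d (fun t => psi t ^+ 2) / (d - c).
have X2E : itv_integral c d (fun t => psi t ^+ 2) = X2 * (d - c) by rewrite /X2 divfK // gt_eqF.
rewrite ME X2E in e1 e2.
rewrite -[bellman_point _ _ _]/(M, X2) /Omega /=.
have al2 := ler_wpM2l (sqr_ge0 al) osc.
apply/andP; split.
  rewrite -(ler_pM2r dc0); move: ge0; rewrite e1; clear; lra.
rewrite -(ler_pM2r dc0).
have sq : 0 <= (M - al * clamp lo hi m) ^+ 2 * (d - c) by rewrite mulr_ge0 ?sqr_ge0 // ltW.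
move: (le_trans le1 al2); rewrite e2.
move: sq; set K := al * clamp lo hi m; rewrite (exprMn 2 al eps); clear; lra.
Qed.

(** The factor is less than 1: the truncated function has oscillation
    strictly below [eps], as [bounded_bellman] requires. *)
Definition trunc (n : nat) (v : R) : R := n.+1%:R / n.+2%:R * clamp (- n.+1%:R) n.+1%:R v.

Lemma trunc_factor n : 0 < n.+1%:R / n.+2%:R :> R /\ n.+1%:R / n.+2%:R < 1 :> R.
Proof.
split; first by rewrite divr_gt0.
by rewrite ltr_pdivrMr // mul1r ltr_nat.
Qed.

Lemma trunc_norm n v : `|trunc n v| <= `|v| /\ `|trunc n v| <= n.+1%:R.
Proof.
have [a0 a1] := trunc_factor n.
have MM : - n.+1%:R <= n.+1%:R :> R by have : 0 <= n.+1%:R :> R by []; lra.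
have h0 : `|clamp (- n.+1%:R) n.+1%:R v| <= `|v|.
  have := clamp_lip v 0 MM; rewrite (@clamp_id _ _ _ 0) ?subr0 ?oppr_le0 //.
have h1 : `|clamp (- n.+1%:R) n.+1%:R v| <= n.+1%:R.
  by rewrite ler_norml clamp_in.
rewrite /trunc normrM gtr0_norm //.
have := normr_ge0 (clamp (- n.+1%:R) n.+1%:R v).
by move: (_ / _) a0 a1 h0 h1 => r a0 a1; set X := `|clamp _ _ _| => *; split; nra.
Qed.

Lemma trunc_cvg v : trunc n v @[n --> \oo] --> v.
Proof.
rewrite -[X in _ --> X]mul1r.
apply: cvgM.
  have -> : (fun n => n.+1%:R / n.+2%:R : R) = (fun n => 1 - n.+2%:R^-1).
    apply/funext => n.
    by rewrite -[X in X / _](addrK 1) natr1 mulrBl divff ?pnatr_eq0 // mul1r.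
  rewrite -[X in _ --> X]subr0; apply: cvgB; first exact: cvg_cst.
  have := @cvg_harmonic R; rewrite -(cvg_shiftS _) => h; exact: h.
apply/cvgrPdist_le => e e0; have := archi_boundP (normr_ge0 v); set N := Num.bound _ => hN.
exists N => // n /= Nn; rewrite clamp_id ?subrr ?normr0 ?ltW //.
- have : (N%:R : R) <= n.+1%:R by rewrite ler_nat; exact: leq_trans (leqnSn _).
  have := ler_norm (- v); rewrite normrN; lra.
- have : (N%:R : R) <= n.+1%:R by rewrite ler_nat; exact: leq_trans (leqnSn _).
  have := ler_norm v; lra.
Qed.

End GeneralFunctions.

(** * Bellman induction for functions of bounded mean oscillation *)

Section BmoFunctions.
Context {R : realType}.
Local Notation mu := (@lebesgue_measure R).
Implicit Types (a b c d s t M k eps : R) (phi f : R -> R).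

(** On an interval with ends [a] and [b], the functions of BMO with finite
    second moment. *)
Definition bmo_itv eps a b phi := [/\ itv_integrable a b phi,
  itv_integrable a b (fun t => phi t ^+ 2) &
  forall c d, a <= c -> c < d -> d <= b ->
    itv_integral c d (fun t => (phi t - itv_integral c d phi / (d - c)) ^+ 2)
      <= eps ^+ 2 * (d - c)].

Lemma bmo_itv_point eps a b phi : a < b -> bmo_itv eps a b phi ->
  Omega eps (bellman_point phi a b).
Proof.
move=> ab [i1 i2 osc]; have ba0 : 0 < b - a by rewrite subr_gt0.
have ab' := ltW ab.
set x := bellman_point phi a b.
have e1 : itv_integral a b phi = x.1 * (b - a) by rewrite /x /= divfK // gt_eqF.
have e2 : itv_integral a b (fun t => phi t ^+ 2) = x.2 * (b - a).
  by rewrite /x /= divfK // gt_eqF.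
have := osc _ _ (lexx _) ab (lexx _); rewrite -/(bellman_point phi a b).1 -/x.
have [_ ->] := itv_integral_sqr x.1 ab' i1 i2; rewrite e1 e2 => up.
have low : 0 <= itv_integral a b (fun t => (phi t - x.1) ^+ 2).
  by apply: Rintegral_ge0 => t _; exact: sqr_ge0.
move: low; have [_ ->] := itv_integral_sqr x.1 ab' i1 i2; rewrite e1 e2 => low.
by apply/andP; split; rewrite -(ler_pM2r ba0); lra.
Qed.

Lemma bmo_itvN eps a b phi : bmo_itv eps a b phi -> bmo_itv eps a b (fun t => - phi t).
Proof.
have N (h : R -> R) : (fun t => - h t) = (fun t => (-1) * h t).
  by apply/funext => t; rewrite mulN1r.
move=> [i1 i2 osc]; split.
- by rewrite N; exact: itv_integrableZ.
- by under eq_fun do rewrite sqrrN.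
move=> c d ac cd db; have := osc c d ac cd db; apply: le_trans.
rewrite N itv_integralZ; last exact: itv_integrable_sub i1 ac db.
rewrite (_ : (fun t => _) = (fun t => (phi t - itv_integral c d phi / (d - c)) ^+ 2)) //.
by apply/funext => t; ring.
Qed.

Section Truncation.
Variables (eps a b : R) (phi : R -> R).
Hypotheses (eps0 : 0 < eps) (ab : a < b) (bphi : bmo_itv eps a b phi).

Let phi_ n t := trunc n (phi t).

Lemma trunc_measurable n : measurable_fun `]a, b[ (phi_ n).
Proof.
case: bphi => i1 _ _; apply: measurable_funM; first exact: measurable_cst.
apply: measurable_minr; last exact: measurable_cst.
by apply: measurable_maxr; [exact: measurable_cst|exact: itv_integrable_measurable].
Qed.

Lemma trunc_in n s t : a <= s -> s < t -> t <= b ->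
  Omega (n.+1%:R / n.+2%:R * eps) (bellman_point (phi_ n) s t).
Proof.
move=> as_ st tb; case: bphi => i1 i2 osc.
have [a0 a1] := @trunc_factor R n.
apply: (clamp_variance _ (ltW a0) i1 i2 as_ st tb (osc _ _ as_ st tb)).
have h : 0 <= n.+1%:R :> R by [].
lra.
Qed.

Lemma trunc_point_cvg :
  (bellman_point (phi_ n) a b).1 @[n --> \oo] --> (bellman_point phi a b).1 /\
  (bellman_point (phi_ n) a b).2 @[n --> \oo] --> (bellman_point phi a b).2.
Proof.
case: bphi => i1 i2 osc; split.
  apply: cvgM; last exact: cvg_cst.
  apply: (itv_dominated_convergence trunc_measurable
    (itv_integrable_measurable i1) _ (itv_integrable_norm i1) _).2.
    by move=> t _; exact: trunc_cvg.
  by move=> n t _; have [] := trunc_norm n (phi t).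
apply: cvgM; last exact: cvg_cst.
apply: (@itv_dominated_convergence _ a b (fun n t => phi_ n t ^+ 2) (fun t => phi t ^+ 2)
  (fun t => phi t ^+ 2) _ _ _ i2 _).2.
- by move=> n; apply: measurable_funX; exact: trunc_measurable.
- exact: itv_integrable_measurable.
- by move=> t _; apply: cvgM; exact: trunc_cvg.
- move=> n t _; rewrite normrX -[leRHS]real_normK ?num_real //.
  by rewrite ler_pXn2r ?nnegrE //; have [] := trunc_norm n (phi t).
Qed.

Lemma trunc_bellman n f G : continuous f -> Lambda eps f G ->
  itv_integral a b (f \o phi_ n) <= (b - a) * G (bellman_point (phi_ n) a b).
Proof.
move=> fc LG; have [a0 a1] := @trunc_factor R n.
apply: (@bounded_bellman _ a b n.+1%:R eps (n.+1%:R / n.+2%:R * eps)) => //.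
- exact: trunc_measurable.
- by move=> t _; have [] := trunc_norm n (phi t).
- by rewrite mulr_gt0.
- by rewrite gtr_pMl.
- exact: trunc_in.
Qed.

Lemma trunc_in_eps n : Omega eps (bellman_point (phi_ n) a b).
Proof.
have [a0 a1] := @trunc_factor R n.
have := trunc_in n (lexx a) ab (lexx b) => /andP[l h]; apply/andP; split => //.
apply: (le_trans h); rewrite lerD2l.
by rewrite ler_pXn2r ?nnegrE ?mulr_ge0 ?(ltW a0) ?(ltW eps0) // ger_pMl // ltW.
Qed.

Lemma trunc_value_cvg (G : R * R -> R) : {within Omega eps, continuous G} ->
  G (bellman_point (phi_ n) a b) @[n --> \oo] --> G (bellman_point phi a b).
Proof.
move=> Gc; apply/cvgrPdist_le => e e0.
have [d d0 hd] := (within_continuous_dist _ _).1 Gc _ _ (bmo_itv_point ab bphi) e0.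
have [/cvgrPdist_lt/(_ _ d0) h1 /cvgrPdist_lt/(_ _ d0) h2] := trunc_point_cvg.
near=> n; apply: hd; first exact: trunc_in_eps.
  by near: n.
by near: n.
Unshelve. all: by end_near. Qed.

Lemma expR_affine_cont k : continuous (fun t : R => expR (k * t)).
Proof.
move=> t; apply: (@continuous_comp _ _ _ (fun t => k * t) expR); last exact: continuous_expR.
by apply: cvgM; [exact: cvg_cst|exact: cvg_id].
Qed.

Lemma exp_Lambda k : 0 < k -> k * eps < 1 ->
  Lambda eps (fun t => expR (k * t)) (exp_major eps k).
Proof.
move=> k0 ke; split; first exact: exp_major_concave.
  by apply: continuous_subspaceT; exact: exp_major_continuous.
by move=> u; apply: exp_major_boundary => //; exact: ltW.
Qed.

(** The integral John-Nirenberg inequality.  Bellman induction with [exp_major]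
    bounds the integrals for the truncated functions, and Fatou applies. *)
Lemma bmo_exp_integrable k : 0 < k -> k * eps < 1 ->
  itv_integrable a b (fun t => expR (k * phi t)).
Proof.
move=> k0 ke; have LE := exp_Lambda k0 ke.
have ec := @expR_affine_cont k.
have ba0 : 0 < b - a by rewrite subr_gt0.
have mphi : measurable_fun `]a, b[ phi by case: bphi => /itv_integrable_measurable.
have me : measurable_fun `]a, b[ (fun t => expR (k * phi t)).
  apply: (@measurableT_comp _ _ _ _ _ _ (fun t => expR (k * t))) => //.
  exact: continuous_measurable_fun.
have men n : measurable_fun `]a, b[ (fun t => expR (k * phi_ n t)).
  apply: (@measurableT_comp _ _ _ _ _ _ (fun t => expR (k * t))).
    exact: continuous_measurable_fun.
  exact: trunc_measurable.
have ien n : itv_integrable a b (fun t => expR (k * phi_ n t)).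
  apply: (@itv_integrable_bounded _ _ _ _ (expR (k * n.+1%:R))) => // t _.
  rewrite ger0_norm ?expR_ge0 // ler_expR ler_pM2l //.
  by apply: le_trans (ler_norm _) _; have [] := trunc_norm n (phi t).
have [B hB] : exists B, forall n, itv_integral a b (fun t => expR (k * phi_ n t)) <= B.
  have Gc := @trunc_value_cvg (exp_major eps k) (let: And3 _ c _ := LE in c).
  have /cvg_seq_bounded/pinfty_ex_gt0[M _ /= hM] := cvgP _ Gc.
  exists ((b - a) * M) => n; apply: le_trans (trunc_bellman n ec LE) _.
  by rewrite ler_pM2l //; apply: le_trans (ler_norm _) _; exact: hM.
apply/integrableP; split; first exact/measurable_EFinP.
apply: (@le_lt_trans _ _ B%:E); last exact: ltry.
have := @fatou _ _ _ mu `]a, b[%classic (measurable_itv _)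
  (fun n t => (expR (k * phi_ n t))%:E).
have h1 n : measurable_fun `]a, b[ (fun t => (expR (k * phi_ n t))%:E).
  by apply/measurable_EFinP.
move=> /(_ h1) => /(_ (fun n t _ => expR_ge0 _)) F.
apply: (le_trans _ (le_trans F _)).
  rewrite le_eqVlt; apply/orP; left; apply/eqP; apply: eq_integral => t tab.
  have c : (expR (k * phi_ n t))%:E @[n --> \oo] --> (expR (k * phi t))%:E.
    apply: cvg_EFin; first exact: nearW.
    apply: (@cvg_comp _ _ _ (fun n => phi_ n t) (fun v => expR (k * v))); last exact: ec.
    exact: trunc_cvg.
  by have [-> _] := cvg_limn_einf_sup c; rewrite /= ger0_norm ?expR_ge0.
rewrite limn_einf_lim; apply: lime_le; first exact: is_cvg_einfs.
apply: nearW => n; apply: ge_ereal_inf.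
exists (\int[mu]_(t in `]a, b[) (expR (k * phi_ n t))%:E)%E; first by exists n; first exact: leqnn.
by rewrite (itv_integralE (ien n)) lee_fin.
Qed.

End Truncation.

Lemma bmo_bellman eps a b phi f G C k : 0 < eps -> a < b -> bmo_itv eps a b phi ->
  continuous f -> 0 < k -> k * eps < 1 -> 0 <= C ->
  (forall t, `|f t| <= C * (expR (k * t) + expR (- (k * t)))) ->
  Lambda eps f G ->
  itv_integrable a b (f \o phi) /\
  itv_integral a b (f \o phi) <= (b - a) * G (bellman_point phi a b).
Proof.
move=> eps0 ab bphi fc k0 ke C0 fC LG.
have i1 := bmo_exp_integrable eps0 ab bphi k0 ke.
have i2 := bmo_exp_integrable eps0 ab (bmo_itvN bphi) k0 ke.
have ig : itv_integrable a b (fun t => C * 2 * (expR (k * phi t) + expR (k * - phi t))).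
  by apply: itv_integrableZ; exact: itv_integrableD.
have [||||i3 lim] := @itv_dominated_convergence _ a b (fun n t => f (trunc n (phi t)))
  (f \o phi) _ _ _ _ ig _.
- move=> n; apply: (@measurableT_comp _ _ _ _ _ _ f).
    exact: continuous_measurable_fun.
  exact: (trunc_measurable bphi).
- apply: (@measurableT_comp _ _ _ _ _ _ f); first exact: continuous_measurable_fun.
  by case: bphi => /itv_integrable_measurable.
- move=> t _; apply: (@cvg_comp _ _ _ (fun n => trunc n (phi t)) f); last exact: fc.
  exact: trunc_cvg.
- move=> n t _; apply: le_trans (fC _) _; rewrite -mulrA ler_wpM2l // mulrN.
  set v := phi t; have [h _] := trunc_norm n v.
  have kh : - (k * `|v|) <= k * trunc n v <= k * `|v|.
    rewrite -ler_norml normrM (gtr0_norm k0) ler_pM2l //.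
  have e1 : expR (k * `|v|) <= expR (k * v) + expR (- (k * v)).
    have [v0|v0] := leP 0 v; first by rewrite (ger0_norm v0) lerDl expR_ge0.
    by rewrite (ltr0_norm v0) mulrN lerDr expR_ge0.
  move: kh => /andP[kh1 kh2].
  have e2 : expR (k * trunc n v) <= expR (k * `|v|) by rewrite ler_expR.
  have e3 : expR (- (k * trunc n v)) <= expR (k * `|v|) by rewrite ler_expR lerNl.
  lra.
split => //.
have [_ Gc _] := LG.
have lim2 := trunc_value_cvg eps0 ab bphi Gc.
have lim3 : (b - a) * G (bellman_point (fun t => trunc n (phi t)) a b) @[n --> \oo]
    --> (b - a) * G (bellman_point phi a b).
  by apply: cvgM; [exact: cvg_cst|exact: lim2].
apply: (ler_cvg_to lim lim3); apply: nearW => n.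
exact: (trunc_bellman eps0 ab bphi n fc LG).
Qed.

End BmoFunctions.

(** * Quantile functions of good laws *)

Section StepFunctions.
Context {R : realType}.
Local Notation mu := (@lebesgue_measure R).
Implicit Types (a b c d s t u v eps : R) (h : R -> R) (L : seq (R * R)).

Definition values L := undup [seq p.2 | p <- L].

Lemma wsum_values L h : wsum L h =
  \sum_(v <- values L) wsum L (fun u => (u == v)%:R) * h v.
Proof.
under [RHS]eq_bigr => v _ do rewrite /wsum big_distrl.
rewrite exchange_big /= /wsum; apply: eq_big_seq => p pL.
have pS : p.2 \in values L by rewrite mem_undup map_f.
rewrite (bigD1_seq p.2) ?undup_uniq //= eqxx mulr1 big1 ?addr0 // => v.
by rewrite eq_sym => /negbTE ->; rewrite mulr0 mul0r.
Qed.

Definition positive_weights L := forall p, p \in L -> 0 < p.1.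

Section Construction.
Variables (L : seq (R * R)) (a b : R).
Hypotheses (ab : a < b) (L0 : positive_weights L) (L1 : wsum L (fun=> 1) = 1).

Let L0' : nonneg_weights L.
Proof. by move=> p /L0/ltW. Qed.

Let left v := a + (b - a) * wsum L (fun u => (u < v)%R%:R).
Let right v := a + (b - a) * wsum L (fun u => (u <= v)%R%:R).

Lemma right_left v : right v - left v = (b - a) * wsum L (fun u => (u == v)%:R).
Proof.
rewrite /right /left opprD addrACA subrr add0r -mulrBr; congr (_ * _).
rewrite -mulN1r -wsumZ -wsumD; apply: wsum_ext => p _.
by case: (ltgtP p.2 v) => _ /=; ring.
Qed.

Lemma left_right_lt v : v \in values L -> left v < right v.
Proof.
move=> vS; rewrite -subr_gt0 right_left mulr_gt0 ?subr_gt0 //.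
move: vS; rewrite mem_undup => /mapP[p pL ->].
rewrite /wsum (big_rem p) //= eqxx mulr1 ltr_pwDl ?L0 //.
rewrite big_seq sumr_ge0 // => q /mem_rem qL.
by rewrite mulr_ge0 ?ler0n ?L0'.
Qed.

Lemma right_le_left u v : u < v -> right u <= left v.
Proof.
move=> uv; rewrite lerD2l ler_pM2l ?subr_gt0 //; apply: ler_wsum => // p _.
rewrite ler_nat; case: (leP p.2 u) => // pu; by rewrite (le_lt_trans pu uv).
Qed.

Lemma left_ge v : a <= left v.
Proof. by rewrite lerDl mulr_ge0 ?wsum_ge0 // subr_ge0 ltW. Qed.

Lemma right_le v : right v <= b.
Proof.
have : wsum L (fun u => (u <= v)%R%:R) <= wsum L (fun=> 1).
  by apply: ler_wsum => // p _; case: (p.2 <= v)%R; rewrite ?ler01 ?lexx.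
by rewrite -lerBrDl ger_pMr ?subr_gt0 // L1.
Qed.

Let ind v t : R := (left v <= t < right v)%R%:R.

(** The quantile function of [L], transported to the interval with ends [a] and
    [b]: the value [v] is taken on an interval of length proportional to its
    weight. *)
Definition step t : R := \sum_(v <- values L) v * ind v t.

(** The intervals with ends [left v] and [right v], for [v] in [values L],
    partition the interval with ends [a] and [b]: [v] is the least value with
    t < right v. *)
Lemma step_level t : a <= t -> t < b ->
  exists2 v, v \in values L & forall h, \sum_(u <- values L) h u * ind u t = h v.
Proof.
move=> at_ tb.
have S0 : values L != [::].
  apply/eqP => e; have := wsum_values L (fun=> 1); rewrite L1 e big_nil.
  by move/eqP; rewrite oner_eq0.
have [w wS wmax] := seq_max S0.
have rw : right w = b.
  have e : wsum L (fun u => (u <= w)%R%:R) = wsum L (fun=> 1).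
    by apply: wsum_ext => p pL; rewrite wmax // mem_undup map_f.
  by rewrite /right e L1 mulr1 addrC subrK.
have [v' ] : exists2 v, v \in [seq - u | u <- values L & t < right u] &
    forall u, u \in [seq - u | u <- values L & t < right u] -> u <= v.
  apply: seq_max; apply/eqP => e.
  have : - w \in [seq - u | u <- values L & t < right u].
    by rewrite map_f // mem_filter wS rw tb.
  by rewrite e.
case/mapP => v; rewrite mem_filter => /andP[tv vS] -> {v'} vmin.
have {}vmin u : u \in values L -> t < right u -> v <= u.
  move=> uS tu; rewrite -lerN2; apply: vmin; rewrite map_f // mem_filter uS tu //.
have lv : left v <= t.
  have [/eqP e|e] := eqVneq [seq u <- values L | u < v] [::].
    have -> : left v = a; last by [].
      rewrite /left (_ : wsum _ _ = 0) ?mulr0 ?addr0 //.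
      rewrite /wsum big_seq big1 // => p pL.
      have pS : p.2 \in values L by rewrite mem_undup map_f.
      move: e; rewrite -[_ == _]negbK -has_filter => /hasPn/(_ _ pS)/negbTE ->.
      by rewrite mulr0.
  have [u] := seq_max e; rewrite mem_filter => /andP[uv uS] umax.
  have <- : right u = left v.
    congr (_ + _ * _); apply: wsum_ext => p pL; congr (_%:R).
    have pS : p.2 \in values L by rewrite mem_undup map_f.
    have [pv|pv] := ltP p.2 v.
      by rewrite umax // mem_filter pv pS.
    by rewrite leNgt (lt_le_trans uv pv).
  by rewrite leNgt; apply/negP => /(vmin _ uS); rewrite leNgt uv.
exists v => // h; rewrite (bigD1_seq v) ?undup_uniq //= {1}/ind lv tv mulr1.
rewrite big1_seq ?addr0 // => u /andP[uv uS]; rewrite /ind.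
have [uv'|vu|e] := ltgtP u v; last by rewrite e eqxx in uv.
- rewrite [X in _ && X]ltNge (le_trans (right_le_left uv') lv) andbF mulr0 //.
- by rewrite leNgt (lt_le_trans tv (right_le_left vu)) mulr0.
Qed.

Lemma step_comp h t : a <= t -> t < b -> h (step t) = \sum_(v <- values L) h v * ind v t.
Proof.
by move=> at_ tb; have [v _ hv] := step_level at_ tb; rewrite /step (hv id) hv.
Qed.

Lemma ind_measurable v : measurable_fun setT (ind v).
Proof.
rewrite (_ : ind v = \1_(`[left v, right v[%classic)); last first.
  by apply/funext => t; rewrite indicE mem_setE /ind in_itv.
exact: measurable_indic.
Qed.

Lemma sum_ind_measurable h : measurable_fun setT (fun t => \sum_(v <- values L) h v * ind v t).
Proof.
apply: measurable_sum => v; apply: measurable_funM; first exact: measurable_cst.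
exact: ind_measurable.
Qed.

Lemma sum_ind_bounded h t : `|\sum_(v <- values L) h v * ind v t| <= \sum_(v <- values L) `|h v|.
Proof.
apply: (le_trans (ler_norm_sum _ _ _)); apply: ler_sum => v _.
rewrite normrM ler_piMr // /ind; case: (_ && _); rewrite ?normr1 ?normr0 //.
Qed.

Lemma sum_ind_integrable h c d :
  itv_integrable c d (fun t => \sum_(v <- values L) h v * ind v t).
Proof.
apply: itv_integrable_bounded; last by move=> t _; exact: sum_ind_bounded.
by apply: measurable_funTS; exact: sum_ind_measurable.
Qed.

Lemma ind_integrable v c d : itv_integrable c d (ind v).
Proof.
apply: (@itv_integrable_bounded _ _ _ _ 1).
  by apply: measurable_funTS; exact: ind_measurable.
by move=> t _; rewrite /ind; case: (_ && _); rewrite ?normr1 ?normr0.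
Qed.

Lemma itv_integral_eq c d (h g : R -> R) : (forall t, t \in `]c, d[ -> h t = g t) ->
  itv_integral c d h = itv_integral c d g.
Proof. by move=> e; apply: eq_Rintegral => t; rewrite inE; exact: e. Qed.

Let overlap c d v := clamp c d (right v) - clamp c d (left v).

Lemma ind_integral v c d : c < d -> left v <= right v ->
  itv_integral c d (ind v) = overlap c d v.
Proof.
move=> cd lr; have cd' := ltW cd.
have /andP[l1 l2] := clamp_in (left v) cd'; have /andP[r1 r2] := clamp_in (right v) cd'.
have lr' := clamp_mono c d lr.
rewrite (itv_integral_chasles (ind_integrable v c d) l1 l2).
rewrite (itv_integral_chasles (ind_integrable v _ d) lr' r2).
have -> : itv_integral c (clamp c d (left v)) (ind v) = 0.
  rewrite (@itv_integral_eq _ _ _ (fun=> 0)) ?itv_integral_cst ?mul0r // => t.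
  rewrite in_itv /= => /andP[ct tl]; rewrite /ind leNgt.
  suff -> : t < left v by [].
  move: tl; rewrite /clamp lt_min lt_max => /andP[/orP[tc|//] _].
  by rewrite ltNge (ltW tc) in ct.
have -> : itv_integral (clamp c d (right v)) d (ind v) = 0.
  rewrite (@itv_integral_eq _ _ _ (fun=> 0)) ?itv_integral_cst ?mul0r // => t.
  rewrite in_itv /= => /andP[rt td]; rewrite /ind [X in _ && X]ltNge.
  suff -> : right v <= t by rewrite andbF.
  move: rt; rewrite /clamp gt_min gt_max => /orP[/andP[_ /ltW //]|dt].
  by rewrite ltNge (ltW dt) in td.
rewrite (@itv_integral_eq _ _ _ (fun=> 1)) ?itv_integral_cst //; last first.
  move=> t; rewrite in_itv /= => /andP[lt tr]; rewrite /ind.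
  have -> : left v <= t.
    move: lt; rewrite /clamp gt_min gt_max => /orP[/andP[_ /ltW //]|dt].
    by have := lt_le_trans (lt_trans dt tr) r2; rewrite ltxx.
  suff -> : t < right v by [].
  move: tr; rewrite /clamp lt_min lt_max => /andP[/orP[tc|//] _].
  by have := le_lt_trans l1 (lt_trans lt tc); rewrite ltxx.
by rewrite mul1r addr0 add0r.
Qed.

(** The part of the interval of level [v] that lies between [c] and [d], as a
    proportion of that interval. *)
Definition step_cut c d v := overlap c d v / (right v - left v).

Lemma step_integral h c d : a <= c -> c < d -> d <= b ->
  itv_integral c d (h \o step) = (b - a) * wsum L (fun v => step_cut c d v * h v).
Proof.
move=> ac cd db.
rewrite (@itv_integral_eq _ _ _ (fun t => \sum_(v <- values L) h v * ind v t)); last first.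
  move=> t; rewrite in_itv /= => /andP[ct td]; apply: step_comp.
    exact: le_trans ac (ltW ct).
  exact: lt_le_trans td db.
have -> : itv_integral c d (fun t => \sum_(v <- values L) h v * ind v t) =
    \sum_(v <- values L) h v * itv_integral c d (ind v).
  elim: (values L) => [|v S IH].
    rewrite big_nil (@itv_integral_eq _ _ _ (fun=> 0)) ?itv_integral_cst ?mul0r ?ltW // => t _.
    by rewrite big_nil.
  rewrite big_cons -IH -itv_integralZ; last exact: ind_integrable.
  rewrite -itv_integralD; first by apply: itv_integral_eq => t _; rewrite big_cons.
    by apply: itv_integrableZ; exact: ind_integrable.
  elim: (S) => [|w S' IH'].
    rewrite (_ : (fun t => _) = (fun=> 0)); first exact: itv_integrable_cst.
    by apply/funext => t; rewrite big_nil.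
  rewrite (_ : (fun t => _) = (fun t => h w * ind w t + \sum_(u <- S') h u * ind u t)).
    by apply: itv_integrableD => //; apply: itv_integrableZ; exact: ind_integrable.
  by apply/funext => t; rewrite big_cons.
rewrite wsum_values big_distrr; apply: eq_big_seq => v vS /=.
have lr := left_right_lt vS.
rewrite (ind_integral cd (ltW lr)) /step_cut right_left.
have W0 : (b - a) * wsum L (fun u => (u == v)%:R) != 0.
  by rewrite -right_left subr_eq0 gt_eqF.
move: W0; rewrite mulf_eq0 negb_or => /andP[W1 W2].
by field; rewrite W1 W2.
Qed.

Lemma step_cut_interval c d : c < d -> interval_cut [seq p.2 | p <- L] (step_cut c d).
Proof.
move=> cd; have cd' := ltW cd.
have lrle v : left v <= right v.
  rewrite lerD2l ler_pM2l ?subr_gt0 //; apply: ler_wsum => // p _.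
  by rewrite ler_nat; case: (ltgtP p.2 v).
split=> [v|u v w].
  have := lrle v; rewrite /step_cut /overlap le_eqVlt => /predU1P[->|lr].
    by rewrite !subrr mul0r lexx ler01.
  have lr' := clamp_mono c d (ltW lr).
  rewrite divr_ge0 ?subr_ge0 ?(ltW lr) //= ler_pdivrMr ?subr_gt0 // mul1r.
  have := clamp_lip (right v) (left v) cd'.
  by rewrite !ger0_norm ?subr_ge0 // ltW.
rewrite -!(mem_undup [seq p.2 | p <- L]) -/(values L) => uS vS wS uv vw.
have lru := left_right_lt uS; have lrv := left_right_lt vS; have lrw := left_right_lt wS.
rewrite /step_cut !pmulr_lgt0 ?invr_gt0 ?subr_gt0 // => ku kw.
have cu : c < right u.
  rewrite ltNge; apply/negP => h; move: ku; rewrite /clamp.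
  by rewrite (max_l h) (max_l (le_trans (ltW lru) h)) ltxx.
have wd : left w < d.
  rewrite ltNge; apply/negP => h; move: kw; rewrite /clamp.
  have h' : d <= right w := le_trans h (ltW lrw).
  by rewrite !min_r ?ltxx // le_max ?h ?h' orbT.
have h1 := right_le_left uv; have h2 := right_le_left vw.
rewrite /overlap !clamp_id ?divff ?subr_eq0 ?gt_eqF //; lra.
Qed.

Lemma step_integrable h c d : a <= c -> d <= b -> itv_integrable c d (h \o step).
Proof.
move=> ac db; have := sum_ind_integrable h c d; rewrite /itv_integrable.
apply: eq_integrable => // t.
rewrite inE /= in_itv /= => /andP[ct td]; congr EFin; apply/esym/step_comp.
  exact: le_trans ac (ltW ct).
exact: lt_le_trans td db.
Qed.

Lemma good_law_step eps : good eps L ->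
  [/\ measurable_fun setT step,
      exists M, forall t, `|step t| <= M,
      bmo_itv eps a b step &
      forall h, itv_integral a b (h \o step) = (b - a) * wsum L h].
Proof.
move=> gL; split.
- exact: sum_ind_measurable.
- by exists (\sum_(v <- values L) `|v|) => t; exact: sum_ind_bounded.
- split; [exact: (@step_integrable id)|exact: (@step_integrable (fun v => v ^+ 2))|].
  move=> c d ac cd db; have dc0 : 0 < d - c by rewrite subr_gt0.
  have i1 := @step_integrable id _ _ ac db.
  have i2 := @step_integrable (fun v => v ^+ 2) _ _ ac db.
  have [_ ->] := itv_integral_sqr (itv_integral c d step / (d - c)) (ltW cd) i1 i2.
  have e0 := step_integral (fun=> 1) ac cd db.
  have e1 := step_integral id ac cd db.
  have e2 := step_integral (fun v => v ^+ 2) ac cd db.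
  rewrite -[itv_integral c d (id \o step)]/(itv_integral c d step) in e1.
  rewrite -[itv_integral c d (_ \o step)]/(itv_integral c d (fun t => step t ^+ 2)) in e2.
  rewrite -[itv_integral c d (_ \o step)]/(itv_integral c d (fun t => 1)) in e0.
  have := gL _ (step_cut_interval cd); rewrite /cut_small /small_variance.
  rewrite itv_integral_cst ?(ltW cd) // mul1r in e0.
  have e0' : wsum L (fun v => step_cut c d v * 1) = wsum L (step_cut c d).
    by apply: wsum_ext => p _; rewrite mulr1.
  rewrite e0' in e0; rewrite e1 e2.
  move: e0 dc0; move: (wsum L (step_cut c d)) (wsum L (fun v => step_cut c d v * v))
    (wsum L (fun v => step_cut c d v * v ^+ 2)) => m0 m1 m2 e0.
  rewrite e0 => dc0 sv.
  have ba0 : 0 < b - a by rewrite subr_gt0.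
  have m00 : 0 < m0 by move: dc0; rewrite pmulr_rgt0.
  rewrite -(ler_pM2r m00).
  have -> : ((b - a) * m2 - 2 * ((b - a) * m1 / ((b - a) * m0)) * ((b - a) * m1) +
    ((b - a) * m1 / ((b - a) * m0)) ^+ 2 * ((b - a) * m0)) * m0 = (b - a) * (m0 * m2 - m1 ^+ 2).
    by field; rewrite (gt_eqF m00) (gt_eqF ba0).
  have -> : eps ^+ 2 * ((b - a) * m0) * m0 = (b - a) * (eps ^+ 2 * m0 ^+ 2) by ring.
  by rewrite ler_pM2l.
- move=> h; rewrite (step_integral h (lexx _) ab (lexx _)); congr (_ * _).
  apply: wsum_ext => p pL.
  have pS : p.2 \in values L by rewrite mem_undup map_f.
  have lr := left_right_lt pS; have l := left_ge p.2; have r := right_le p.2.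
  rewrite /step_cut /overlap !clamp_id ?divff ?mul1r ?subr_eq0 ?gt_eqF //; lra.
Qed.

End Construction.

End StepFunctions.

(** * Averages over bounded intervals with arbitrary ends *)

Section Interface.
Context {R : realType}.
Local Notation mu := (@lebesgue_measure R).
Implicit Types (a b c d s t u v eps : R) (h phi : R -> R) (I J : interval R).

Lemma bounded_intervalE J : bounded_interval J ->
  exists a b (l r : bool), a < b /\ J = Interval (BSide l a) (BSide r b).
Proof.
rewrite /bounded_interval; case: J => [[l a|[]] [r b|[]]] /andP[]; rewrite lebesgue_measure_itv //=.
case: ifP => [|_]; last by rewrite ltxx.
by rewrite lte_fin => ab _ _; exists a, b, l, r.
all: by rewrite ?ltry ?ltNyr ?addye ?addey ?ltxx.
Qed.

Lemma itv_measure_sides (l r : bool) a b : a < b ->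
  mu [set` Interval (BSide l a) (BSide r b)] = (b - a)%:E.
Proof. by move=> ab; rewrite lebesgue_measure_itv /= lte_fin ab -EFinB. Qed.

Lemma bounded_interval_sides (l r : bool) a b : a < b ->
  bounded_interval (Interval (BSide l a) (BSide r b)).
Proof.
by move=> ab; rewrite /bounded_interval itv_measure_sides // lte_fin subr_gt0 ab ltry.
Qed.

Lemma avgE (l r : bool) a b h : a < b -> measurable_fun `]a, b[ h ->
  avg (Interval (BSide l a) (BSide r b)) h =
  ((b - a)^-1%:E * \int[mu]_(t in `]a, b[) (h t)%:E)%E.
Proof.
move=> ab mh; rewrite /avg itv_measure_sides //=; congr (_ * _)%E.
by rewrite integral_itv_bndoo //; apply/measurable_EFinP.
Qed.

Lemma avg_itv_integral (l r : bool) a b h : a < b -> itv_integrable a b h ->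
  avg (Interval (BSide l a) (BSide r b)) h = (itv_integral a b h / (b - a))%:E.
Proof.
move=> ab ih; rewrite avgE //; last exact: itv_integrable_measurable.
by rewrite itv_integralE // -EFinM mulrC.
Qed.

Lemma itv_sub_open (l r : bool) a b c d : a <= c -> d <= b ->
  `]c, d[%classic `<=` [set` Interval (BSide l a) (BSide r b)].
Proof.
by move=> ac db; apply: subset_itv; rewrite bnd_simp //; case: l r => [] [].
Qed.

Lemma itv_sub_ends (l r l' r' : bool) a b c d : c < d ->
  [set` Interval (BSide l' c) (BSide r' d)] `<=` [set` Interval (BSide l a) (BSide r b)] ->
  a <= c /\ d <= b.
Proof.
move=> cd sub.
have inJ m : c < m -> m < d -> a <= m <= b.
  move=> cm md.
  have /sub : [set` Interval (BSide l' c) (BSide r' d)] m.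
    by rewrite /= itv_boundlr; apply/andP; split; [case: (l')|case: (r')]; rewrite bnd_simp // ltW.
  rewrite /= itv_boundlr => /andP[h1 h2]; apply/andP; split.
    by move: h1; case: (l); rewrite bnd_simp // => /ltW.
  by move: h2; case: (r); rewrite bnd_simp // => /ltW.
split; rewrite leNgt; apply/negP => h.
  have cm : c < Num.min a d by rewrite lt_min h.
  have ma : Num.min a d <= a by rewrite ge_min lexx.
  have md : Num.min a d <= d by rewrite ge_min lexx orbT.
  have := inJ ((c + Num.min a d) / 2); move: (Num.min a d) cm ma md => m cm ma md.
  have -> : c < (c + m) / 2 by lra.
  have -> : (c + m) / 2 < d by lra.
  by move=> /(_ isT isT) /andP[? _]; lra.
have cm : Num.max b c < d by rewrite gt_max h.
have ma : b <= Num.max b c by rewrite le_max lexx.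
have md : c <= Num.max b c by rewrite le_max lexx orbT.
have := inJ ((d + Num.max b c) / 2); move: (Num.max b c) cm ma md => m cm ma md.
have -> : c < (d + m) / 2 by lra.
have -> : (d + m) / 2 < d by lra.
by move=> /(_ isT isT) /andP[_ ?]; lra.
Qed.

Lemma BMO_bmo_itv eps (l r : bool) a b phi (x2 : R) : a < b ->
  BMO eps (Interval (BSide l a) (BSide r b)) phi ->
  avg (Interval (BSide l a) (BSide r b)) (fun t => phi t ^+ 2) = x2%:E ->
  bmo_itv eps a b phi.
Proof.
set I := Interval _ _; move=> ab [iphi osc] e2.
have ba0 : 0 < b - a by rewrite subr_gt0.
have i1 : itv_integrable a b phi.
  by apply: integrableS iphi => //; exact: itv_sub_open.
have m1 := itv_integrable_measurable i1.
have m2 : measurable_fun `]a, b[ (fun t => phi t ^+ 2) by exact: measurable_funX.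
have i2 : itv_integrable a b (fun t => phi t ^+ 2).
  apply/integrableP; split; first by apply/measurable_EFinP; exact: m2.
  move: e2; rewrite avgE // => e2.
  apply: (@le_lt_trans _ _ (\int[mu]_(t in `]a, b[) (phi t ^+ 2)%:E)%E).
    rewrite le_eqVlt; apply/orP; left; apply/eqP; apply: eq_integral => t _ /=.
    by rewrite ger0_norm ?sqr_ge0.
  rewrite ltey; apply/eqP => iy; move: e2; rewrite iy.
  by rewrite mulry gtr0_sg ?invr_gt0 // mul1e.
split => // c d ac cd db.
have dc0 : 0 < d - c by rewrite subr_gt0.
have j1 := itv_integrable_sub i1 ac db; have j2 := itv_integrable_sub i2 ac db.
have [j3 _] := itv_integral_sqr (itv_integral c d phi / (d - c)) (ltW cd) j1 j2.
have : (mean_oscillation2 `]c, d[ phi <= (eps ^+ 2)%:E)%E.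
  apply: le_trans osc; apply: ereal_sup_ubound; exists `]c, d[ => //; split.
    exact: bounded_interval_sides.
  exact: itv_sub_open.
rewrite /mean_oscillation2 (avg_itv_integral false true cd j1) /=.
have -> : (fun t => `|phi t - itv_integral c d phi / (d - c)| ^+ 2) =
   (fun t => (phi t - itv_integral c d phi / (d - c)) ^+ 2).
  by apply/funext => t; rewrite real_normK ?num_real.
by rewrite (avg_itv_integral false true cd j3) lee_fin ler_pdivrMr.
Qed.

Lemma bmo_itv_BMO eps (l r : bool) a b phi : a < b ->
  measurable_fun setT phi -> (exists M, forall t, `|phi t| <= M) ->
  bmo_itv eps a b phi -> BMO eps (Interval (BSide l a) (BSide r b)) phi.
Proof.
move=> ab mphi [M hM] [i1 i2 osc]; split.
  apply: measurable_bounded_integrable => //.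
  - by rewrite [X in (X < _)%E]itv_measure_sides // ltry.
  - exact: measurable_funTS.
  - by exists M; split; [rewrite num_real|move=> x /ltW Mx t _; exact: le_trans (hM t) Mx].
apply: ge_ereal_sup => _ [J [bJ JI] <-].
have [c [d [l' [r' [cd JE]]]]] := bounded_intervalE bJ.
rewrite JE in JI *; have [ac db] := itv_sub_ends cd JI.
have dc0 : 0 < d - c by rewrite subr_gt0.
have j1 := itv_integrable_sub i1 ac db; have j2 := itv_integrable_sub i2 ac db.
have [j3 _] := itv_integral_sqr (itv_integral c d phi / (d - c)) (ltW cd) j1 j2.
rewrite /mean_oscillation2 (avg_itv_integral _ _ cd j1) /=.
have -> : (fun t => `|phi t - itv_integral c d phi / (d - c)| ^+ 2) =
   (fun t => (phi t - itv_integral c d phi / (d - c)) ^+ 2).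
  by apply/funext => t; rewrite real_normK ?num_real.
by rewrite (avg_itv_integral _ _ cd j3) lee_fin ler_pdivrMr // osc.
Qed.

End Interface.

(** * Growth of functions integrable with an exponential weight *)

Section Growth.
Context {R : realType}.
Local Notation mu := (@lebesgue_measure R).
Implicit Types (f : R -> R).

Lemma derivable_continuous f : (forall t, derivable f t 1) -> continuous f.
Proof. by move=> d t; apply/differentiable_continuous/derivable1_diffP. Qed.

(** Where the weight is the exponential t |-> expR (sg * t), the derivative of
    its product with [f] is the weight times f' + sg f. *)
Lemma weighted_increment f (sg x y eps0 : R) : C2 f ->
  weighted_integrable eps0 f -> weighted_integrable eps0 (derive1 f) -> x < y ->
  (forall t, x <= t <= y -> expR (sg * t) = weight eps0 t) ->
  `|expR (sg * y) * f y - expR (sg * x) * f x| <=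
    \int[mu]_t (`|derive1 f t * weight eps0 t| + `|sg| * `|f t * weight eps0 t|).
Proof.
move=> [d1 d2 _] wf wf' xy we.
have fc := derivable_continuous d1; have f'c := derivable_continuous d2.
have ec : continuous (fun t : R => expR (sg * t)) by exact: expR_affine_cont.
pose F t := expR (sg * t) * f t.
pose h t := expR (sg * t) * (derive1 f t + sg * f t).
have FD (t : R) : is_derive t 1 F (h t).
  have df : is_derive t 1 f (derive1 f t) by rewrite derive1E; apply/derivableP.
  apply: is_derive_eq; rewrite /GRing.scale /= /h.
  change (expR (sg * t) * derive1 f t + f t * (expR (sg * t) * (sg * 1)) =
    expR (sg * t) * (derive1 f t + sg * f t) :> R).
  by ring.
have Fc : continuous F by move=> t; apply: cvgM; [exact: ec|exact: fc].
have hc : continuous h.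
  move=> t; apply: cvgM; first exact: ec.
  by apply: cvgD; [exact: f'c|apply: cvgM; [exact: cvg_cst|exact: fc]].
have := @continuous_FTC2 R h F x y xy (continuous_subspaceT hc).
have LR : derivable_oo_LRcontinuous F x y.
  split.
  - by move=> t _; case: (FD t).
  - by apply: cvg_at_right_filter; exact: Fc.
  - by apply: cvg_at_left_filter; exact: Fc.
move=> /(_ LR) FTC.
have {}FTC : (\int[mu]_(t in `[x, y]) (h t)%:E)%E = ((F y)%:E - (F x)%:E)%E.
  by apply: FTC => t _; rewrite derive1E; case: (FD t).
have ih : mu.-integrable `[x, y] (EFin \o h).
  apply: continuous_compact_integrable; first exact: segment_compact.
  exact: continuous_subspaceT.
pose H t := `|derive1 f t * weight eps0 t| + `|sg| * `|f t * weight eps0 t|.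
have iH : mu.-integrable setT (EFin \o H).
  apply: (@integrableD _ _ _ mu setT measurableT
    (fun t => (`|derive1 f t * weight eps0 t|%R)%:E)
    (fun t => (`|sg| * `|f t * weight eps0 t|)%:E)).
    exact: (@integrable_norm _ _ _ mu setT (fun t => derive1 f t * weight eps0 t)).
  apply: (@integrableZl _ _ _ mu setT measurableT `|sg|
    (fun t => (`|f t * weight eps0 t|%R)%:E)).
  exact: (@integrable_norm _ _ _ mu setT (fun t => f t * weight eps0 t)).
have iHxy : mu.-integrable `[x, y] (EFin \o H) by apply: integrableS iH.
have -> : F y - F x = \int[mu]_(t in `[x, y]) h t by rewrite /Rintegral FTC.
apply: le_trans (le_normr_Rintegral _ ih) _ => //.
apply: (@le_trans _ _ (\int[mu]_(t in `[x, y]) H t)).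
  apply: le_Rintegral => //; first exact: integrable_norm.
  move=> t /=; rewrite in_itv /= => /we; rewrite /h /H => ->.
  rewrite mulrDr (le_trans (ler_normD _ _)) // lerD //.
    by rewrite mulrC.
  by rewrite -normrM [X in `|X| <= _]mulrCA (mulrC (weight _ _)).
rewrite /Rintegral fine_le //.
- exact: integrable_fin_num.
- exact: integrable_fin_num.
- apply: ge0_subset_integral => //.
    by case/integrableP : iH.
  by move=> t _; rewrite lee_fin addr_ge0 // mulr_ge0.
Qed.

(** The product of [f] with the weight has an integrable derivative on each half
    line, so it is bounded. *)
Lemma growth_bound f (eps0 : R) : 0 < eps0 -> C2 f ->
  weighted_integrable eps0 f -> weighted_integrable eps0 (derive1 f) ->
  exists2 C : R, 0 <= C & forall t, `|f t| <= C * expR (`|t| / eps0).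
Proof.
move=> e0 fC2 wf wf'.
pose K := \int[mu]_t (`|derive1 f t * weight eps0 t| + eps0^-1 * `|f t * weight eps0 t|).
have K0 : 0 <= K.
  by apply: Rintegral_ge0 => t _; rewrite addr_ge0 // mulr_ge0 // invr_ge0 ltW.
exists (`|f 0| + K); first by rewrite addr_ge0.
move=> t.
suff : `|f t| * weight eps0 t <= `|f 0| + K.
  have w0 : 0 < weight eps0 t by exact: expR_gt0.
  by rewrite -ler_pdivlMr // /weight mulNr expRN invrK.
have [t0|t0|->] := ltgtP t 0; last first.
- by rewrite /weight normr0 oppr0 mul0r expR0 mulr1 lerDl.
- have := @weighted_increment f (- eps0^-1) 0 t eps0 fC2 wf wf' t0.
  rewrite normrN (gtr0_norm (_ : 0 < eps0^-1)) ?invr_gt0 // -/K.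
  have we s : 0 <= s <= t -> expR (- eps0^-1 * s) = weight eps0 s.
    by move=> /andP[s0 _]; rewrite /weight ger0_norm // mulrC mulrN mulNr.
  move=> /(_ we); rewrite we ?lexx ?(ltW t0) // mulr0 expR0 mul1r => h.
  have w0 : 0 < weight eps0 t by exact: expR_gt0.
  rewrite -{1}(gtr0_norm w0) -normrM mulrC -(subrK (f 0) (_ * _)).
  by rewrite (le_trans (ler_normD _ _)) // addrC lerD2l.
- have := @weighted_increment f (eps0^-1) t 0 eps0 fC2 wf wf' t0.
  rewrite (gtr0_norm (_ : 0 < eps0^-1)) ?invr_gt0 // -/K.
  have we s : t <= s <= 0 -> expR (eps0^-1 * s) = weight eps0 s.
    by move=> /andP[_ s0]; rewrite /weight ler0_norm // opprK mulrC.
  move=> /(_ we); rewrite (we t) ?lexx ?(ltW t0) // mulr0 expR0 mul1r distrC => h.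
  have w0 : 0 < weight eps0 t by exact: expR_gt0.
  rewrite -{1}(gtr0_norm w0) -normrM mulrC -(subrK (f 0) (_ * _)).
  by rewrite (le_trans (ler_normD _ _)) // addrC lerD2l.
Qed.

End Growth.

(** * The envelope of good laws *)

Section MinimalConcave.
Context {R : realType}.
Implicit Types (L : seq (R * R)) (x y : R * R).

Definition law_at eps x L := [/\ positive_weights L, good eps L,
  wsum L (fun=> 1) = 1, wsum L id = x.1 & wsum L (fun v => v ^+ 2) = x.2].

Lemma positive_nonneg L : positive_weights L -> nonneg_weights L.
Proof. by move=> L0 p /L0/ltW. Qed.

Lemma law_at_point (eps u : R) : law_at eps (u, u ^+ 2) [:: (1, u)].
Proof.
split; rewrite /wsum ?big_seq1 /= ?mulr1 ?mul1r //; last exact: good_point.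
by move=> p; rewrite inE => /eqP ->; exact: ltr01.
Qed.

(** The variance vanishes, so all the mass is at [u]. *)
Lemma law_at_boundary (eps u : R) L (f : R -> R) : law_at eps (u, u ^+ 2) L ->
  wsum L f = f u.
Proof.
move=> [L0 _ w1 m1 m2].
have z : wsum L (fun v => (v - u) ^+ 2) = 0.
  rewrite (@wsum_ext _ L _ (fun v => v ^+ 2 + ((- (2 * u)) * v + u ^+ 2 * 1))); last first.
    by move=> p _; ring.
  rewrite (@wsumD _ L (fun v => v ^+ 2)) (@wsumD _ L (fun v => _ * v)).
  by rewrite (@wsumZ _ L _ id) (@wsumZ _ L _ (fun=> 1)) w1 m1 m2 /=; ring.
have pu p : p \in L -> p.2 = u.
  move=> pL; move: z => /eqP; rewrite /wsum big_seq psumr_eq0; last first.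
    by move=> q qL; rewrite mulr_ge0 ?sqr_ge0 // ltW ?L0.
  move=> /allP/(_ p pL); rewrite pL /= mulf_eq0 gt_eqF ?L0 //= sqrf_eq0 subr_eq0.
  by move/eqP.
rewrite (@wsum_ext _ L f (fun=> f u * 1)); last by move=> p /pu ->; rewrite mulr1.
by rewrite (@wsumZ _ L _ (fun=> 1)) w1 mulr1.
Qed.

Lemma law_at_mix eps x y (a b : R) L1 L2 : 0 < eps -> segment_in eps x y ->
  0 < a -> 0 < b -> a + b = 1 -> law_at eps x L1 -> law_at eps y L2 ->
  law_at eps (a *: x + b *: y) (scale_law a L1 ++ scale_law b L2).
Proof.
move=> e0 seg a0 b0 ab [p1 g1 w1 m1 q1] [p2 g2 w2 m2 q2].
have sp c L : 0 < c -> positive_weights L -> positive_weights (scale_law c L).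
  by move=> c0 Lp p /mapP[q qL ->]; rewrite mulr_gt0 ?Lp.
split.
- by move=> p; rewrite mem_cat => /orP[]; apply: sp.
- apply: good_cat => //; do ?exact: good_scale.
  + by apply: positive_nonneg; exact: sp.
  + by apply: positive_nonneg; exact: sp.
  move=> c d c0 d0.
  have one L h : wsum L (fun v => 1 * h v) = wsum L h.
    by apply: wsum_ext => p _; rewrite mul1r.
  rewrite !(one _ id) !(one _ (fun v => v ^+ 2)) !wsum_scale w1 w2 m1 m2 q1 q2 !mulr1.
  rewrite !mulrA /small_variance.
  have ca0 : 0 <= c * a by rewrite mulr_ge0 // ltW.
  have db0 : 0 <= d * b by rewrite mulr_ge0 // ltW.
  move: (c * a) (d * b) ca0 db0 => p q p0 q0.
  have [z|nz] := eqVneq (p + q) 0.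
    have pz : p = 0 by lra. have qz : q = 0 by lra.
    by rewrite pz qz; lra.
  have pq0 : 0 < p + q by rewrite lt_def nz addr_ge0.
  have s1 : p / (p + q) + q / (p + q) = 1 by rewrite -mulrDl divff.
  have := seg (p / (p + q)) (q / (p + q)) (divr_ge0 p0 (ltW pq0)) (divr_ge0 q0 (ltW pq0)) s1.
  rewrite combE => /andP[_ /=] h.
  have pq2 : 0 < (p + q) ^+ 2 by rewrite exprn_gt0.
  move: h; rewrite -(ler_pM2l pq2).
  have -> : (p + q) ^+ 2 * (p / (p + q) * x.2 + q / (p + q) * y.2) =
      (p + q) * (p * x.2 + q * y.2) by field.
  have -> : (p + q) ^+ 2 * ((p / (p + q) * x.1 + q / (p + q) * y.1) ^+ 2 + eps ^+ 2) =
     (p * x.1 + q * y.1) ^+ 2 + eps ^+ 2 * (p + q) ^+ 2 by field.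
  lra.
- by rewrite wsum_cat !wsum_scale w1 w2 !mulr1.
- by rewrite wsum_cat !wsum_scale m1 m2 combE.
- by rewrite wsum_cat !wsum_scale q1 q2 combE.
Qed.

(** On the tangent through [x], the law is carried by the two ends. *)
Lemma law_at_exists (eps : R) x : 0 < eps -> Omega eps x -> exists L, law_at eps x L.
Proof.
move=> e0 xO; have s0 := depth_ge0 eps x; have se := depth_le (ltW e0) xO.
have [xE _] := tangentE xO; have sq := sqr_depth xO.
have [d|d] := eqVneq (depth eps x) eps.
  exists [:: (1, x.1)]; have -> : x = (x.1, x.1 ^+ 2); last exact: law_at_point.
  by rewrite [LHS]surjective_pairing; congr (_, _); rewrite d in sq; lra.
have {}se : depth eps x < eps by rewrite lt_neqAle d.
move: (depth eps x) s0 se xE => s s0 se xE.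
have ne : `|- eps| <= eps by rewrite normrN ger0_norm // ltW.
have pe : `|eps| <= eps by rewrite ger0_norm // ltW.
have c0 : 0 < (eps - s) / (2 * eps) by rewrite divr_gt0 ?subr_gt0 // mulr_gt0.
have d0 : 0 < (eps + s) / (2 * eps) by rewrite divr_gt0 ?mulr_gt0 //; lra.
have cd : (eps - s) / (2 * eps) + (eps + s) / (2 * eps) = 1.
  by field; rewrite gt_eqF.
have [t1 t2] := tangent_end eps (x.1 - s).
have := law_at_mix e0 (tangent_segment (x.1 - s) ne pe) c0 d0 cd.
rewrite tangent_comb // t1 t2 => /(_ _ _ (law_at_point _ _) (law_at_point _ _)).
rewrite (_ : tangent _ _ _ = x); first by move=> h; eexists; exact: h.
rewrite [RHS]xE; congr (tangent _ _ _); by field; rewrite gt_eqF.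
Qed.

Section Envelope.
Variables (eps k C : R) (f : R -> R).
Hypotheses (eps0 : 0 < eps) (fc : continuous f) (k0 : 0 < k) (ke : k * eps < 1).
Hypotheses (C0 : 0 <= C)
  (fC : forall t, `|f t| <= C * (expR (k * t) + expR (- (k * t)))).

Lemma law_exp x L : law_at eps x L ->
  wsum L (fun v => expR (k * v)) <= exp_major eps k x /\
  wsum L (fun v => expR (- (k * v))) <= exp_major eps k (- x.1, x.2).
Proof.
move=> [L0 gL w1 m1 m2].
have [ms _ bmo hI] := good_law_step (@ltr01 R) L0 w1 gL.
set phi := step L 0 1 in ms bmo hI.
have ec := @expR_affine_cont R k.
have eC t : `|expR (k * t)| <= 1 * (expR (k * t) + expR (- (k * t))).
  by rewrite mul1r ger0_norm ?expR_ge0 // lerDl expR_ge0.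
have LE := exp_Lambda eps0 k0 ke.
have [_ h1] := bmo_bellman eps0 ltr01 bmo ec k0 ke ler01 eC LE.
have [_ h2] := bmo_bellman eps0 ltr01 (bmo_itvN bmo) ec k0 ke ler01 eC LE.
have i1 : itv_integral 0 1 phi = x.1 by rewrite (hI id) subr0 mul1r.
have i2 : itv_integral 0 1 (fun t => phi t ^+ 2) = x.2.
  by rewrite (hI (fun v => v ^+ 2)) subr0 mul1r.
split.
  move: h1; rewrite (hI (fun t => expR (k * t))) !subr0 !mul1r /bellman_point.
  by rewrite i1 i2 !subr0 !divr1 -surjective_pairing.
move: h2; rewrite /bellman_point.
have -> : itv_integral 0 1 (fun t => - phi t) = - x.1.
  rewrite (hI (fun v => - v)) subr0 mul1r -m1 -mulN1r -wsumZ.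
  by apply: wsum_ext => p _; rewrite mulN1r.
have -> : itv_integral 0 1 (fun t => (- phi t) ^+ 2) = x.2.
  by rewrite -i2; congr (itv_integral _ _ _); apply/funext => t; rewrite sqrrN.
rewrite !subr0 !divr1 mul1r; apply: le_trans.
rewrite -[X in _ <= X]/(itv_integral 0 1 ((fun v => expR (k * - v)) \o phi)).
rewrite (hI (fun v => expR (k * - v))) subr0 mul1r.
by rewrite le_eqVlt; apply/orP; left; apply/eqP; apply: wsum_ext => p _; rewrite mulrN.
Qed.

Definition law_envelope x : R := sup [set wsum L f | L in law_at eps x].

Definition ceiling x : R := C * (exp_major eps k x + exp_major eps k (- x.1, x.2)).

Lemma law_ceiling x L : law_at eps x L -> wsum L f <= ceiling x.
Proof.
move=> Lx; have [h1 h2] := law_exp Lx; have [L0 _ _ _ _] := Lx.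
apply: (@le_trans _ _ (wsum L (fun v => C * (expR (k * v) + expR (- (k * v)))))).
  apply: ler_wsum; first exact: positive_nonneg.
  by move=> p _; apply: le_trans (ler_norm _) (fC _).
rewrite (@wsumZ _ L C (fun v => _ + _)) wsumD ler_wpM2l // lerD //.
Qed.

Lemma law_envelope_ub x L : law_at eps x L -> wsum L f <= law_envelope x.
Proof.
move=> Lx; apply: ub_le_sup; last by exists L.
by exists (ceiling x) => _ [L' Lx' <-]; exact: law_ceiling.
Qed.

Lemma law_envelope_le x M : Omega eps x -> (forall L, law_at eps x L -> wsum L f <= M) ->
  law_envelope x <= M.
Proof.
move=> xO h; apply: ge_sup; last by move=> _ [L Lx <-]; exact: h.
by have [L Lx] := law_at_exists eps0 xO; exists (wsum L f), L.
Qed.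

Lemma law_envelope_boundary u : law_envelope (u, u ^+ 2) = f u.
Proof.
have uO : Omega eps (u, u ^+ 2) by rewrite /Omega /= lexx lerDl sqr_ge0.
apply/eqP; rewrite eq_le; apply/andP; split.
  by apply: law_envelope_le => // L /law_at_boundary ->.
by have := law_envelope_ub (law_at_point eps u); rewrite (law_at_boundary f (law_at_point eps u)).
Qed.

Lemma law_envelope_concave : locally_concave eps law_envelope.
Proof.
move=> x y seg a b; rewrite le_eqVlt => /predU1P[<-|a0].
  by rewrite add0r => _ ->; rewrite !scale0r !scale1r !add0r mul0r mul1r add0r.
rewrite le_eqVlt => /predU1P[<-|b0].
  by rewrite addr0 => ->; rewrite !scale0r !scale1r !addr0 mul0r mul1r addr0.
move=> ab; have [xO yO] := segment_in_ends seg.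
set z := a *: x + b *: y.
have h L1 L2 : law_at eps x L1 -> law_at eps y L2 ->
    a * wsum L1 f + b * wsum L2 f <= law_envelope z.
  move=> l1 l2; have := law_envelope_ub (law_at_mix eps0 seg a0 b0 ab l1 l2).
  by rewrite wsum_cat !wsum_scale.
have h1 L2 : law_at eps y L2 -> law_envelope x <= (law_envelope z - b * wsum L2 f) / a.
  move=> l2; apply: law_envelope_le => // L1 l1.
  by rewrite ler_pdivlMr // mulrC lerBrDr h.
have : law_envelope y <= (law_envelope z - a * law_envelope x) / b.
  apply: law_envelope_le => // L2 l2; have := h1 L2 l2.
  by rewrite !ler_pdivlMr // [X in X <= _ -> _]mulrC [X in _ -> X <= _]mulrC; lra.
by rewrite ler_pdivlMr //; lra.
Qed.


Lemma exp_major_bound K x : Omega eps x -> x.1 <= K ->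
  exp_major eps k x <= expR (- (k * eps)) / (1 - k * eps) * (expR (k * K) * expR (k * eps)).
Proof.
move=> xO xK; have s0 := depth_ge0 eps x; have se := depth_le (ltW eps0) xO.
have C1 : 0 <= expR (- (k * eps)) / (1 - k * eps).
  by rewrite divr_ge0 ?expR_ge0 // subr_ge0 ltW.
rewrite /exp_major ler_wpM2l // ler_pM ?expR_ge0 //.
- rewrite /exp_plane subrr mulr0 addr0 mulr_ge0 ?expR_ge0 // subr_ge0.
  by apply: le_trans (ltW ke); rewrite ler_pM2l.
- by rewrite ler_expR ler_pM2l.
- rewrite /exp_plane subrr mulr0 addr0 -[leRHS]mulr1 ler_pM ?expR_ge0 //.
  + by rewrite subr_ge0; apply: le_trans (ltW ke); rewrite ler_pM2l.
  + by rewrite ler_expR ler_pM2l.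
  + by rewrite gerBl mulr_ge0 // ltW.
Qed.

Lemma reflect_in x : Omega eps x -> Omega eps (- x.1, x.2).
Proof. by rewrite /Omega /= sqrrN. Qed.

Lemma law_envelope_bounded K : 0 <= K ->
  exists2 M : R, 0 <= M & forall x, Omega eps x -> `|x.1| <= K -> `|law_envelope x| <= M.
Proof.
move=> K0; have K1 : 0 <= K + 2 * eps by rewrite addr_ge0 // mulr_ge0 // ltW.
have [B B0 hB] := continuous_bounded fc K1.
pose D := expR (- (k * eps)) / (1 - k * eps) * (expR (k * K) * expR (k * eps)).
have D0 : 0 <= D.
  apply: mulr_ge0; last by rewrite mulr_ge0 ?expR_ge0.
  by rewrite divr_ge0 ?expR_ge0 // subr_ge0 ltW.
exists (B + C * (D + D)); first by rewrite addr_ge0 // mulr_ge0 // addr_ge0.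
move=> x xO xK; have CD : 0 <= C * (D + D) by rewrite mulr_ge0 // addr_ge0.
rewrite ler_norml; apply/andP; split.
  apply: (@le_trans _ _ (- B)); first by rewrite lerN2 lerDl.
  apply: (concave_floor eps0 law_envelope_concave xO xK) => u uK.
  by rewrite law_envelope_boundary; have := hB u uK; rewrite ler_norml => /andP[].
apply: (@le_trans _ _ (C * (D + D))); last by rewrite lerDr.
apply: law_envelope_le => // L Lx; apply: (le_trans (law_ceiling Lx)).
move: xK; rewrite ler_norml => /andP[x1 x2].
rewrite ler_wpM2l // lerD // exp_major_bound //=; first exact: reflect_in.
by rewrite lerNl.
Qed.

(** The tangent through [x0] with contact on its left meets the tangent through
    [x] with contact on its right in a point of the strip near both; along
    either tangent [tangent_lipschitz] applies, because the three points stay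
    away from the ends. *)
Lemma law_envelope_cont_inside x0 e : Omega eps x0 -> depth eps x0 < eps -> 0 < e ->
  exists2 d : R, 0 < d & forall x, Omega eps x ->
    `|x0.1 - x.1| < d -> `|x0.2 - x.2| < d -> `|law_envelope x0 - law_envelope x| <= e.
Proof.
move=> xO0 s0e e0; set s0 := depth eps x0 in s0e.
have s00 : 0 <= s0 := depth_ge0 _ _.
(* A margin: on the tangents used below, all the points are at horizontal
   distance at most s0 + eta = eps - eta from the point of contact. *)
pose eta := (eps - s0) / 2; have eta0 : 0 < eta by rewrite /eta; lra.
pose K := `|x0.1| + 1 + 2 * eps.
have K0 : 0 <= K by rewrite /K; have := normr_ge0 x0.1; lra.
have [M M0 hM] := law_envelope_bounded K0.
pose q := 2 * M / eta + 1.
have q0 : 0 < q.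
  have : 0 <= 2 * M / eta by apply: divr_ge0; [exact: mulr_ge0|exact: ltW].
  by rewrite /q; lra.
have [r [r0 r1 r2 r3]] : exists r, [/\ 0 < r, r <= 1, r <= eta & r <= e / (2 * q)].
  exists (Num.min 1 (Num.min eta (e / (2 * q)))); split; rewrite ?ge_min ?lexx ?orbT //.
  by rewrite !lt_min ltr01 eta0 divr_gt0 // mulr_gt0.
have /cvgrPdist_lt/(_ _ r0)/nbhs_ballP[d' /= d'0 hd'] := @depth_continuous R eps x0.
exists (Num.min r d'); first by rewrite lt_min r0 d'0.
move=> x xO; rewrite !lt_min => /andP[xr xd1] /andP[_ xd2].
have sr : `|s0 - depth eps x| < r by apply: hd'.
set s := depth eps x in sr.
have ss0 : 0 <= s := depth_ge0 _ _.
have [xE0 _] := tangentE xO0; have [_ xE] := tangentE xO.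
rewrite -/s0 in xE0; rewrite -/s in xE.
set a0 := x0.1 - s0 in xE0; set b := x.1 + s in xE.
(* The common point of the tangents with contact abscissae a0 and b. *)
have midE : tangent eps a0 ((b - a0) / 2) = tangent eps b ((a0 - b) / 2).
  by rewrite /tangent; congr (_, _); field.
move: xr sr; rewrite !ltr_norml => /andP[xr1 xr2] /andP[sr1 sr2].
have x0K := ler_norm x0.1; have x0K' := ler_norm (- x0.1); rewrite normrN in x0K'.
have etaE : eps - eta = s0 + eta by rewrite /eta; field.
have m1 : `|(b - a0) / 2| <= eps - eta.
  rewrite ler_norml etaE /a0 /b; clear - eps0 fc k0 ke C0 fC xr1 xr2 sr1 sr2 r0 r2 s00 ss0 eta0.
  by apply/andP; split; lra.
have m2 : `|(a0 - b) / 2| <= eps - eta.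
  rewrite ler_norml etaE /a0 /b; clear - eps0 fc k0 ke C0 fC xr1 xr2 sr1 sr2 r0 r2 s00 ss0 eta0.
  by apply/andP; split; lra.
have n1 : `|s0| <= eps - eta by rewrite ger0_norm // etaE; lra.
have n2 : `|- s| <= eps - eta by rewrite normrN ger0_norm // etaE; lra.
have bd a : `|a| <= K - eps -> forall th, `|th| <= eps -> `|law_envelope (tangent eps a th)| <= M.
  move=> aK th the; apply: hM; first exact: tangent_in.
  by rewrite /tangent /= (le_trans (ler_normD _ _)) //; lra.
have a0K : `|a0| <= K - eps.
  rewrite ler_norml /K /a0; clear - eps0 fc k0 ke C0 fC x0K x0K' s0e s00.
  by apply/andP; split; lra.
have bK : `|b| <= K - eps.
  rewrite ler_norml /K /b; clear - eps0 fc k0 ke C0 fC x0K x0K' xr1 xr2 sr1 sr2 r0 r1 r2 etaE s0e s00 ss0.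
  by apply/andP; split; lra.
have t1 := tangent_lipschitz law_envelope_concave (bd _ a0K) eta0 n1 m1.
have t2 := tangent_lipschitz law_envelope_concave (bd _ bK) eta0 m2 n2.
rewrite -xE0 in t1; rewrite -xE -midE in t2.
have h1 : `|s0 - (b - a0) / 2| <= r.
  rewrite ler_norml /a0 /b; clear - eps0 fc k0 ke C0 fC xr1 xr2 sr1 sr2.
  by apply/andP; split; lra.
have h2 : `|(a0 - b) / 2 - - s| <= r.
  rewrite ler_norml /a0 /b; clear - eps0 fc k0 ke C0 fC xr1 xr2 sr1 sr2.
  by apply/andP; split; lra.
have Q0 : 0 <= 2 * M / eta by apply: divr_ge0; [exact: mulr_ge0|exact: ltW].
have t1' : `|law_envelope x0 - law_envelope (tangent eps a0 ((b - a0) / 2))| <= q * r.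
  by apply: (le_trans t1); rewrite ler_pM // /q lerDl.
have t2' : `|law_envelope (tangent eps a0 ((b - a0) / 2)) - law_envelope x| <= q * r.
  by apply: (le_trans t2); rewrite ler_pM // /q lerDl.
have qr : q * r <= e / 2.
  have -> : e / 2 = q * (e / (2 * q)) by field; rewrite gt_eqF.
  by rewrite ler_pM2l.
rewrite -(subrKA (law_envelope (tangent eps a0 ((b - a0) / 2)))).
by rewrite (le_trans (ler_normD _ _)) //; clear - eps0 fc k0 ke C0 fC t1' t2' qr; lra.
Qed.


(** Near [u] this is continuity.  Far from [u] the hyperbolic cosine is
    comparable to the exponential, which dominates [f]. *)
Lemma boundary_majorant u eta : 0 < eta -> exists2 K : R, 0 <= K &
  forall v, f v <= f u + eta + K * (expR (k * (v - u)) + expR (- (k * (v - u))) - 2).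
Proof.
move=> eta0.
have /cvgrPdist_le/(_ _ eta0)/nbhs_ballP[rho /= rho0 hrho] := @fc u.
pose q := 1 - expR (- (k * rho)).
have q0 : 0 < q by rewrite subr_gt0 expR_lt1 oppr_lt0 mulr_gt0.
pose A := 2 * C * expR (k * `|u|) + `|f u|.
have A0 : 0 <= A by rewrite addr_ge0 // mulr_ge0 ?expR_ge0 // mulr_ge0.
exists (A / q ^+ 2); first by rewrite divr_ge0 // sqr_ge0.
move=> v; set y := k * (v - u).
have -> : expR y + expR (- y) - 2 = expR `|y| * (1 - expR (- `|y|)) ^+ 2.
  have -> : expR y + expR (- y) = expR `|y| + expR (- `|y|).
    have [y0|y0] := leP 0 y; first by rewrite ger0_norm.
    by rewrite (ltr0_norm y0) opprK addrC.
  have e := expRxMexpNx_1 `|y|.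
  move: (expR `|y|) (expR (- `|y|)) e => Y Z e.
  have -> : Y * (1 - Z) ^+ 2 = Y - 2 * (Y * Z) + (Y * Z) * Z by ring.
  by rewrite e; ring.
have K0 : 0 <= A / q ^+ 2 by rewrite divr_ge0 // sqr_ge0.
have [near|far] := ltP `|u - v| rho.
  have := hrho v near; rewrite ler_norml => /andP[h _].
  have : 0 <= A / q ^+ 2 * (expR `|y| * (1 - expR (- `|y|)) ^+ 2).
    by rewrite mulr_ge0 // mulr_ge0 ?expR_ge0 // sqr_ge0.
  lra.
have yE : `|y| = k * `|u - v| by rewrite /y normrM (gtr0_norm k0) distrC.
have yrho : k * rho <= `|y| by rewrite yE ler_pM2l.
have qy : q ^+ 2 <= (1 - expR (- `|y|)) ^+ 2.
  have qy : q <= 1 - expR (- `|y|) by rewrite lerD2l lerN2 ler_expR lerN2.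
  by rewrite ler_pXn2r ?nnegrE ?(ltW q0) ?(le_trans (ltW q0)).
have Y1 : 1 <= expR `|y| by rewrite -expR0 ler_expR.
have fv : f v - f u <= A * expR `|y|.
  have h1 : k * v <= k * `|u| + `|y|.
    have : y <= `|y| by exact: ler_norm.
    have : k * u <= k * `|u| by rewrite ler_pM2l // ler_norm.
    rewrite /y; lra.
  have h2 : - (k * v) <= k * `|u| + `|y|.
    have : - y <= `|y| by rewrite -normrN; exact: ler_norm.
    have : k * - u <= k * `|u| by rewrite ler_pM2l // -normrN ler_norm.
    rewrite /y; lra.
  have e1 : expR (k * v) + expR (- (k * v)) <= 2 * (expR (k * `|u|) * expR `|y|).
    by rewrite -expRD mulr_natl mulr2n lerD // ler_expR.
  have e2 := le_trans (le_trans (ler_norm _) (fC v)) (ler_wpM2l C0 e1).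
  have e3 : - f u <= `|f u| by rewrite -normrN; exact: ler_norm.
  have e4 : `|f u| <= `|f u| * expR `|y| by rewrite ler_peMr.
  rewrite /A; lra.
have : A * expR `|y| <= A / q ^+ 2 * (expR `|y| * (1 - expR (- `|y|)) ^+ 2).
  have -> : A * expR `|y| = A / q ^+ 2 * (expR `|y| * q ^+ 2) by field; rewrite gt_eqF.
  by rewrite ler_wpM2l // ler_wpM2l // expR_ge0.
lra.
Qed.

(** Squeezed between the chord of [concave_chord] and the bound obtained by
    integrating [boundary_majorant]; both are continuous functions of [x], with
    values f u and f u + e / 2 at (u, u^2). *)
Lemma law_envelope_cont_boundary u e : 0 < e ->
  exists2 d : R, 0 < d & forall x, Omega eps x ->
    `|u - x.1| < d -> `|u ^+ 2 - x.2| < d -> `|f u - law_envelope x| <= e.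
Proof.
move=> e0; have e20 : 0 < e / 2 by rewrite divr_gt0.
have [K K0 hK] := boundary_majorant u e20.
pose Up x := f u + e / 2 + K * (expR (- (k * u)) * exp_major eps k x
   + expR (k * u) * exp_major eps k (- x.1, x.2) - 2).
pose Lo x := (eps - depth eps x) / (2 * eps) * f (x.1 - depth eps x - eps)
   + (eps + depth eps x) / (2 * eps) * f (x.1 - depth eps x + eps).
have reflc : continuous (fun x : R * R => (- x.1, x.2)).
  move=> x; apply: (@cvg_pair _ _ _ _ (nbhs _) (nbhs _)); last exact: cvg_snd.
  by apply: cvgN; exact: cvg_fst.
have ec := @exp_major_continuous R eps k.
have Upc : continuous Up.
  move=> x; apply: cvgD; first exact: cvg_cst.
  apply: cvgM; first exact: cvg_cst.
  apply: cvgB; last exact: cvg_cst.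
  apply: cvgD; apply: cvgM; try exact: cvg_cst; first exact: ec.
  by apply: (@continuous_comp _ _ _ (fun x : R * R => (- x.1, x.2)) (exp_major eps k));
    [exact: reflc|exact: ec].
have dc := @depth_continuous R eps.
have Loc : continuous Lo.
  move=> x; apply: cvgD; apply: cvgM.
  - apply: cvgM; last exact: cvg_cst.
    by apply: cvgB; [exact: cvg_cst|exact: dc].
  - apply: (@continuous_comp _ _ _ (fun x : R * R => x.1 - depth eps x - eps) f); last exact: fc.
    apply: cvgB; last exact: cvg_cst.
    by apply: cvgB; [exact: cvg_fst|exact: dc].
  - apply: cvgM; last exact: cvg_cst.
    by apply: cvgD; [exact: cvg_cst|exact: dc].
  - apply: (@continuous_comp _ _ _ (fun x : R * R => x.1 - depth eps x + eps) f); last exact: fc.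
    apply: cvgD; last exact: cvg_cst.
    by apply: cvgB; [exact: cvg_fst|exact: dc].
have d0 : depth eps (u, u ^+ 2) = eps.
  by rewrite /depth /= subrr subr0 sqrtr_sqr gtr0_norm.
have Up0 : Up (u, u ^+ 2) = f u + e / 2.
  rewrite /Up /= exp_major_boundary ?ltW //.
  have -> : (- u, u ^+ 2) = (- u, (- u) ^+ 2) by rewrite sqrrN.
  rewrite exp_major_boundary ?ltW // mulrN [expR (- _) * _]mulrC !expRxMexpNx_1.
  by ring.
have Lo0 : Lo (u, u ^+ 2) = f u.
  rewrite /Lo d0 /= subrr !mul0r add0r subrK.
  by rewrite (_ : (eps + eps) / (2 * eps) = 1) ?mul1r //; field; rewrite gt_eqF.
have /cvgrPdist_le/(_ _ e20)/nbhs_ballP[d1 /= d10 h1] := Upc (u, u ^+ 2).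
have /cvgrPdist_le/(_ _ e0)/nbhs_ballP[d2 /= d20 h2] := Loc (u, u ^+ 2).
exists (Num.min d1 d2); first by rewrite lt_min d10.
move=> x xO; rewrite !lt_min => /andP[x1 x2] /andP[y1 y2].
have up : law_envelope x <= Up x.
  apply: law_envelope_le => // L Lx; have [g1 g2] := law_exp Lx; have [L0 _ w1 _ _] := Lx.
  have hle : wsum L f <= wsum L (fun v => (f u + e / 2 - 2 * K) * 1
      + K * (expR (- (k * u)) * expR (k * v) + expR (k * u) * expR (- (k * v)))).
    apply: ler_wsum; first exact: positive_nonneg.
    move=> p _; apply: le_trans (hK p.2) _; rewrite -!expRD.
    have -> : k * (p.2 - u) = - (k * u) + k * p.2 by ring.
    have -> : - (- (k * u) + k * p.2) = k * u + - (k * p.2) by ring.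
    by rewrite le_eqVlt; apply/orP; left; apply/eqP; ring.
  apply: (le_trans hle).
  rewrite (@wsumD _ L (fun v => _ * 1)) (@wsumZ _ L _ (fun=> 1)) w1 mulr1.
  rewrite (@wsumZ _ L K (fun v => _ + _)) (@wsumD _ L (fun v => _ * expR (k * v))).
  rewrite (@wsumZ _ L _ (fun v => expR (k * v))) (@wsumZ _ L _ (fun v => expR (- (k * v)))).
  rewrite /Up.
  have s1 := ler_wpM2l (expR_ge0 (- (k * u))) g1.
  have s2 := ler_wpM2l (expR_ge0 (k * u)) g2.
  apply: (le_trans (lerD (lexx _) (ler_wpM2l K0 (lerD s1 s2)))).
  by rewrite le_eqVlt; apply/orP; left; apply/eqP; ring.
have lo : Lo x <= law_envelope x.
  by have := concave_chord eps0 law_envelope_concave xO; rewrite /= !law_envelope_boundary.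
have := h1 x; rewrite Up0 => /(_ (conj x1 y1)).
have := h2 x; rewrite Lo0 => /(_ (conj x2 y2)).
rewrite !ler_norml => /andP[_ l2] /andP[u1 _].
by apply/andP; split; move: (Up x) (Lo x) (law_envelope x) up lo l2 u1 => U V W *; lra.
Qed.

Lemma law_envelope_Lambda : Lambda eps f law_envelope.
Proof.
split; [exact: law_envelope_concave| |exact: law_envelope_boundary].
apply/within_continuous_dist => x e xO e0.
have se := depth_le (ltW eps0) xO.
have [d|d] := eqVneq (depth eps x) eps; last first.
  by apply: law_envelope_cont_inside => //; rewrite lt_neqAle d.
have xE : x = (x.1, x.1 ^+ 2).
  rewrite [LHS]surjective_pairing; congr (_, _).
  by have := sqr_depth xO; rewrite d; lra.
have [r r0 hr] := law_envelope_cont_boundary x.1 e0; exists r => // y yO h1 h2.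
rewrite {1}xE law_envelope_boundary; apply: hr => //.
by rewrite {1}xE /= in h2.
Qed.

End Envelope.

End MinimalConcave.

(** * The Bellman function is the envelope *)

Section Assembly.
Context {R : realType}.
Implicit Types (x : R * R) (L : seq (R * R)) (G : R * R -> R).

Lemma Lambda_ext (eps : R) (f : R -> R) G G' : 0 <= eps ->
  (forall x, Omega eps x -> G' x = G x) -> Lambda eps f G -> Lambda eps f G'.
Proof.
move=> e0 e [cG contG bG]; split.
- move=> x y s a b a0 b0 ab; have [xO yO] := segment_in_ends s.
  by rewrite !e //; [exact: cG|exact: s].
- apply/within_continuous_dist => x d xO d0.
  have [r r0 hr] := (within_continuous_dist _ _).1 contG x d xO d0.
  by exists r => // y yO h1 h2; rewrite !e //; exact: hr.
- move=> u; rewrite e ?bG // /Omega /= lexx lerDl sqr_ge0 //.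
Qed.

Section OnInterval.
Variables (eps k C a b : R) (l r : bool) (f : R -> R).
Hypotheses (eps0 : 0 < eps) (ab : a < b) (fc : continuous f) (k0 : 0 < k) (ke : k * eps < 1).
Hypotheses (C0 : 0 <= C)
  (fC : forall t, `|f t| <= C * (expR (k * t) + expR (- (k * t)))).

Let I := Interval (BSide l a) (BSide r b).

(** The quantile function of the law is admissible in the definition of the
    Bellman function. *)
Lemma law_le_Bellman x L : law_at eps x L -> ((wsum L f)%:E <= Bellman I eps f x)%E.
Proof.
move=> [L0 gL w1 m1 m2].
have [ms bs bmo hI] := good_law_step ab L0 w1 gL.
have ba0 : b - a != 0 by rewrite gt_eqF ?subr_gt0.
have avgh h : avg I (h \o step L a b) = (wsum L h)%:E.
  rewrite avg_itv_integral //; first by rewrite hI mulrAC divff // mul1r.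
  exact: step_integrable.
apply: ereal_sup_ubound; exists (step L a b); last exact: avgh.
split; first exact: bmo_itv_BMO.
- by rewrite -m1; exact: (avgh id).
- by rewrite -m2; exact: (avgh (fun v => v ^+ 2)).
Qed.

Lemma Bellman_le G x : Lambda eps f G -> (Bellman I eps f x <= (G x)%:E)%E.
Proof.
move=> LG; apply: ge_ereal_sup => _ [phi [bphi e1 e2] <-].
have ba0 : 0 < b - a by rewrite subr_gt0.
have bmo := BMO_bmo_itv ab bphi e2; have [i1 i2 _] := bmo.
have [ifphi le] := bmo_bellman eps0 ab bmo fc k0 ke C0 fC LG.
move: e1 e2; rewrite !avg_itv_integral // => -[e1] [e2].
rewrite lee_fin ler_pdivrMr // mulrC; apply: (le_trans le).
by rewrite /bellman_point e1 e2 -surjective_pairing.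
Qed.

Lemma BellmanE x : Omega eps x -> Bellman I eps f x = (law_envelope eps f x)%:E.
Proof.
move=> xO; have up := Bellman_le x (law_envelope_Lambda eps0 fc k0 ke C0 fC).
apply/eqP; rewrite eq_le up /=.
have [L Lx] := law_at_exists eps0 xO; have low := law_le_Bellman Lx.
have fin : Bellman I eps f x \is a fin_num.
  rewrite fin_real // (lt_le_trans _ low) ?ltNyr //= (le_lt_trans up) ?ltry //.
rewrite -(fineK fin) lee_fin; apply: law_envelope_le => // L' Lx'.
by rewrite -lee_fin fineK //; exact: law_le_Bellman.
Qed.

End OnInterval.
End Assembly.

Unset Implicit Arguments.

Theorem mainTheorem1 (R : realType) (I : interval R) (eps0 : R) (N : nat)
    (f : R -> R) :
  bounded_interval I -> 0 < eps0 -> frakWN eps0 N f ->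
  forall eps : R, 0 < eps -> eps < eps0 ->
    [/\ forall x : R * R, Omega eps x -> Bellman I eps f x \is a fin_num,
        Lambda eps f (fun x => fine (Bellman I eps f x)) &
        forall x : R * R, Omega eps x ->
          Bellman I eps f x = ereal_inf [set (G x)%:E | G in Lambda eps f]].
Proof.
move=> bI eps00 [[fC2 wf wf' _ _] _] eps e0 ee0.
have fc := derivable_continuous (let: And3 d _ _ := fC2 in d).
have [C C0 fC] := growth_bound eps00 fC2 wf wf'.
have k0 : 0 < eps0^-1 by rewrite invr_gt0.
have ke : eps0^-1 * eps < 1 by rewrite mulrC ltr_pdivrMr // mul1r.
have {}fC t : `|f t| <= C * (expR (eps0^-1 * t) + expR (- (eps0^-1 * t))).
  apply: le_trans (fC t) _; rewrite ler_wpM2l // mulrC.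
  have [t0|t0] := leP 0 t; first by rewrite (ger0_norm t0) lerDl expR_ge0.
  by rewrite (ltr0_norm t0) mulrN lerDr expR_ge0.
have [a [b [l [r [ab ->]]]]] := bounded_intervalE bI.
have BE := BellmanE l r e0 ab fc k0 ke C0 fC.
have cL := law_envelope_Lambda e0 fc k0 ke C0 fC.
split.
- by move=> x xO; rewrite BE.
- by apply: Lambda_ext cL; [exact: ltW|move=> x xO; rewrite BE].
- move=> x xO; apply/eqP; rewrite eq_le; apply/andP; split.
    by apply: le_ereal_inf_tmp => _ [G LG <-]; exact: (Bellman_le l r e0 ab fc k0 ke C0 fC).
  by apply: ge_ereal_inf; exists (law_envelope eps f x)%:E; [exists (law_envelope eps f)|rewrite BE].
Qed.
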